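(* Let $q>0$ and let $\mathcal{A}=\mathbb{C}\langle a,a^*\mid aa^*=qa^*a+\mathbf 1\rangle$ be the $q$-oscillator $*$-algebra, with the $\mathbb{Z}$-grading $\mathcal{A}=\bigoplus_{n\in\mathbb{Z}}\mathcal{A}_n$ determined by $a\in\mathcal{A}_1$, $a^*\in\mathcal{A}_{-1}$. Then every irreducible well-behaved $*$-representation $\pi$ of $\mathcal{A}$ is induced from a one-dimensional $*$-representation; that is, there exist a subgroup $H\subseteq\mathbb{Z}$ and an inducible one-dimensional $*$-representation $\rho$ of $\mathcal{A}_H=\bigoplus_{n\in H}\mathcal{A}_n$ such that $\pi$ is unitarily equivalent to $\mathrm{Ind}_{\mathcal{A}_H\uparrow\mathcal{A}}\rho$.
   Context: **$*$-representations.** A $*$-representation $\pi$ of a unital $*$-algebra $\mathcal{A}$ on a dense linear subspace $\mathcal{D}(\pi)$ of a Hilbert space $\mathcal{H}_\pi$ is an algebra homomorphism from $\mathcal{A}$ into the linear operators $\mathcal{D}(\pi)\to\mathcal{D}(\pi)$ with $\langle\pi(x)\varphi,\psi\rangle=\langle\varphi,\pi(x^* )\psi\rangle$ for $\varphi,\psi\in\mathcal{D}(\pi)$, $x\in\mathcal{A}$. The graph topology on $\mathcal{D}(\pi)$ is given by the norms $\varphi\mapsto\|\varphi\|+\|\pi(x)\varphi\|$, $x\in\mathcal{A}$. $\pi$ is closed if $\mathcal{D}(\pi)$ is complete in it; the closure of $\pi$ is the $*$-representation $x\mapsto\overline{\pi(x)}$ restricted to the completion of $\mathcal{D}(\pi)$.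 $\pi_1,\pi_2$ are unitarily equivalent if $\pi_2(x)=U\pi_1(x)U^{-1}$ for all $x$, for an isometric linear map $U$ of $\mathcal{D}(\pi_1)$ onto $\mathcal{D}(\pi_2)$. $\pi$ with $\mathcal D(\pi)\ne\{0\}$ is irreducible if $\pi=\pi_1\oplus\pi_2$ (on $\mathcal{D}(\pi_1)\oplus\mathcal{D}(\pi_2)$) is only possible with $\mathcal{D}(\pi_1)=\{0\}$ or $\mathcal{D}(\pi_2)=\{0\}$. **Partial action.** $\mathcal{B}:=\mathcal{A}_0$ is commutative. $\widehat{\mathcal{B}}$ is the set of characters (nonzero $*$-homomorphisms $\mathcal{B}\to\mathbb{C}$), with the weak topology defined by the functions $\widehat b(\chi)=\chi(b)$, $b\in\mathcal B$, and its Borel structure. $\widehat{\mathcal{B}}^+$ is the set of $\chi\in\widehat{\mathcal{B}}$ with $\chi(c^*c)\ge0$ for all homogeneous $c\in\bigcup_n\mathcal{A}_n$. For $n\in\mathbb{Z}$, $\mathcal{D}_{-n}$ is the set of $\chi\in\widehat{\mathcal{B}}^+$ with $\chi(c^*c)\neq0$ for some $c\in\mathcal{A}_n$, and $\alpha_n:\mathcal{D}_{-n}\to\mathcal{D}_n$ is $(\alpha_n(\chi))(b)=\chi(c^*bc)/\chi(c^*c)$, $b\in\mathcal{B}$, for any such $c$ (independent of the choice). **Well-behaved.** A closed $*$-representation $\pi$ of $\mathcal{A}$ is well-behaved if: (i) the restriction of $\pi$ to $\mathcal{B}$ is integrable (i.e. $\overline{\pi(b)}$ is normal for every $b\in\mathcal{B}$)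 and there is a spectral measure $E_\pi$ on $\widehat{\mathcal{B}}^+$ with $\overline{\pi(b)}=\int_{\widehat{\mathcal{B}}^+}\widehat b(\chi)\,dE_\pi(\chi)$ for $b\in\mathcal{B}$; (ii) for all $n\in\mathbb{Z}$, $c\in\mathcal{A}_n$ and Borel $\Delta\subseteq\widehat{\mathcal{B}}^+$, $\pi(c)E_\pi(\Delta)\supseteq E_\pi(\alpha_n(\Delta\cap\mathcal{D}_{-n}))\pi(c)$. **Induction.** Let $H\subseteq\mathbb{Z}$ be a subgroup and $p:\mathcal{A}\to\mathcal{A}_H$ the canonical projection. A $*$-representation $\rho$ of $\mathcal{A}_H$ is inducible if the sesquilinear form $\langle\sum_k x_k\otimes\varphi_k,\sum_l y_l\otimes\psi_l\rangle_0=\sum_{k,l}\langle\rho(p(y_l^*x_k))\varphi_k,\psi_l\rangle$ is positive semidefinite on $\mathcal{A}\otimes_{\mathcal{A}_H}\mathcal{D}(\rho)$. Then $\mathrm{Ind}_{\mathcal{A}_H\uparrow\mathcal{A}}\rho$ is the closure of the $*$-representation $\pi(x)[\sum_i a_i\otimes\varphi_i]=[\sum_i xa_i\otimes\varphi_i]$ on the quotient of $\mathcal{A}\otimes_{\mathcal{A}_H}\mathcal{D}(\rho)$ by the kernel of $\langle\cdot,\cdot\rangle_0$. *)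

(* Defs.v *)
From HB Require Import structures.
From mathcomp Require Import all_boot all_order all_algebra.
From mathcomp Require Import all_classical all_reals all_analysis.
From mathcomp Require Import complex.
Set Implicit Arguments.
Unset Strict Implicit.
Unset Printing Implicit Defensive.
Import Order.TTheory GRing.Theory Num.Theory.
Import numFieldNormedType.Exports.
Local Open Scope quotient_scope.
Local Open Scope classical_set_scope.
Local Open Scope ring_scope.

HB.mixin Record Algebra_isStarAlgebra (R : realType) A
    of GRing.Algebra R[i] A := {
  star : A -> A;
  starD : forall x y, star (x + y) = star x + star y;
  starZ : forall (c : R[i]) x, star (c *: x) = c^* *: star x;
  starM : forall x y, star (x * y) = star y * star x;
  starK : involutive star }.

#[short(type="starAlgType")]
HB.structure Definition StarAlgebra (R : realType) :=
  {A of GRing.Algebra R[i] A & Algebra_isStarAlgebra R A}.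

HB.mixin Record CompleteNormedModule_isHilbert (R : realType) E
    of CompleteNormedModule R[i] E := {
  inner : E -> E -> R[i];
  inner_linearl : forall (c : R[i]) u v w,
    inner (c *: u + v) w = c * inner u w + inner v w;
  innerC : forall u v, inner v u = (inner u v)^*;
  inner_norm : forall u, inner u u = `|u| ^+ 2 }.

#[short(type="hilbertType")]
HB.structure Definition Hilbert (R : realType) :=
  {E of CompleteNormedModule R[i] E & CompleteNormedModule_isHilbert R E}.

Section StarTheory.
Context (R : realType) (A : starAlgType R).
Implicit Types x : A.
Lemma star0 : star (0 : A) = 0.
Proof. by apply: (addIr (star (0 : A))); rewrite -starD !add0r. Qed.
Lemma star1 : star (1 : A) = 1.
Proof. by rewrite -[RHS]starK -[star 1 in RHS]mulr1 starM starK mulr1. Qed.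
End StarTheory.

(* [gr n] is the homogeneous component A_n. *)
Record grading (R : realType) (A : starAlgType R) := Grading {
  comp :> int -> set A;
  comp0 : forall n, comp n 0;
  comp_linear : forall n (c : R[i]) x y,
    comp n x -> comp n y -> comp n (c *: x + y);
  comp1 : comp 0 1;
  compM : forall m n x y, comp m x -> comp n y -> comp (m + n) (x * y);
  comp_star : forall n x, comp n x -> comp (- n) (star x);
  comp_span : forall x, exists s : seq A,
    (forall y, y \in s -> exists n, comp n y) /\ x = \sum_(y <- s) y;
  comp_direct : forall (s : seq int) (f : int -> A), uniq s ->
    (forall n, comp n (f n)) -> \sum_(n <- s) f n = 0 ->
    forall n, n \in s -> f n = 0 }.

Inductive graded_span (R : realType) (A : starAlgType R) (gr : grading A)
    (S : {pred int}) : A -> Prop :=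
  | graded_span0 : graded_span gr S 0
  | graded_spanD n x y : n \in S -> gr n x -> graded_span gr S y ->
      graded_span gr S (x + y).

Definition graded_pred (R : realType) (A : starAlgType R) (gr : grading A)
    (S : {pred int}) : {pred A} := fun x => `[< graded_span gr S x >].

(* The *-subalgebra A_H, the direct sum of the A_n with n in H. *)
Record subalg (R : realType) (A : starAlgType R) (gr : grading A)
    (H : zmodClosed int) := Subalg {
  subalg_val : A;
  subalg_valP : subalg_val \in graded_pred gr H }.

Section GradedSpan.
Context (R : realType) (A : starAlgType R) (gr : grading A) (S : {pred int}).

Lemma graded_span_comp n x : n \in S -> gr n x -> graded_span gr S x.
Proof.
by move=> nS xn; rewrite -[x]addr0; apply: graded_spanD nS xn (graded_span0 _ _).
Qed.

Lemma graded_span_add x y :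
  graded_span gr S x -> graded_span gr S y -> graded_span gr S (x + y).
Proof.
by elim=> [|n u v nS un _ IH] Sy; rewrite ?add0r // -addrA; apply: graded_spanD nS un (IH Sy).
Qed.

Lemma comp_scale n (c : R[i]) x : gr n x -> gr n (c *: x).
Proof. by move=> xn; rewrite -[c *: x]addr0; apply: comp_linear => //; apply: comp0. Qed.

Lemma graded_span_scale (c : R[i]) x : graded_span gr S x -> graded_span gr S (c *: x).
Proof.
elim=> [|n u v nS un _ IH]; first by rewrite scaler0; apply: graded_span0.
by rewrite scalerDr; apply: graded_spanD nS (comp_scale c un) IH.
Qed.

End GradedSpan.

Section GradedSubalg.
Context (R : realType) (A : starAlgType R) (gr : grading A) (H : zmodClosed int).

Lemma graded_span_mul x y :
  graded_span gr H x -> graded_span gr H y -> graded_span gr H (x * y).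
Proof.
move=> Hx Hy; elim: Hx => [|m u v mH um _ IH]; first by rewrite mul0r; apply: graded_span0.
rewrite mulrDl; apply: graded_span_add IH.
elim: Hy => [|n w z nH wn _ IH]; first by rewrite mulr0; apply: graded_span0.
rewrite mulrDr; apply: graded_span_add IH.
by apply: (graded_span_comp (rpredD mH nH)); apply: compM.
Qed.

Lemma graded_span_star x : graded_span gr H x -> graded_span gr H (star x).
Proof.
elim=> [|m u v mH um _ IH]; first by rewrite star0; apply: graded_span0.
rewrite starD; apply: graded_span_add IH.
by apply: (@graded_span_comp _ _ _ _ (- m)); rewrite ?rpredN //; apply: comp_star.
Qed.

HB.instance Definition _ := [isSub for @subalg_val R A gr H].
HB.instance Definition _ := [Choice of subalg gr H by <:].

Lemma graded_subalg_closed : GRing.subsemialg_closed (graded_pred gr H).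
Proof.
split.
- by apply/asboolP; apply: (@graded_span_comp _ _ _ _ 0 _ (rpred0 H)); apply: comp1.
- split; first exact/asboolP/graded_span0.
  by move=> x y /asboolP Hx /asboolP Hy; apply/asboolP/graded_span_add.
- by move=> c x /asboolP Hx; apply/asboolP/graded_span_scale.
- by move=> x y /asboolP Hx /asboolP Hy; apply/asboolP/graded_span_mul.
Qed.

HB.instance Definition _ :=
  GRing.SubChoice_isSubAlgebra.Build R[i] A (graded_pred gr H) (subalg gr H)
    graded_subalg_closed.

Definition subalg_star (x : subalg gr H) : subalg gr H :=
  Subalg (asboolT (graded_span_star (asboolW (subalg_valP x)))).

Fact subalg_starD x y : subalg_star (x + y) = subalg_star x + subalg_star y.
Proof. by apply: val_inj; rewrite (raddfD val) /= -starD; congr star; exact: (raddfD val). Qed.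
Fact subalg_starZ (c : R[i]) x : subalg_star (c *: x) = c^* *: subalg_star x.
Proof. by apply: val_inj; rewrite [RHS]linearZ /= -starZ; congr star; rewrite -/(val _) [LHS]linearZ. Qed.
Fact subalg_starM x y : subalg_star (x * y) = subalg_star y * subalg_star x.
Proof. by apply: val_inj; rewrite (rmorphM val) /= -starM; congr star; exact: (rmorphM val). Qed.
Fact subalg_starK : involutive subalg_star.
Proof. by move=> x; apply: val_inj; rewrite /= starK. Qed.

HB.instance Definition _ := Algebra_isStarAlgebra.Build R (subalg gr H)
  subalg_starD subalg_starZ subalg_starM subalg_starK.

End GradedSubalg.

(* C<a, a^* | a a^* = q a^* a + 1>: the algebra terms in a and a^*, modulo the
   least congruence containing the axioms of unital complex algebras and the
   defining relation. [OCst c] is the scalar multiple c of the unit. *)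
Section Oscillator.
Context (R : realType).

Inductive osc_term :=
  | OGen | OGenStar
  | OCst of R[i]
  | OAdd of osc_term & osc_term
  | OMul of osc_term & osc_term.

HB.instance Definition _ := gen_eqMixin osc_term.
HB.instance Definition _ := gen_choiceMixin osc_term.

Context (q : R).

Inductive osc_eq : osc_term -> osc_term -> Prop :=
  | osc_refl x : osc_eq x x
  | osc_sym x y : osc_eq x y -> osc_eq y x
  | osc_trans x y z : osc_eq x y -> osc_eq y z -> osc_eq x z
  | osc_congrD x x' y y' :
      osc_eq x x' -> osc_eq y y' -> osc_eq (OAdd x y) (OAdd x' y')
  | osc_congrM x x' y y' :
      osc_eq x x' -> osc_eq y y' -> osc_eq (OMul x y) (OMul x' y')
  | osc_addA x y z : osc_eq (OAdd x (OAdd y z)) (OAdd (OAdd x y) z)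
  | osc_addC x y : osc_eq (OAdd x y) (OAdd y x)
  | osc_add0 x : osc_eq (OAdd (OCst 0) x) x
  | osc_addN x : osc_eq (OAdd (OMul (OCst (-1)) x) x) (OCst 0)
  | osc_mulA x y z : osc_eq (OMul x (OMul y z)) (OMul (OMul x y) z)
  | osc_mul1l x : osc_eq (OMul (OCst 1) x) x
  | osc_mul1r x : osc_eq (OMul x (OCst 1)) x
  | osc_mulDl x y z : osc_eq (OMul (OAdd x y) z) (OAdd (OMul x z) (OMul y z))
  | osc_mulDr x y z : osc_eq (OMul x (OAdd y z)) (OAdd (OMul x y) (OMul x z))
  | osc_cstD c d : osc_eq (OCst (c + d)) (OAdd (OCst c) (OCst d))
  | osc_cstM c d : osc_eq (OCst (c * d)) (OMul (OCst c) (OCst d))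
  | osc_cst_central c x : osc_eq (OMul (OCst c) x) (OMul x (OCst c))
  | osc_rel : osc_eq (OMul OGen OGenStar)
      (OAdd (OMul (OCst q%:C%C) (OMul OGenStar OGen)) (OCst 1)).

Definition osc_eqb : rel osc_term := fun x y => `[< osc_eq x y >].

Fact osc_eqb_equiv : equiv_class_of osc_eqb.
Proof.
split=> [x|x y|y x z]; first exact/asboolP/osc_refl.
  by apply/asbool_equiv_eq; split; apply: osc_sym.
by move=> /asboolP xy /asboolP yz; apply/asboolP/(osc_trans xy yz).
Qed.
Canonical osc_equiv := EquivRelPack osc_eqb_equiv.

Definition oscillator := {eq_quot osc_equiv}.

HB.instance Definition _ := Choice.on oscillator.
HB.instance Definition _ := EqQuotient.on oscillator.

Definition osc_pi (x : osc_term) : oscillator := \pi_oscillator x.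

Lemma osc_piP x y : osc_pi x = osc_pi y <-> osc_eq x y.
Proof. by split=> [/eqmodP/asboolP|xy]; [|apply/eqmodP/asboolP]. Qed.

Lemma osc_piK (u : oscillator) : exists x, u = osc_pi x.
Proof. by exists (repr u); rewrite /osc_pi reprK. Qed.

Lemma osc_repr x : osc_eq (repr (osc_pi x)) x.
Proof. by apply/osc_piP; rewrite /osc_pi reprK. Qed.

Definition osc_zero := osc_pi (OCst 0).
Definition osc_one := osc_pi (OCst 1).
Definition osc_add (u v : oscillator) := osc_pi (OAdd (repr u) (repr v)).
Definition osc_mul (u v : oscillator) := osc_pi (OMul (repr u) (repr v)).
Definition osc_scale (c : R[i]) (u : oscillator) := osc_pi (OMul (OCst c) (repr u)).
Definition osc_opp (u : oscillator) := osc_scale (-1) u.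

Lemma osc_addE x y : osc_add (osc_pi x) (osc_pi y) = osc_pi (OAdd x y).
Proof. by apply/osc_piP; apply: osc_congrD; apply: osc_repr. Qed.
Lemma osc_mulE x y : osc_mul (osc_pi x) (osc_pi y) = osc_pi (OMul x y).
Proof. by apply/osc_piP; apply: osc_congrM; apply: osc_repr. Qed.
Lemma osc_scaleE c x : osc_scale c (osc_pi x) = osc_pi (OMul (OCst c) x).
Proof. by apply/osc_piP; apply: osc_congrM; [apply: osc_refl|apply: osc_repr]. Qed.
Lemma osc_oppE x : osc_opp (osc_pi x) = osc_pi (OMul (OCst (-1)) x).
Proof. exact: osc_scaleE. Qed.

Definition oscE := (osc_oppE, osc_addE, osc_mulE, osc_scaleE).

Local Ltac osc_lift := repeat match goal with
  | |- forall u : oscillator, _ => let x := fresh "x" in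
     let h := fresh in move=> h; have [x ->] := osc_piK h; clear h end;
  rewrite /osc_zero /osc_one ?oscE; apply/osc_piP.

Fact osc_addrA : associative osc_add.
Proof. by rewrite /associative; osc_lift; apply: osc_addA. Qed.
Fact osc_addrC : commutative osc_add.
Proof. by rewrite /commutative; osc_lift; apply: osc_addC. Qed.
Fact osc_add0r : left_id osc_zero osc_add.
Proof. by rewrite /left_id; osc_lift; apply: osc_add0. Qed.
Fact osc_addNr : left_inverse osc_zero osc_opp osc_add.
Proof. by rewrite /left_inverse; osc_lift; apply: osc_addN. Qed.
HB.instance Definition _ := GRing.isZmodule.Build oscillator
  osc_addrA osc_addrC osc_add0r osc_addNr.

Fact osc_mulrA : associative osc_mul.
Proof. by rewrite /associative; osc_lift; apply: osc_mulA. Qed.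
Fact osc_mul1r' : left_id osc_one osc_mul.
Proof. by rewrite /left_id; osc_lift; apply: osc_mul1l. Qed.
Fact osc_mulr1' : right_id osc_one osc_mul.
Proof. by rewrite /right_id; osc_lift; apply: osc_mul1r. Qed.
Fact osc_mulrDl : left_distributive osc_mul osc_add.
Proof. by rewrite /left_distributive; osc_lift; apply: osc_mulDl. Qed.
Fact osc_mulrDr : right_distributive osc_mul osc_add.
Proof. by rewrite /right_distributive; osc_lift; apply: osc_mulDr. Qed.

(* The action of a and a^* on the unnormalised Fock space, which shows that the
   quotient is not trivial: (a f)(n) = [n+1]_q f(n+1), (a^* f)(n) = f(n-1). *)
Fixpoint osc_fock (x : osc_term) (f : nat -> R[i]) : nat -> R[i] :=
  match x with
  | OGen => fun n => (\sum_(k < n.+1) q%:C%C ^+ k) * f n.+1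
  | OGenStar => fun n => if n is m.+1 then f m else 0
  | OCst c => fun n => c * f n
  | OAdd y z => fun n => osc_fock y f n + osc_fock z f n
  | OMul y z => osc_fock y (osc_fock z f)
  end.

Lemma osc_fock_linear x (c : R[i]) f g n :
  osc_fock x (fun k => c * f k + g k) n = c * osc_fock x f n + osc_fock x g n.
Proof.
elim: x f g n => [||d|y IHy z IHz|y IHy z IHz] f g n /=.
- by rewrite mulrDr mulrCA.
- by case: n => // ; rewrite mulr0 addr0.
- by rewrite mulrDr mulrCA.
- by rewrite IHy IHz mulrDr addrACA.
- rewrite -IHy; congr osc_fock.
  by apply/funext => k; rewrite IHz.
Qed.

Lemma osc_fock_eq x y : osc_eq x y -> osc_fock x = osc_fock y.
Proof.
have fD u f g : osc_fock u (fun k => f k + g k) = (fun n => osc_fock u f n + osc_fock u g n).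
  apply/funext => n; rewrite -[X in X + _]mul1r -osc_fock_linear; congr osc_fock.
  by apply/funext => k; rewrite mul1r.
have f0 u : osc_fock u (fun=> 0) = (fun=> 0).
  have := fD u (fun=> 0) (fun=> 0).
  move=> E; apply/funext => n; move/funeqP/(_ n): E => /=.
  have -> : (fun _ : nat => 0 + 0 : R[i]) = (fun=> 0) by apply/funext => ?; rewrite addr0.
  by move=> E; apply: (addrI (osc_fock u (fun=> 0) n)); rewrite -E addr0.
have fZ u (c : R[i]) f : osc_fock u (fun k => c * f k) = (fun n => c * osc_fock u f n).
  apply/funext => n; rewrite -[RHS]addr0 -[X in _ + X](congr1 (fun h => h n) (f0 u)).
  by rewrite -osc_fock_linear; congr osc_fock; apply/funext => k; rewrite addr0.
elim=> //=.
- by move=> u v w _ -> _ ->.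
- by move=> u u' v v' _ -> _ ->.
- by move=> u u' v v' _ -> _ ->.
- by move=> u v w; apply/funext => f; apply/funext => n; rewrite addrA.
- by move=> u v; apply/funext => f; apply/funext => n; rewrite addrC.
- by move=> u; apply/funext => f; apply/funext => n; rewrite mul0r add0r.
- by move=> u; apply/funext => f; apply/funext => n; rewrite mulN1r addNr mul0r.
- by move=> u; apply/funext => f; apply/funext => n; rewrite mul1r.
- by move=> u; apply/funext => f; congr osc_fock; apply/funext => k; rewrite mul1r.
- by move=> u v w; apply/funext => f; rewrite fD.
- by move=> c d; apply/funext => f; apply/funext => n; rewrite mulrDl.
- by move=> c d; apply/funext => f; apply/funext => n; rewrite mulrA.
- by move=> c u; apply/funext => f; rewrite fZ.
- apply/funext => f; apply/funext => -[|n]; first by rewrite big_ord1 expr0 mulr0 add0r.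
  rewrite mulrA -mulrDl; congr (_ * _); rewrite big_ord_recl expr0 addrC; congr (_ + _).
  by rewrite mulr_sumr; apply: eq_bigr => i _; rewrite -exprS.
Qed.

Fact osc_oner_neq0 : osc_one != osc_zero.
Proof.
apply/eqP => /osc_piP/osc_fock_eq/(congr1 (fun h => h (fun=> 1) 0%N)) /=.
by rewrite !mulr1 => /eqP; rewrite oner_eq0.
Qed.

HB.instance Definition _ := GRing.Zmodule_isNzRing.Build oscillator
  osc_mulrA osc_mul1r' osc_mulr1' osc_mulrDl osc_mulrDr osc_oner_neq0.

Fact osc_scalerA (c d : R[i]) u : osc_scale c (osc_scale d u) = osc_scale (c * d) u.
Proof.
move: u; osc_lift; apply: osc_trans (osc_mulA _ _ _) _.
by apply: osc_congrM; [apply/osc_sym/osc_cstM|apply: osc_refl].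
Qed.
Fact osc_scale1r : left_id (1 : R[i]) osc_scale.
Proof. by rewrite /left_id; osc_lift; apply: osc_mul1l. Qed.
Fact osc_scalerDr : right_distributive osc_scale (@GRing.add oscillator).
Proof.
move=> c; rewrite /GRing.add /=; osc_lift; apply: osc_mulDr.
Qed.
Fact osc_scalerDl u : {morph osc_scale^~ u : c d / c + d}.
Proof.
move=> c d; rewrite /= /GRing.add /=; move: u; osc_lift.
apply: osc_trans (osc_mulDl _ _ _).
by apply: osc_congrM; [apply: osc_cstD|apply: osc_refl].
Qed.
HB.instance Definition _ := GRing.Zmodule_isLmodule.Build R[i] oscillator
  osc_scalerA osc_scale1r osc_scalerDr osc_scalerDl.

Fact osc_scalerAl (c : R[i]) (u v : oscillator) : c *: (u * v) = (c *: u) * v.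
Proof.
rewrite /GRing.mul /GRing.scale /=; move: u v; osc_lift; apply: osc_mulA.
Qed.
HB.instance Definition _ := GRing.Lmodule_isLalgebra.Build R[i] oscillator osc_scalerAl.

Fact osc_scalerAr (c : R[i]) (u v : oscillator) : c *: (u * v) = u * (c *: v).
Proof.
rewrite /GRing.mul /GRing.scale /=; move: u v; osc_lift.
apply: osc_trans (osc_mulA _ _ _) _; apply: osc_trans; last exact/osc_sym/osc_mulA.
by apply: osc_congrM; [apply: osc_cst_central|apply: osc_refl].
Qed.
HB.instance Definition _ := GRing.Lalgebra_isAlgebra.Build R[i] oscillator osc_scalerAr.

Fixpoint osc_tstar (x : osc_term) : osc_term :=
  match x with
  | OGen => OGenStar
  | OGenStar => OGen
  | OCst c => OCst c^*
  | OAdd y z => OAdd (osc_tstar y) (osc_tstar z)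
  | OMul y z => OMul (osc_tstar z) (osc_tstar y)
  end.

Lemma osc_tstar_eq x y : osc_eq x y -> osc_eq (osc_tstar x) (osc_tstar y).
Proof.
elim=> /=; try by constructor.
- by move=> u v w _ uv _ vw; apply: osc_trans uv vw.
- by rewrite conjC0; constructor.
- have N1 : (-1 : R[i])^* = -1 by rewrite rmorphN rmorph1.
  move=> u; rewrite N1 conjC0; apply: osc_trans (osc_addN (osc_tstar u)).
  by apply: osc_congrD; [apply/osc_sym/osc_cst_central|apply: osc_refl].
- by move=> u v w; apply/osc_sym/osc_mulA.
- by move=> u; rewrite conjC1; constructor.
- by move=> u; rewrite conjC1; constructor.
- by move=> c d; rewrite rmorphD; constructor.
- move=> c d; rewrite rmorphM; apply: osc_trans (osc_cstM _ _) _; exact: osc_cst_central.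
- by move=> c u; apply/osc_sym/osc_cst_central.
- have -> : (q%:C%C)^* = q%:C%C :> R[i].
    by rewrite /Num.conj /= oppr0.
  rewrite conjC1; apply: osc_trans osc_rel _; apply: osc_congrD; last exact: osc_refl.
  exact: osc_cst_central.
Qed.

Definition osc_star (u : oscillator) := osc_pi (osc_tstar (repr u)).

Lemma osc_starE x : osc_star (osc_pi x) = osc_pi (osc_tstar x).
Proof. by apply/osc_piP/osc_tstar_eq/osc_repr. Qed.

Fact osc_starD (u v : oscillator) : osc_star (u + v) = osc_star u + osc_star v.
Proof.
rewrite /GRing.add /=; have [x ->] := osc_piK u; have [y ->] := osc_piK v.
by rewrite oscE !osc_starE oscE.
Qed.
Fact osc_starZ (c : R[i]) (u : oscillator) : osc_star (c *: u) = c^* *: osc_star u.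
Proof.
rewrite /GRing.scale /=; have [x ->] := osc_piK u.
by rewrite oscE !osc_starE oscE; apply/osc_piP/osc_sym/osc_cst_central.
Qed.
Fact osc_starM (u v : oscillator) : osc_star (u * v) = osc_star v * osc_star u.
Proof.
rewrite /GRing.mul /=; have [x ->] := osc_piK u; have [y ->] := osc_piK v.
by rewrite oscE !osc_starE oscE.
Qed.
Fact osc_starK : involutive osc_star.
Proof.
move=> u; have [x ->] := osc_piK u; rewrite !osc_starE; congr osc_pi.
by elim: x => //= [c|y -> z -> //|y -> z -> //]; rewrite conjCK.
Qed.
HB.instance Definition _ := Algebra_isStarAlgebra.Build R oscillator
  osc_starD osc_starZ osc_starM osc_starK.

Definition osc_a : oscillator := osc_pi OGen.

Lemma osc_relE : osc_a * star osc_a = q%:C%C *: (star osc_a * osc_a) + 1.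
Proof.
rewrite /star /= /osc_a osc_starE /GRing.mul /GRing.scale /GRing.add /GRing.one /= /osc_one !oscE.
exact/osc_piP/osc_rel.
Qed.

End Oscillator.

Section OscillatorGrading.
Context (R : realType) (q : R).
Local Notation A := (oscillator q).

(* The grading generated by a in degree 1 and a^* in degree -1. *)
Inductive osc_comp : int -> A -> Prop :=
  | osc_comp_a : osc_comp 1 (osc_a q)
  | osc_comp_star_a : osc_comp (- 1) (star (osc_a q))
  | osc_comp_1 : osc_comp 0 1
  | osc_comp_0 n : osc_comp n 0
  | osc_comp_lin n (c : R[i]) x y :
      osc_comp n x -> osc_comp n y -> osc_comp n (c *: x + y)
  | osc_comp_mul m n x y :
      osc_comp m x -> osc_comp n y -> osc_comp (m + n) (x * y).

(* The automorphism a |-> 2 a, a^* |-> 2^-1 a^*, with eigenvalue 2 ^ n on A_n. *)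
Fixpoint osc_tgauge (x : osc_term R) : osc_term R :=
  match x with
  | OGen => OMul (OCst 2) (OGen R)
  | OGenStar => OMul (OCst 2^-1) (OGenStar R)
  | OCst c => OCst c
  | OAdd y z => OAdd (osc_tgauge y) (osc_tgauge z)
  | OMul y z => OMul (osc_tgauge y) (osc_tgauge z)
  end.

Lemma osc_piD x y : osc_pi q (OAdd x y) = osc_pi q x + osc_pi q y.
Proof. by rewrite /GRing.add /= osc_addE. Qed.
Lemma osc_piM x y : osc_pi q (OMul x y) = osc_pi q x * osc_pi q y.
Proof. by rewrite /GRing.mul /= osc_mulE. Qed.
Lemma osc_piC c : osc_pi q (OCst c) = c *: 1.
Proof.
rewrite /GRing.scale /= /GRing.one /= /osc_one osc_scaleE.
exact/osc_piP/osc_sym/osc_mul1r.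
Qed.
Lemma osc_piZ c x : osc_pi q (OMul (OCst c) x) = c *: osc_pi q x.
Proof. by rewrite osc_piM osc_piC -scalerAl mul1r. Qed.

Lemma osc_star_aE : star (osc_a q) = osc_pi q (OGenStar R).
Proof. by rewrite /star /= osc_starE. Qed.

Lemma osc_tgauge_eq x y : osc_eq q x y -> osc_eq q (osc_tgauge x) (osc_tgauge y).
Proof.
elim=> /=; try by constructor.
  by move=> u v w _ uv _ vw; apply: osc_trans uv vw.
apply/osc_piP; rewrite !(osc_piD, osc_piM, osc_piC, osc_piZ).
rewrite -!scalerAl -!scalerAr !mul1r !scalerA mulfV ?pnatr_eq0 // mulVf ?pnatr_eq0 // !scale1r.
by rewrite mulr1 -osc_star_aE; apply: osc_relE.
Qed.

Definition osc_gauge (u : A) : A := osc_pi q (osc_tgauge (repr u)).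

Lemma osc_gaugeE x : osc_gauge (osc_pi q x) = osc_pi q (osc_tgauge x).
Proof. by apply/osc_piP/osc_tgauge_eq/osc_repr. Qed.

Lemma osc_gaugeM (u v : A) : osc_gauge (u * v) = osc_gauge u * osc_gauge v.
Proof.
have [x ->] := osc_piK u; have [y ->] := osc_piK v.
by rewrite -osc_piM !osc_gaugeE /= osc_piM.
Qed.

Lemma osc_gauge_lin (c : R[i]) (u v : A) :
  osc_gauge (c *: u + v) = c *: osc_gauge u + osc_gauge v.
Proof.
have [x ->] := osc_piK u; have [y ->] := osc_piK v.
by rewrite -osc_piZ -osc_piD !osc_gaugeE /= osc_piD osc_piZ.
Qed.

Lemma osc_gauge0 : osc_gauge 0 = 0.
Proof. by have := osc_gauge_lin (-1) 0 0; rewrite scaler0 addr0 scaleN1r addNr. Qed.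

Lemma osc_gauge_comp n x : osc_comp n x -> osc_gauge x = (2 : R[i]) ^ n *: x.
Proof.
have two0 : (2 : R[i]) != 0 by rewrite pnatr_eq0.
elim=> {n x} [||| n|n c x y _ IHx _ IHy|m n x y _ IHx _ IHy].
- by rewrite osc_gaugeE /= osc_piZ expr1z.
- by rewrite osc_star_aE osc_gaugeE /= osc_piZ exprN1.
- by rewrite -[1 in LHS]/(osc_pi q (OCst 1)) osc_gaugeE /= expr0z scale1r.
- by rewrite osc_gauge0 scaler0.
- by rewrite osc_gauge_lin IHx IHy scalerDr !scalerA mulrC.
- by rewrite osc_gaugeM IHx IHy -scalerAl -scalerAr scalerA expfzDr.
Qed.

Lemma two_exp_inj : injective (fun n : int => (2 : R[i]) ^ n).
Proof.
move=> m n /=; have -> : 2 = real_complex R 2 by rewrite rmorph_nat.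
by rewrite -!fmorphXz => /fmorph_inj; apply: ieexprIz; rewrite ?ltr0n ?(eqr_nat R 2 1).
Qed.

Fact osc_comp_direct (s : seq int) (f : int -> A) : uniq s ->
  (forall n, osc_comp n (f n)) -> \sum_(n <- s) f n = 0 ->
  forall n, n \in s -> f n = 0.
Proof.
elim: s f => [|m s IH] f //= /andP[ms us] fc; rewrite big_cons => sum0.
have gsum (t : seq int) : osc_gauge (\sum_(n <- t) f n) = \sum_(n <- t) (2 : R[i]) ^ n *: f n.
  elim: t => [|n t IHt]; first by rewrite !big_nil osc_gauge0.
  by rewrite !big_cons -IHt -(osc_gauge_comp (fc n)) -[f n in LHS]scale1r osc_gauge_lin scale1r.
have fs n : n \in s -> f n = 0.
  move=> ns; have nm : n != m by apply: contraNneq ms => <-.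
  pose g k := ((2 : R[i]) ^ k - 2 ^ m) *: f k.
  have g0 : \sum_(k <- s) g k = 0.
    rewrite /g (eq_bigr (fun k => (2 : R[i]) ^ k *: f k - (2 : R[i]) ^ m *: f k)); last first.
      by move=> k _; rewrite scalerBl.
    rewrite sumrB -gsum -scaler_sumr.
    have -> : \sum_(k <- s) f k = (-1) *: f m + 0.
      by apply: (addrI (f m)); rewrite sum0 addr0 scaleN1r subrr.
    by rewrite osc_gauge_lin osc_gauge0 (osc_gauge_comp (fc m)) addr0 addr0 scaleN1r scalerA mulrN1 scaleNr subrr.
  have := IH g us _ g0 n ns; rewrite /g => gn.
  have {gn} /eqP : ((2 : R[i]) ^ n - 2 ^ m) *: f n = 0.
    apply: gn => k; rewrite -[_ *: _]addr0; apply: osc_comp_lin => //; exact: osc_comp_0.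
  by rewrite scaler_eq0 subr_eq0 (inj_eq two_exp_inj) (negbTE nm) => /eqP.
move=> n; rewrite inE => /orP[/eqP ->|]; last exact: fs.
move: sum0; rewrite [X in _ + X]big1_seq ?addr0 // => k /andP[_]; exact: fs.
Qed.

Definition osc_dec (x : A) := exists s : seq A,
  (forall y, y \in s -> exists n, osc_comp n y) /\ x = \sum_(y <- s) y.

Lemma osc_dec0 : osc_dec 0.
Proof. by exists [::]; rewrite big_nil. Qed.

Lemma osc_decD x y : osc_dec x -> osc_dec y -> osc_dec (x + y).
Proof.
move=> [s [hs ->]] [t [ht ->]]; exists (s ++ t); rewrite big_cat; split=> // z.
by rewrite mem_cat => /orP[/hs|/ht].
Qed.

Lemma osc_dec_comp n x : osc_comp n x -> osc_dec x.
Proof.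
by move=> xn; exists [:: x]; rewrite big_seq1; split=> // y; rewrite inE => /eqP ->; exists n.
Qed.

Lemma osc_decM x y : osc_dec x -> osc_dec y -> osc_dec (x * y).
Proof.
move=> [s [hs ->]] [t [ht ->]]; elim: s hs => [|u s IH] hs.
  by rewrite big_nil mul0r; apply: osc_dec0.
rewrite big_cons mulrDl; apply: osc_decD; last first.
  by apply: IH => z zs; apply: hs; rewrite inE zs orbT.
have [m um] : exists m, osc_comp m u by apply: hs; rewrite inE eqxx.
clear IH; elim: t ht => [|v t IHt] ht; first by rewrite big_nil mulr0; apply: osc_dec0.
rewrite big_cons mulrDr; apply: osc_decD; last first.
  by apply: IHt => z zt; apply: ht; rewrite inE zt orbT.
have [n vn] : exists n, osc_comp n v by apply: ht; rewrite inE eqxx.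
exact: osc_dec_comp (osc_comp_mul um vn).
Qed.

Fact osc_comp_span x : osc_dec x.
Proof.
have [t ->] := osc_piK x; elim: t => [||c|y IHy z IHz|y IHy z IHz].
- exact: osc_dec_comp osc_comp_a.
- by rewrite -osc_star_aE; exact: osc_dec_comp osc_comp_star_a.
- rewrite osc_piC -[_ *: _]addr0; apply: (@osc_dec_comp 0).
  by apply: osc_comp_lin; [apply: osc_comp_1|apply: osc_comp_0].
- by rewrite osc_piD; apply: osc_decD.
- by rewrite osc_piM; apply: osc_decM.
Qed.

Fact osc_comp_star n x : osc_comp n x -> osc_comp (- n) (star x).
Proof.
elim=> {n x} [||| n|n c x y _ IHx _ IHy|m n x y _ IHx _ IHy].
- exact: osc_comp_star_a.
- by rewrite starK opprK; exact: osc_comp_a.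
- by rewrite star1; exact: osc_comp_1.
- by rewrite star0; exact: osc_comp_0.
- by rewrite starD starZ; apply: osc_comp_lin.
- by rewrite starM opprD addrC; apply: osc_comp_mul.
Qed.

Definition osc_grading : grading A := Grading osc_comp_0 osc_comp_lin osc_comp_1
  osc_comp_mul osc_comp_star osc_comp_span osc_comp_direct.

End OscillatorGrading.

Section Projection.
Context (R : realType) (A : starAlgType R) (gr : grading A).

Lemma graded_span_family (S : {pred int}) x : graded_span gr S x ->
  exists (s : seq int) (f : int -> A),
    [/\ uniq s, {subset s <= S}, forall n, gr n (f n) & x = \sum_(n <- s) f n].
Proof.
elim=> [|m u y mS um _ [s [f [us sS fc ->]]]].
  by exists [::], (fun=> 0); split=> //; [move=> n; apply: comp0|rewrite big_nil].
have [ms|ms] := boolP (m \in s); last first.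
  exists (m :: s), (fun n => if n == m then u else f n); split=> /=.
  - by rewrite ms.
  - by move=> n; rewrite inE => /orP[/eqP ->|/sS].
  - by move=> n; case: eqP => [->|].
  - rewrite big_cons eqxx; congr (_ + _); apply: eq_big_seq => n ns.
    by case: eqP => // nm; rewrite nm (negbTE ms) in ns.
exists s, (fun n => if n == m then 1 *: u + f n else f n); split=> //.
  by move=> n; case: eqP => [->|//]; apply: comp_linear.
rewrite (bigD1_seq m) //= [in RHS](bigD1_seq m) //= eqxx scale1r addrA; congr (_ + _).
by apply: eq_bigr => n /negbTE ->.
Qed.

Lemma graded_span_disjoint (S T : {pred int}) x :
  (forall n, n \in S -> n \notin T) ->
  graded_span gr S x -> graded_span gr T x -> x = 0.
Proof.
move=> ST /graded_span_family[s [f [us sS fc ->]]] /graded_span_family[t [g [ut tT gc xE]]].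
pose h n := if n \in s then f n else (-1) *: g n.
have h0 : \sum_(n <- s ++ t) h n = 0.
  rewrite big_cat /= (eq_big_seq f); last by move=> n ns; rewrite /h ns.
  rewrite [X in _ + X](eq_big_seq (fun n => - g n)).
    by rewrite sumrN -xE subrr.
  by move=> n nt; rewrite /h ifF ?scaleN1r//; apply: contraTF nt => /sS/ST; apply: contra; apply: tT.
rewrite big1_seq // => n /andP[_ ns].
have -> : f n = h n by rewrite /h ns.
apply: (comp_direct _ _ h0); last by rewrite mem_cat ns.
- rewrite cat_uniq us ut andbT; apply/hasPn => k kt; apply/negP => /sS/ST.
  by rewrite (tT _ kt).
- by move=> k; rewrite /h; case: ifP => // _; apply: comp_scale.
Qed.

Context (H : zmodClosed int).

(* The canonical projection p : A -> A_H. *)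
Definition gproj (x : A) : subalg gr H :=
  xget 0 [set y | graded_span gr [predC H] (x - val y)].

Lemma gprojP x (y : subalg gr H) :
  graded_span gr [predC H] (x - val y) <-> gproj x = y.
Proof.
have valH (z : subalg gr H) : graded_span gr H (val z) by exact/asboolP/(subalg_valP z).
have uq (z w : subalg gr H) : graded_span gr [predC H] (x - val z) ->
    graded_span gr [predC H] (x - val w) -> z = w.
  move=> xz xw; apply/eqP; rewrite -subr_eq0; apply/eqP/val_inj.
  rewrite [RHS](raddf0 val); apply: (@graded_span_disjoint H [predC H]).
  - by move=> n nH; rewrite inE /= negbK.
  - exact: valH.
  - have -> : val (z - w) = (x - val w) + (-1) *: (x - val z).
      by rewrite [LHS](raddfB val) scaleN1r opprB [RHS]addrC addrA subrK.
    exact: graded_span_add xw (graded_span_scale _ xz).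
suff [z xz] : exists z : subalg gr H, graded_span gr [predC H] (x - val z).
  split=> [xy|<-]; last by rewrite /gproj; case: xgetP => [w _ //|/(_ z)].
  by apply: uq xy; rewrite /gproj; case: xgetP => [w _ //|/(_ z)].
have [s [hs ->]] := comp_span gr x; elim: s hs => [|u s IH] hs.
  by exists 0; rewrite big_nil (raddf0 val) subr0; apply: graded_span0.
have [|z xz] := IH; first by move=> v vs; apply: hs; rewrite inE vs orbT.
have [n un] : exists n, gr n u by apply: hs; rewrite inE eqxx.
have [nH|nH] := boolP (n \in H).
  exists (Subalg (asboolT (graded_span_comp nH un)) + z).
  by rewrite big_cons (raddfD val) /= opprD addrACA subrr add0r.
exists z; rewrite big_cons -addrA; by apply: graded_spanD un xz; rewrite inE.
Qed.

End Projection.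

Definition int0 : {pred int} := pred1 0.
Fact int0_closed : GRing.zmod_closed int0.
Proof. by split=> [|m n]; rewrite !inE // => /eqP -> /eqP ->. Qed.
HB.instance Definition _ := GRing.isZmodClosed.Build int int0 int0_closed.

Notation base gr := (subalg gr int0).

(* Linear operators in E are identified with their graphs in E * E, so that
   inclusion of graphs is extension of operators. *)
Section Operators.
Context (R : realType) (E : hilbertType R).
Implicit Types S T : set (E * E).

Definition op_fun (f : E -> E) : set (E * E) := [set p | p.2 = f p.1].

Definition op_dom T : set E := [set u | exists v, T (u, v)].

Definition op_comp S T : set (E * E) :=
  [set p | exists v, T (p.1, v) /\ S (v, p.2)].

Definition op_adj T : set (E * E) :=
  [set p | forall u v, T (u, v) -> inner v p.1 = inner u p.2].

Definition normal_op T :=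
  [/\ closed T, dense (op_dom T) & op_comp (op_adj T) T = op_comp T (op_adj T)].

End Operators.

(* Outside of the domain [rdom], the values of [ract x] are irrelevant. *)
Record star_rep (R : realType) (A : starAlgType R) (E : hilbertType R) := StarRep {
  rdom : set E;
  ract : A -> E -> E;
  rdom0 : rdom 0;
  rdom_linear : forall (c : R[i]) u v, rdom u -> rdom v -> rdom (c *: u + v);
  rdom_dense : dense rdom;
  ract_dom : forall x u, rdom u -> rdom (ract x u);
  ract_linear : forall x (c : R[i]) u v, rdom u -> rdom v ->
    ract x (c *: u + v) = c *: ract x u + ract x v;
  ract_algD : forall x y u, rdom u -> ract (x + y) u = ract x u + ract y u;
  ract_algZ : forall (c : R[i]) x u, rdom u -> ract (c *: x) u = c *: ract x u;
  ract_algM : forall x y u, rdom u -> ract (x * y) u = ract x (ract y u);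
  ract_alg1 : forall u, rdom u -> ract 1 u = u;
  ract_star : forall x u v, rdom u -> rdom v ->
    inner (ract x u) v = inner u (ract (star x) v) }.

Section StarRep.
Context (R : realType) (A : starAlgType R).

Definition rop (E : hilbertType R) (pi : star_rep A E) (x : A) : set (E * E) :=
  [set p | rdom pi p.1 /\ p.2 = ract pi x p.1].

(* Cauchy filters on D(pi) and convergence for the graph topology. *)
Definition graph_cauchy (E : hilbertType R) (pi : star_rep A E) (F : set_system E) :=
  F (rdom pi) /\
  forall (x : A) (e : R[i]), 0 < e -> exists2 S, F S &
    forall u v, S u -> S v -> rdom pi u -> rdom pi v ->
      `|u - v| + `|ract pi x (u - v)| < e.

Definition graph_cvg (E : hilbertType R) (pi : star_rep A E) (F : set_system E) (u : E) :=
  forall (x : A) (e : R[i]), 0 < e ->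
    F [set v | rdom pi v /\ `|v - u| + `|ract pi x (v - u)| < e].

Definition closed_rep (E : hilbertType R) (pi : star_rep A E) :=
  forall F : set_system E, ProperFilter F -> graph_cauchy pi F ->
    exists2 u, rdom pi u & graph_cvg pi F u.

(* The completion of D(pi0) for the graph topology, as a subspace of E. *)
Definition graph_completion (E : hilbertType R) (pi0 : star_rep A E) : set E :=
  [set u | exists F : set_system E,
    [/\ ProperFilter F, graph_cauchy pi0 F & F --> u]].

Definition is_closure (E : hilbertType R) (pi0 pi : star_rep A E) :=
  rdom pi = graph_completion pi0 /\
  forall x u, rdom pi u -> closure (rop pi0 x) (u, ract pi x u).

Definition unitarily_equivalent (E1 E2 : hilbertType R)
    (pi1 : star_rep A E1) (pi2 : star_rep A E2) :=
  exists U : E1 -> E2,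
    [/\ forall (c : R[i]) u v, rdom pi1 u -> rdom pi1 v ->
          U (c *: u + v) = c *: U u + U v,
        forall u, rdom pi1 u -> `|U u| = `|u|,
        U @` rdom pi1 = rdom pi2
      & forall x u, rdom pi1 u -> ract pi2 x (U u) = U (ract pi1 x u)].

(* D1 and D2 are the domains of the two summands of a decomposition
   pi = pi1 (+) pi2, on the Hilbert spaces closure D1 and closure D2. *)
Definition rep_decomposition (E : hilbertType R) (pi : star_rep A E) (D1 D2 : set E) :=
  let invariant_subspace (D : set E) :=
    [/\ D 0, forall (c : R[i]) u v, D u -> D v -> D (c *: u + v)
      & forall x u, D u -> D (ract pi x u)] in
  [/\ invariant_subspace D1, invariant_subspace D2,
      forall u v, D1 u -> D2 v -> inner u v = 0
    & rdom pi = [set u + v | u in D1 & v in D2]].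

Definition irreducible_rep (E : hilbertType R) (pi : star_rep A E) :=
  rdom pi <> [set 0] /\
  forall D1 D2, rep_decomposition pi D1 D2 -> D1 = [set 0] \/ D2 = [set 0].

Definition one_dimensional (E : hilbertType R) (pi : star_rep A E) :=
  exists2 u, u != 0 & rdom pi = [set c *: u | c in [set: R[i]]].

End StarRep.

Section SpectralMeasure.
Context d (T : measurableType d) (R : realType) (E : hilbertType R).
Implicit Types (X : set T) (P : set T -> E -> E).

Definition orthogonal_projection (p : E -> E) :=
  [/\ forall (c : R[i]) u v, p (c *: u + v) = c *: p u + p v,
      forall u, p (p u) = p u
    & forall u v, inner (p u) v = inner u (p v)].

(* P is a spectral measure on the measurable subset X of T; only the values
   of P on the measurable subsets of X are relevant. *)
Definition spectral_measure X P :=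
  [/\ forall D, measurable D -> D `<=` X -> orthogonal_projection (P D),
      P X = id
    & forall D : (set T)^nat, (forall n, measurable (D n) /\ D n `<=` X) ->
        trivIset setT D ->
        forall u, series (fun n => P (D n) u) @ \oo --> P (\bigcup_n D n) u].

Definition scalar_measure X P (u : E) : set T -> \bar R :=
  fun D => (complex.Re (inner (P (D `&` X) u) u))%:E.

Definition complex_integral (mu : set T -> \bar R) X (f : T -> R[i]) : R[i] :=
  (fine (\int[mu]_(t in X) (complex.Re (f t))%:E) +i*
   fine (\int[mu]_(t in X) (complex.Im (f t))%:E))%C.

Definition spectral_dom X P (f : T -> R[i]) : set E :=
  [set u | (\int[scalar_measure X P u]_(t in X)
    (complex.Re (f t) ^+ 2 + complex.Im (f t) ^+ 2)%:E < +oo)%E].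

(* The integral of f against the complex measure D |-> <P(D)u, v>, which is
   obtained from the positive measures [scalar_measure] by polarization. *)
Definition spectral_form X P (f : T -> R[i]) (u v : E) : R[i] :=
  4^-1 * \sum_(k < 4) 'i ^+ k *
    complex_integral (scalar_measure X P (u + 'i ^+ k *: v)) X f.

(* The spectral integral of f: the operator T with domain [spectral_dom] and
   <T u, v> = \int f d<P u, v>. *)
Definition spectral_integral X P (f : T -> R[i]) : set (E * E) :=
  [set p | spectral_dom X P f p.1 /\
    forall v, spectral_dom X P f v -> inner p.2 v = spectral_form X P f p.1 v].

End SpectralMeasure.

Section PartialAction.
Context (R : realType) (A : starAlgType R) (gr : grading A).

(* An element of A_0, such as c^* c or c^* b c with c homogeneous, viewed in the
   type of the *-algebra A_0. *)
Definition to_base (x : A) : base gr := insubd 0 x.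

(* Complex functions on A_0 with the topology of pointwise convergence; the
   evaluation at b is the function b^. *)
Definition base_fun := {ptws base gr -> R[i]^o}.

Definition is_character (chi : base_fun) :=
  [/\ forall (c : R[i]) x y, chi (c *: x + y) = c * chi x + chi y,
      forall x y, chi (x * y) = chi x * chi y,
      forall x, chi (star x) = (chi x)^*
    & exists x, chi x != 0].

Definition positive_characters : set base_fun :=
  [set chi | is_character chi /\
    forall n c, gr n c -> 0 <= chi (to_base (star c * c))].

(* The functions on A_0 with the sigma-algebra generated by the relatively open
   subsets of [positive_characters]: its elements that are contained in
   [positive_characters] are the Borel subsets of that space. *)
Definition character_space :=
  g_sigma_algebraType [set positive_characters `&` O | O in @open base_fun].

(* [action_dom n] is D_{-n}. *)
Definition action_dom (n : int) : set base_fun :=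
  [set chi | positive_characters chi /\
    exists2 c, gr n c & chi (to_base (star c * c)) != 0].

(* The image under alpha_n of a subset of D_{-n}. *)
Definition action_image (n : int) (D : set base_fun) : set base_fun :=
  [set chi' | exists chi c, [/\ D chi, gr n c, chi (to_base (star c * c)) != 0
    & forall b : base gr, chi' b =
        chi (to_base (star c * val b * c)) / chi (to_base (star c * c))]].

(* The closed *-representation pi is well-behaved, with spectral measure P. The
   restriction of pi to A_0 has domain D(pi), so its operators are the
   [rop pi (val b)]. *)
Definition well_behaved (E : hilbertType R) (pi : star_rep A E) :=
  closed_rep pi /\
  (forall b : base gr, normal_op (closure (rop pi (val b)))) /\
  exists P : set character_space -> E -> E,
    [/\ spectral_measure (positive_characters : set character_space) P,
        forall b : base gr, closure (rop pi (val b)) =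
          spectral_integral (positive_characters : set character_space) P
            (fun chi : base_fun => chi b)
      & forall n c (D : set character_space), gr n c -> measurable D ->
          D `<=` positive_characters ->
          op_comp (op_fun (P (action_image n (D `&` action_dom n)))) (rop pi c)
            `<=` op_comp (rop pi c) (op_fun (P D))].

End PartialAction.

Section Induction.
Context (R : realType) (A : starAlgType R) (gr : grading A).
Context (H : zmodClosed int) (K : hilbertType R) (rho : star_rep (subalg gr H) K).

(* Formal sums of symbols x (x) u with x in A and u in D(rho), modulo the
   relations of the tensor product of A and D(rho) over A_H. *)
Definition formal_sum := seq (A * rdom rho).

Inductive tensor_eq : formal_sum -> formal_sum -> Prop :=
  | tensor_refl s : tensor_eq s s
  | tensor_sym s t : tensor_eq s t -> tensor_eq t s
  | tensor_trans s t w : tensor_eq s t -> tensor_eq t w -> tensor_eq s w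
  | tensor_cat s s' t t' :
      tensor_eq s s' -> tensor_eq t t' -> tensor_eq (s ++ t) (s' ++ t')
  | tensor_comm s t : tensor_eq (s ++ t) (t ++ s)
  | tensor_0l u : tensor_eq [:: (0, u)] [::]
  | tensor_Dl x y u : tensor_eq [:: (x + y, u)] [:: (x, u); (y, u)]
  | tensor_Dr x u v w : val w = val u + val v ->
      tensor_eq [:: (x, w)] [:: (x, u); (x, v)]
  | tensor_balance x (h : subalg gr H) u v : val v = ract rho h (val u) ->
      tensor_eq [:: (x * val h, u)] [:: (x, v)].

Definition tensor_eqb : rel formal_sum := fun s t => `[< tensor_eq s t >].

Fact tensor_eqb_equiv : equiv_class_of tensor_eqb.
Proof.
split=> [s|s t|t s w]; first exact/asboolP/tensor_refl.
  by apply/asbool_equiv_eq; split; apply: tensor_sym.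
by move=> /asboolP st /asboolP tw; apply/asboolP/(tensor_trans st tw).
Qed.
Canonical tensor_equiv := EquivRelPack tensor_eqb_equiv.

Definition tensor := {eq_quot tensor_equiv}.
HB.instance Definition _ := Choice.on tensor.
HB.instance Definition _ := EqQuotient.on tensor.

Definition tensor_pi (s : formal_sum) : tensor := \pi_tensor s.

Lemma tensor_piP s t : tensor_pi s = tensor_pi t <-> tensor_eq s t.
Proof. by split=> [/eqmodP/asboolP|st]; [|apply/eqmodP/asboolP]. Qed.

Lemma tensor_piK (z : tensor) : exists s, z = tensor_pi s.
Proof. by exists (repr z); rewrite /tensor_pi reprK. Qed.

Lemma tensor_repr s : tensor_eq (repr (tensor_pi s)) s.
Proof. by apply/tensor_piP; rewrite /tensor_pi reprK. Qed.

(* x (y (x) u) = (x y) (x) u *)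
Definition formal_mul (x : A) (s : formal_sum) : formal_sum :=
  [seq (x * p.1, p.2) | p <- s].

Definition tensor_zero := tensor_pi [::].
Definition tensor_add (z w : tensor) := tensor_pi (repr z ++ repr w).
Definition tensor_scale (c : R[i]) (z : tensor) := tensor_pi (formal_mul c%:A (repr z)).
Definition tensor_opp (z : tensor) := tensor_scale (-1) z.

Lemma formal_mul_eq x s t :
  tensor_eq s t -> tensor_eq (formal_mul x s) (formal_mul x t).
Proof.
elim=> {s t} /=.
- by move=> s; apply: tensor_refl.
- by move=> s t _; apply: tensor_sym.
- by move=> s t w _ st _; apply: tensor_trans st.
- by move=> s s' t t' _ ss _ tt; rewrite /formal_mul !map_cat; apply: tensor_cat.
- by move=> s t; rewrite /formal_mul !map_cat; apply: tensor_comm.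
- by move=> u; rewrite mulr0; apply: tensor_0l.
- by move=> y z u; rewrite mulrDr; apply: tensor_Dl.
- by move=> y u v w; apply: tensor_Dr.
- by move=> y h u v uv; rewrite mulrA; apply: tensor_balance.
Qed.

Lemma tensor_addE s t : tensor_add (tensor_pi s) (tensor_pi t) = tensor_pi (s ++ t).
Proof. by apply/tensor_piP; apply: tensor_cat; apply: tensor_repr. Qed.
Lemma tensor_scaleE c s : tensor_scale c (tensor_pi s) = tensor_pi (formal_mul c%:A s).
Proof. by apply/tensor_piP/formal_mul_eq/tensor_repr. Qed.

Lemma tensor_catACA s s' t t' :
  tensor_eq ((s ++ s') ++ (t ++ t')) ((s ++ t) ++ (s' ++ t')).
Proof.
rewrite -!catA; apply: tensor_cat; first exact: tensor_refl.
by rewrite !catA; apply: tensor_cat; [apply: tensor_comm|apply: tensor_refl].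
Qed.

Lemma formal_mulD x y s : tensor_eq (formal_mul (x + y) s) (formal_mul x s ++ formal_mul y s).
Proof.
elim: s => [|[z u] s IH] /=; first exact: tensor_refl.
apply: (@tensor_trans _ ([:: (x * z, u); (y * z, u)] ++ (formal_mul x s ++ formal_mul y s))).
  by rewrite -cat1s; apply: tensor_cat IH; rewrite mulrDl; apply: tensor_Dl.
exact: (@tensor_catACA [:: (x * z, u)] [:: (y * z, u)]).
Qed.

Lemma formal_mul0 s : tensor_eq (formal_mul 0 s) [::].
Proof.
elim: s => [|[z u] s IH] /=; first exact: tensor_refl.
by rewrite mul0r -cat1s -[[::]]cats0; apply: tensor_cat IH; apply: tensor_0l.
Qed.

Lemma formal_mul1 s : formal_mul 1 s = s.
Proof. by elim: s => //= -[z u] s ->; rewrite mul1r. Qed.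

Fact tensor_addA : associative tensor_add.
Proof.
move=> z w t; have [? ->] := tensor_piK z; have [? ->] := tensor_piK w.
by have [? ->] := tensor_piK t; rewrite !tensor_addE catA.
Qed.
Fact tensor_addC : commutative tensor_add.
Proof.
move=> z w; have [? ->] := tensor_piK z; have [? ->] := tensor_piK w.
by rewrite !tensor_addE; apply/tensor_piP/tensor_comm.
Qed.
Fact tensor_add0 : left_id tensor_zero tensor_add.
Proof. by move=> z; have [? ->] := tensor_piK z; rewrite tensor_addE. Qed.
Fact tensor_addN : left_inverse tensor_zero tensor_opp tensor_add.
Proof.
move=> z; have [s ->] := tensor_piK z; rewrite /tensor_opp tensor_scaleE tensor_addE.
apply/tensor_piP; rewrite -{2}[s]formal_mul1.
apply: tensor_trans (tensor_sym (formal_mulD _ _ _)) _.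
by rewrite scaleN1r addNr; apply: formal_mul0.
Qed.
HB.instance Definition _ := GRing.isZmodule.Build tensor
  tensor_addA tensor_addC tensor_add0 tensor_addN.

Fact tensor_scaleA (c e : R[i]) z : tensor_scale c (tensor_scale e z) = tensor_scale (c * e) z.
Proof.
have [s ->] := tensor_piK z; rewrite !tensor_scaleE; congr tensor_pi.
rewrite /formal_mul -map_comp; apply: eq_map => -[y u] /=.
by rewrite mulrA -scalerAl mul1r scalerA.
Qed.
Fact tensor_scale1 : left_id (1 : R[i]) tensor_scale.
Proof.
by move=> z; have [s ->] := tensor_piK z; rewrite tensor_scaleE scale1r formal_mul1.
Qed.
Fact tensor_scaleDr : right_distributive tensor_scale (@GRing.add tensor).
Proof.
move=> c z w; rewrite /GRing.add /=; have [s ->] := tensor_piK z; have [t ->] := tensor_piK w.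
by rewrite tensor_addE !tensor_scaleE tensor_addE /formal_mul map_cat.
Qed.
Fact tensor_scaleDl z : {morph tensor_scale^~ z : c e / c + e}.
Proof.
move=> c e; have [s ->] := tensor_piK z; rewrite /= [RHS]/GRing.add /= !tensor_scaleE tensor_addE.
by apply/tensor_piP; rewrite scalerDl; apply: formal_mulD.
Qed.
HB.instance Definition _ := GRing.Zmodule_isLmodule.Build R[i] tensor
  tensor_scaleA tensor_scale1 tensor_scaleDr tensor_scaleDl.

(* The form < , >_0 in terms of representatives of its arguments. *)
Definition induced_form (s t : formal_sum) : R[i] :=
  \sum_(p <- s) \sum_(r <- t)
    inner (ract rho (gproj gr H (star r.1 * p.1)) (val p.2)) (val r.2).

Definition inducible := forall s : formal_sum, 0 <= induced_form s s.

(* [sigma] is a realization of Ind rho: the quotient of the tensor product by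
   the kernel of < , >_0 is identified with its isometric image under [iota]. *)
Definition is_induced (E : hilbertType R) (sigma : star_rep A E) :=
  exists (iota : {linear tensor -> E}) (pi0 : star_rep A E),
    [/\ forall s t, inner (iota (tensor_pi s)) (iota (tensor_pi t)) = induced_form s t,
        rdom pi0 = range iota,
        forall x s, ract pi0 x (iota (tensor_pi s)) = iota (tensor_pi (formal_mul x s))
      & is_closure pi0 sigma].

End Induction.

(* Main.v *)
(* The degree-zero part A_0 is generated by N = a^* a, so a positive character is a point
   t = chi(N) >= 0 of the line, and the partial action of a moves t to (t - 1) / q.
   Covariance and irreducibility make the spectral measure zero-one on invariant Borel
   sets. Iterating t |-> (t - 1) / q, one sees that a positive character lies on the
   orbit of 0, or is the fixed point 1 / (1 - q), or lies above it, where the fractional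
   part of a logarithm is a Borel function separating the orbits; hence the spectral
   measure has an atom t, which gives a unit vector e_0 in the domain that is an
   eigenvector of A_0.
   If t is not fixed, the vectors obtained from e_0 by powers of a and a^* are orthogonal
   eigenvectors of A_0. The projections onto their spans preserve the domain since pi is
   closed, so by irreducibility pi(A) e_0 is a core, and pi is induced from the character
   of A_0 at e_0.
   If t is fixed, irreducibility gives N = t on the whole domain, so pi is bounded and
   commutative. The kernel of |S| - S, for S self-adjoint in pi(A), reduces pi, hence every
   S - s is semidefinite, pi(A) consists of scalars, pi is one-dimensional and H = Z. *)
Require Import Defs.
From HB Require Import structures.
From mathcomp Require Import all_boot all_order all_algebra.
From mathcomp Require Import all_classical all_reals all_analysis.
From mathcomp Require Import complex ring lra.
Import Order.TTheory GRing.Theory Num.Theory.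
Import numFieldNormedType.Exports.
Local Open Scope classical_set_scope.
Local Open Scope ring_scope.
Import measurable_realfun.
Set Implicit Arguments.
Unset Strict Implicit.
Unset Printing Implicit Defensive.

(** * Hilbert spaces *)

(** Both cases end in one criterion, [induced_from_vector]: a unit vector e_0 that is an eigenvector
    of A_H, whose vector state vanishes in the degrees outside H, and whose orbit is a core. Then x
    (x) c |-> c pi(x) e_0 is isometric for the induced form, so Ind rho is realised in the given
    Hilbert space and is pi itself. H is decided by whether the vector state must vanish in nonzero
    degrees. In the coordinate w = (1 - q) t - 1 the map t |-> q t + 1 is multiplication by q, so W
    = (1 - q) N - 1 satisfies W x = q^(-n) x W for x of degree n. If w <> 0 at e_0, comparing the
    two sides at e_0 kills the state in every degree n <> 0, and H = 0 works; for q = 1 the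
    translation of N does the same. If w = 0, nothing prevents <pi(a) e_0, e_0> <> 0, so A_0 is too
    small and the whole algebra has to act on e_0 by scalars. The spectral measure enters through
    sets {chi | chi(N) in S} with S a Borel subset of the line: the zero-one law for invariant S and
    the search for an atom become statements on R. *)

Section InnerProduct.
Context (R : realType) (E : hilbertType R).
Implicit Types (u v w : E) (c : R[i]).

Lemma innerDl u v w : inner (u + v) w = inner u w + inner v w.
Proof. by rewrite -[u]scale1r inner_linearl mul1r scale1r. Qed.
Lemma inner0l w : inner (0 : E) w = 0.
Proof. by apply: (addrI (inner 0 w)); rewrite -innerDl !addr0. Qed.
Lemma innerZl c u w : inner (c *: u) w = c * inner u w.
Proof. by rewrite -[c *: u]addr0 inner_linearl inner0l addr0. Qed.
Lemma innerNl u w : inner (- u) w = - inner u w.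
Proof. by rewrite -scaleN1r innerZl mulN1r. Qed.
Lemma innerBl u v w : inner (u - v) w = inner u w - inner v w.
Proof. by rewrite innerDl innerNl. Qed.
Lemma inner_suml I (r : seq I) (P : pred I) (f : I -> E) w :
  inner (\sum_(i <- r | P i) f i) w = \sum_(i <- r | P i) inner (f i) w.
Proof. by elim/big_rec2: _ => [|i x y _ <-]; rewrite ?inner0l ?innerDl. Qed.

Lemma innerDr u v w : inner u (v + w) = inner u v + inner u w.
Proof. by rewrite innerC innerDl rmorphD /= -!innerC. Qed.
Lemma inner0r w : inner w (0 : E) = 0.
Proof. by rewrite innerC inner0l rmorph0. Qed.
Lemma innerZr c u w : inner u (c *: w) = c^* * inner u w.
Proof. by rewrite innerC innerZl rmorphM /= -innerC. Qed.
Lemma innerNr u w : inner u (- w) = - inner u w.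
Proof. by rewrite innerC innerNl rmorphN /= -innerC. Qed.
Lemma innerBr u v w : inner u (v - w) = inner u v - inner u w.
Proof. by rewrite innerDr innerNr. Qed.
Lemma inner_sumr I (r : seq I) (P : pred I) (f : I -> E) w :
  inner w (\sum_(i <- r | P i) f i) = \sum_(i <- r | P i) inner w (f i).
Proof. by elim/big_rec2: _ => [|i x y _ <-]; rewrite ?inner0r ?innerDr. Qed.

Lemma inner_ge0 u : 0 <= inner u u.
Proof. by rewrite inner_norm exprn_ge0. Qed.
Lemma inner_eq0 u : inner u u = 0 -> u = 0.
Proof. by rewrite inner_norm => /eqP; rewrite sqrf_eq0 normr_eq0 => /eqP. Qed.

Lemma cauchy_schwarz u v : `|inner u v| <= `|u| * `|v|.
Proof.
have [->|v0] := eqVneq v 0; first by rewrite inner0r normr0 mulr_ge0.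
have vv : 0 < inner v v by rewrite inner_norm exprn_gt0 // normr_gt0.
rewrite -(@ler_pXn2r _ 2) ?nnegrE ?mulr_ge0 // exprMn -!inner_norm.
(* This vector is <v, v> times the component of u orthogonal to v; the scaling avoids a division. *)
have := inner_ge0 (inner v v *: u - inner u v *: v).
have vr : (inner v v)^* = inner v v by rewrite -innerC.
rewrite !(innerBl, innerBr, innerZl, innerZr) vr normCK.
have -> : inner v u = (inner u v)^* by exact: innerC.
set x := inner u v; set y := x^*; set a := inner u u; set b := inner v v => H.
have {}H : 0 <= b * (a * b - x * y).
  by apply: le_trans H _; rewrite le_eqVlt; apply/orP; left; apply/eqP; ring.
by move: H; rewrite (pmulr_rge0 _ vv) subr_ge0.
Qed.

Lemma sqnormD u v :
  `|u + v| ^+ 2 = `|u| ^+ 2 + `|v| ^+ 2 + inner u v + (inner u v)^*.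
Proof. by rewrite -!inner_norm innerDl !innerDr -innerC; ring. Qed.

Lemma parallelogram u v :
  `|u + v| ^+ 2 + `|u - v| ^+ 2 = 2 * `|u| ^+ 2 + 2 * `|v| ^+ 2.
Proof. by rewrite !sqnormD normrN innerNr rmorphN; ring. Qed.

(** Has the shape of [spectral_form], so that the latter can be compared with an inner product in
    [point_eigenvector]. *)
Lemma polarization u v :
  inner u v = 4^-1 * \sum_(k < 4) 'i ^+ k * `|u + 'i ^+ k *: v| ^+ 2.
Proof.
apply: (@mulfI _ (4 : R[i])); first by rewrite pnatr_eq0.
rewrite mulrA mulfV ?pnatr_eq0 // mul1r.
have i2 : ('i : R[i]) * 'i = -1 by rewrite -expr2 sqrCi.
rewrite !big_ord_recr big_ord0 /= !sqnormD !innerZr !normrZ !normrX normCi.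
rewrite !expr1n !mul1r !rmorphM /= !rmorphXn /= conjCi !exprS !expr0.
set x := inner u v; set y := x^*; set a := `|u|; set b := `|v|.
have -> : (- 'i)^* = 'i :> R[i] by rewrite rmorphN /= conjCi opprK.
ring: i2.
Qed.

Lemma dense_orth (D : set E) u : dense D -> (forall v, D v -> inner u v = 0) -> u = 0.
Proof.
move=> dD uD; have [//|u0] := eqVneq u 0.
have n0 : 0 < `|u| by rewrite normr_gt0.
have [||v [uv Dv]] := dD (ball u `|u|).
- by exists u; apply: ballxx.
- exact: ball_open.
have := cauchy_schwarz u (u - v).
rewrite innerBr (uD _ Dv) subr0 inner_norm normrX normr_id expr2 ler_pM2l //.
move: uv; rewrite -ball_normE /= => uv /(lt_le_trans uv).
by rewrite ltxx.
Qed.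

(** Orthogonality is asked only eventually: a partial sum removes a given degree only from some
    index on. *)
Lemma cvg_orth (w : nat -> E) u v :
  w @ \oo --> u -> (\forall n \near \oo, inner (w n) v = 0) -> inner u v = 0.
Proof.
move=> wu wv; have [//|uv] := eqVneq (inner u v) 0.
have v0 : v != 0 by apply: contraNneq uv => ->; rewrite inner0r.
have vn : 0 < `|v| by rewrite normr_gt0.
have e0 : 0 < `|inner u v| / `|v| by rewrite divr_gt0 // normr_gt0.
have /cvgrPdist_lt/(_ _ e0) := wu => wu'.
have [n /= [n1 n2]] := filter_ex (filterI wu' wv).
have := cauchy_schwarz (u - w n) v; rewrite innerBl n2 subr0 => H.
by move: n1; rewrite ltr_pdivlMr // => /(le_lt_trans H); rewrite ltxx.
Qed.

End InnerProduct.

Lemma linear_op0 (R : realType) (E : hilbertType R) (T : E -> E) :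
  (forall (c : R[i]) u v, T (c *: u + v) = c *: T u + T v) -> T 0 = 0.
Proof.
move=> Tl; have := Tl 1 0 0; rewrite !scale1r addr0 => /eqP.
by rewrite -subr_eq0 opprD addrA subrr add0r oppr_eq0 => /eqP.
Qed.

Lemma linear_opB (R : realType) (E : hilbertType R) (T : E -> E) u v :
  (forall (c : R[i]) u v, T (c *: u + v) = c *: T u + T v) -> T (u - v) = T u - T v.
Proof. by move=> Tl; rewrite addrC -scaleN1r Tl scaleN1r addrC. Qed.

Section Completeness.
Context (R : realType) (E : hilbertType R).
Implicit Types (u v w : E) (c : R[i]).

(** Norms live in R[i], whose order is partial; a real-valued squared norm admits suprema and real
    arithmetic. *)
Definition sqn u : R := complex.Re (inner u u).

Lemma sqnE u : (sqn u)%:C%C = `|u| ^+ 2.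
Proof. by rewrite /sqn -inner_norm RRe_real // ger0_real // inner_ge0. Qed.

Lemma sqn_inner u : inner u u = (sqn u)%:C%C.
Proof. by rewrite sqnE inner_norm. Qed.

Lemma sqn_ge0 u : 0 <= sqn u.
Proof. by rewrite -lecR sqnE exprn_ge0. Qed.

Lemma sqn_eq0 u : sqn u = 0 -> u = 0.
Proof. by move=> u0; apply: inner_eq0; rewrite sqn_inner u0. Qed.

Lemma sqnZ c u : sqn (c *: u) = complex.Re (`|c| ^+ 2) * sqn u.
Proof.
have cc : (complex.Re (`|c| ^+ 2))%:C%C = `|c| ^+ 2 :> R[i].
  by rewrite RRe_real // ger0_real // exprn_ge0.
by apply: complexI; rewrite [LHS]sqnE [RHS]rmorphM [X in X * _]cc [X in _ * X]sqnE normrZ exprMn.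
Qed.

Lemma sqnN u : sqn (- u) = sqn u.
Proof. by apply: complexI; rewrite !sqnE normrN. Qed.

Lemma sqn_parallelogram u v : sqn (u + v) + sqn (u - v) = 2 * sqn u + 2 * sqn v.
Proof. by apply: complexI; rewrite !rmorphD /= !rmorphM /= !sqnE rmorph_nat parallelogram. Qed.

Lemma sqnD u v : sqn (u + v) = sqn u + sqn v + 2 * complex.Re (inner u v).
Proof.
apply: complexI; rewrite !rmorphD /= rmorphM /= !sqnE rmorph_nat sqnormD -addrA; congr (_ + _).
by rewrite -addcJ.
Qed.

Lemma posC (e : R[i]) : 0 < e -> exists2 d : R, 0 < d & e = d%:C%C.
Proof.
move=> e0; exists (complex.Re e); last by rewrite RRe_real // gtr0_real.
by rewrite -ltcR RRe_real // gtr0_real.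
Qed.

Lemma norm_lt_sqn u (e : R) : 0 < e -> (`|u| < e%:C%C) = (sqn u < e ^+ 2).
Proof.
by move=> e0; rewrite -ltcR sqnE rmorphXn /= ltr_pXn2r // nnegrE // ler0c ltW.
Qed.

Lemma cauchy_sqn_cvg (w : nat -> E) :
  (forall e : R, 0 < e -> exists N, forall m n, (N <= m)%N -> (m <= n)%N ->
     sqn (w n - w m) <= e) -> cvg (w @ \oo).
Proof.
move=> H; apply: cauchy_cvg; apply: cauchy_exP => _ /posC [d d0 ->].
have [|N HN] := H (d ^+ 2 / 2); first by rewrite divr_gt0 // exprn_gt0.
exists (w N), N => // n /= Nn; rewrite -ball_normE /ball_ /=.
rewrite norm_lt_sqn // -sqnN opprB; apply: le_lt_trans (HN N n _ Nn) _ => //.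
by have := exprn_gt0 2 d0; lra.
Qed.

(** The hypothesis makes s nondecreasing; being bounded, it has small increments near its supremum,
    and these dominate those of w. Serves both Bessel sums and the iteration for the absolute
    value. *)
Lemma monotone_sqn_cvg (w : nat -> E) (s : nat -> R) (M : R) :
  (forall m n, (m <= n)%N -> sqn (w n - w m) <= s n - s m) ->
  (forall n, s n <= M) -> cvg (w @ \oo).
Proof.
move=> ws sM; apply: cauchy_sqn_cvg => e e0.
have hs : has_sup (range s).
  by split; [exists (s 0%N), 0%N|exists M => _ [n _ <-]].
have [_ [N _ <-] HN] := sup_adherent e0 hs.
exists N => m n Nm mn; apply: le_trans (ws _ _ mn) _.
have := ws _ _ Nm; have := sqn_ge0 (w m - w N).
have : s n <= sup (range s) by apply: ub_le_sup; [case: hs|exists n].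
by lra.
Qed.

Lemma closed_cvg_seq (K : set E) (w : nat -> E) u :
  closed K -> (forall n, K (w n)) -> w @ \oo --> u -> K u.
Proof. by move=> cK Kw wu; apply: (closed_cvg K cK _ _ wu); apply: nearW. Qed.

Lemma sqn_cvg_le (w : nat -> E) u (d : R) : w @ \oo --> u ->
  (forall e, 0 < e -> \forall n \near \oo, sqn (w n) <= d + e) -> sqn u <= d.
Proof.
move=> wu wd; apply/ler_addgt0Pr => e e0.
have e4 : 0 < e / 4 by rewrite divr_gt0.
have dge : 0 <= d + e.
  have [n /= hn] := filter_ex (wd _ e0); exact: le_trans (sqn_ge0 _) hn.
(* [1 + |d| + e] bounds the norms of late terms, and [t] makes t^2 + 2 t (1 + |d| + e) at most e /
   4. *)
pose t := Num.min 1 ((e / 4) / (1 + 2 * (1 + `|d| + e))).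
have D0 : 0 < 1 + 2 * (1 + `|d| + e) by have := normr_ge0 d; lra.
have t0 : 0 < t by rewrite lt_min ltr01 divr_gt0.
have t1 : t <= 1 by rewrite ge_min lexx.
have tD : t * (1 + 2 * (1 + `|d| + e)) <= e / 4 by rewrite -ler_pdivlMr // ge_min lexx orbT.
have tc : 0 < t%:C%C :> R[i] by rewrite ltcR.
have /cvgrPdist_lt/(_ _ tc) wu' := wu.
have [n /= [n1 n2]] := filter_ex (filterI wu' (wd _ e4)).
move: n1; rewrite norm_lt_sqn // => n1.
rewrite -[u](subrK (w n)) sqnD.
have cs : complex.Re (inner (u - w n) (w n)) <= t * (1 + `|d| + e).
  have b0 : 0 < 1 + `|d| + e by have := normr_ge0 d; lra.
  rewrite -lecR rmorphM /=; apply: (@le_trans _ _ `|complex.Re (inner (u - w n) (w n))|%:C%C).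
    by rewrite lecR ler_norm.
  apply: le_trans (normc_ge_Re _) _; apply: le_trans (cauchy_schwarz _ _) _.
  apply: ler_pM => //; apply: ltW; rewrite norm_lt_sqn //.
  apply: le_lt_trans n2 _; rewrite expr2.
  have := ler_norm d; have := normr_ge0 d; nra.
have : t ^+ 2 <= t by rewrite expr2; nra.
by lra.
Qed.

Lemma orthogonal_projection_exists (K : set E) u :
  closed K -> K 0 -> (forall c v w, K v -> K w -> K (c *: v + w)) ->
  exists2 w, K w & forall v, K v -> inner (u - w) v = 0.
Proof.
move=> cK K0 Kl.
pose A := [set sqn (u - w) | w in K].
have hA : has_inf A.
  by split; [exists (sqn (u - 0)), 0|exists 0 => _ [w _ <-]; exact: sqn_ge0].
have ex n : exists w, K w /\ sqn (u - w) < inf A + n.+1%:R^-1.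
  have [|_ [w Kw <-] ?] := inf_adherent (_ : 0 < n.+1%:R^-1) hA; first by rewrite invr_gt0.
  by exists w.
have [w Hw] := choice ex.
have Kw n : K (w n) by case: (Hw n).
have infA v : K v -> inf A <= sqn (u - v).
  by move=> Kv; apply: ge_inf; [case: hA|exists v].
(* Midpoints of the minimising sequence stay in K, so the parallelogram law gives sqn (w n - w m) <=
   2 / (m + 1) + 2 / (n + 1). *)
have /cvg_ex[l wl] : cvg (w @ \oo).
  apply: cauchy_sqn_cvg => e e0.
  have [N HN] : exists N, 4 * N.+1%:R^-1 <= e.
    exists (Num.truncn (4 / e)); rewrite ler_pdivrMr ?ltr0n // mulrC -ler_pdivrMr //.
    by apply: ltW; rewrite truncnS_gt.
  exists N => m n Nm mn; apply: le_trans HN.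
  have := sqn_parallelogram (u - w m) (u - w n).
  have -> : u - w m - (u - w n) = w n - w m by rewrite opprB addrC addrA subrK.
  have -> : u - w m + (u - w n) = 2 *: (u - 2^-1 *: (w m + w n)).
    rewrite scalerBr scalerA mulfV ?pnatr_eq0 // scale1r addrACA -opprD.
    by rewrite -mulr2n -scaler_nat.
  have Kmid : K (2^-1 *: (w m + w n)).
    rewrite -[X in K X]addr0; apply: (Kl) K0.
    by rewrite -[w m]scale1r; apply: Kl.
  have := infA _ Kmid; rewrite sqnZ normr_nat -natrX.
  have -> : complex.Re (2 ^ 2)%:R = 4 :> R.
    by apply: complexI; rewrite RRe_real ?rmorph_nat // realn.
  have [_] := Hw m; have [_] := Hw n.
  have mle : m.+1%:R^-1 <= N.+1%:R^-1 :> R by rewrite lef_pV2 ?posrE ?ltr0n // ler_nat ltnS.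
  have nle : n.+1%:R^-1 <= N.+1%:R^-1 :> R.
    by rewrite lef_pV2 ?posrE ?ltr0n // ler_nat ltnS (leq_trans Nm).
  move: mle nle; set a := m.+1%:R^-1; set b := n.+1%:R^-1; set d := N.+1%:R^-1; set x := sqn (w n - w m).
  by lra.
have Kl' : K l by apply: closed_cvg_seq cK Kw wl.
exists l => // v Kv.
have uinf : sqn (u - l) <= inf A.
  have wul : (fun n => u - w n) @ \oo --> u - l by apply: cvgB => //; apply: cvg_cst.
  apply: sqn_cvg_le wul _ => e e0.
  have [N HN] : exists N, N.+1%:R^-1 <= e.
    exists (Num.truncn (e^-1)); rewrite -[leRHS]invrK lef_pV2 ?posrE ?ltr0n ?invr_gt0 //.
    by apply: ltW; rewrite truncnS_gt.
  exists N => // n /= Nn; have [_ /ltW hn] := Hw n; apply: le_trans hn _.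
  rewrite lerD2l; apply: le_trans HN.
  by rewrite lef_pV2 ?posrE ?ltr0n // ler_nat ltnS.
have [v0|v0] := eqVneq v 0; first by rewrite v0 inner0r.
pose x := inner (u - l) v.
have vv : 0 < `|v| ^+ 2 by rewrite exprn_gt0 // normr_gt0.
pose c := x / `|v| ^+ 2.
have cr : (`|v| ^+ 2)^* = `|v| ^+ 2 by rewrite -inner_norm -innerC.
(* [c] is the coefficient of u - l along v: moving l by c v would lower the squared distance by
   |x|^2 / |v|^2. *)
have Kc : K (c *: v + l) by apply: Kl.
have := le_trans uinf (infA _ Kc).
have -> : u - (c *: v + l) = (u - l) - c *: v by rewrite opprD addrA addrAC.
rewrite -lecR !sqnE -!inner_norm.
have -> : inner (u - l - c *: v) (u - l - c *: v) = inner (u - l) (u - l) - x * x^* / `|v| ^+ 2.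
  rewrite /x /c /x; move: (u - l) => z.
  rewrite innerBl !innerBr !innerZl !innerZr.
  have -> : inner v z = (inner z v)^* by exact: innerC.
  rewrite [inner v v]inner_norm rmorphM fmorphV /= cr; field.
  by rewrite normr_eq0.
rewrite -normCK lerDl oppr_ge0 pmulr_lle0 ?invr_gt0 // => H.
have : `|x| ^+ 2 == 0 by rewrite eq_le H exprn_ge0.
by rewrite sqrf_eq0 normr_eq0 => /eqP.
Qed.

End Completeness.

(** * The graded oscillator algebra *)

Section OscillatorAlgebra.
Context (R : realType) (q : R) (q_gt0 : 0 < q).
Local Notation A := (oscillator q).
Local Notation a := (osc_a q).
Local Notation qc := (q%:C%C : R[i]).

Definition osc_N : A := star a * a.
Local Notation N := osc_N.

Let qc0 : qc != 0.
Proof. by rewrite eq_complex /= eqxx andbT gt_eqF. Qed.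

Lemma osc_aN : a * N = (qc *: N + 1) * a.
Proof. by rewrite mulrA osc_relE. Qed.

Lemma osc_Na : N * a = a * (qc^-1 *: (N - 1)).
Proof.
rewrite -scalerAr mulrBr osc_aN mulrDl mul1r mulr1 addrK -scalerAl.
by rewrite scalerA mulVf // scale1r.
Qed.

Lemma osc_Nstar : N * star a = star a * (qc *: N + 1).
Proof. by rewrite /N -[LHS]mulrA osc_relE. Qed.

Definition osc_poly (p : {poly R[i]}) : A := horner_alg N p.

Lemma osc_polyD p r : osc_poly (p + r) = osc_poly p + osc_poly r.
Proof. exact: rmorphD. Qed.
Lemma osc_polyM p r : osc_poly (p * r) = osc_poly p * osc_poly r.
Proof. exact: rmorphM. Qed.
Lemma osc_polyC c : osc_poly c%:P = c *: 1.
Proof. by rewrite /osc_poly /= horner_algC. Qed.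
Lemma osc_polyX : osc_poly 'X = N.
Proof. by rewrite /osc_poly /= horner_algX. Qed.

(** An element that carries N to r(N) carries p(N) to p(r(N)): the partial action on the level of
    the algebra. *)
Lemma osc_poly_shift (x : A) (r : {poly R[i]}) :
  N * x = x * osc_poly r -> forall p, osc_poly p * x = x * osc_poly (p \Po r).
Proof.
move=> Nx; elim/poly_ind => [|p c IH].
  by rewrite comp_poly0 /osc_poly !raddf0 mul0r mulr0.
rewrite comp_polyD comp_polyM comp_polyX comp_polyC !osc_polyD !osc_polyM osc_polyX !osc_polyC.
by rewrite mulrDl mulrDr -[_ * N * x]mulrA Nx mulrA IH mulrA -scalerAl -scalerAr mul1r mulr1.
Qed.

Lemma osc_poly_a : N * a = a * osc_poly (qc^-1 *: ('X - 1)).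
Proof.
rewrite osc_Na -mul_polyC osc_polyM osc_polyC -scalerAl mul1r.
by rewrite /osc_poly rmorphB rmorph1 /= horner_algX.
Qed.

Lemma osc_poly_star : N * star a = star a * osc_poly (qc *: 'X + 1).
Proof.
rewrite osc_Nstar osc_polyD -mul_polyC osc_polyM osc_polyC -scalerAl mul1r osc_polyX.
by rewrite /osc_poly rmorph1.
Qed.

Definition osc_mono (n : int) : A :=
  match n with Posz k => a ^+ k | Negz k => star a ^+ k.+1 end.

(** The polynomial stands on the right, where an eigenvector of A_0 absorbs it into a scalar. *)
Definition osc_homog (n : int) (x : A) := exists p, x = osc_mono n * osc_poly p.

Lemma osc_homog_lin n (c : R[i]) x y :
  osc_homog n x -> osc_homog n y -> osc_homog n (c *: x + y).
Proof.
move=> [p ->] [r ->]; exists (c%:P * p + r).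
by rewrite osc_polyD osc_polyM osc_polyC mulrDr -scalerAl mul1r scalerAr.
Qed.

Lemma osc_homog_poly n x p : osc_homog n x -> osc_homog n (x * osc_poly p).
Proof. by move=> [r ->]; exists (r * p); rewrite osc_polyM mulrA. Qed.

Lemma osc_homog_a n x : osc_homog n x -> osc_homog (n + 1) (x * a).
Proof.
move=> [p ->]; rewrite -mulrA (osc_poly_shift osc_poly_a).
rewrite mulrA; apply: osc_homog_poly; case: n => [k|k].
  by exists 1; rewrite /osc_poly rmorph1 mulr1 -exprSr -PoszD addn1.
exists 'X; rewrite osc_polyX [osc_mono (Negz k)]exprSr -mulrA; congr (_ * _).
case: k => [|k] //; have -> : Negz k.+1 + 1 = Negz k; last by [].
by rewrite !NegzE -[k.+2]addn1 PoszD opprD subrK.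
Qed.

Lemma osc_homog_star n x : osc_homog n x -> osc_homog (n - 1) (x * star a).
Proof.
move=> [p ->]; rewrite -mulrA (osc_poly_shift osc_poly_star).
rewrite mulrA; apply: osc_homog_poly; case: n => [[|k]|k].
- by exists 1; rewrite /osc_poly rmorph1 mulr1 /= expr0 mul1r.
- have -> : Posz k.+1 - 1 = k by rewrite -addn1 PoszD addrK.
  exists (qc *: 'X + 1); rewrite osc_polyD -mul_polyC osc_polyM osc_polyC -scalerAl mul1r osc_polyX.
  by rewrite /osc_poly rmorph1 -osc_relE mulrA /= exprSr.
- exists 1; rewrite /osc_poly rmorph1 mulr1.
  have -> : Negz k - 1 = Negz k.+1 by rewrite !NegzE -[k.+2]addn1 PoszD opprD.
  by rewrite /= -exprSr.
Qed.

(** The arbitrary left factor x strengthens the induction: the product case becomes a composition of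
    two right multiplications. *)
Lemma osc_compM_homog n (y : A) : osc_comp n y ->
  forall m x, osc_homog m x -> osc_homog (m + n) (x * y).
Proof.
elim=> {n y} [||| n|n c y z _ IHy _ IHz|m n y z _ IHy _ IHz] k x hx.
- exact: osc_homog_a.
- exact: osc_homog_star.
- by rewrite addr0 mulr1.
- by exists 0; rewrite /osc_poly raddf0 !mulr0.
- by rewrite mulrDr -scalerAr; apply: osc_homog_lin; [apply: IHy|apply: IHz].
- by rewrite addrA mulrA; apply/IHz/IHy.
Qed.

Lemma osc_comp_homog n (x : A) : osc_comp n x -> osc_homog n x.
Proof.
move=> /osc_compM_homog/(_ 0 1); rewrite add0r mul1r; apply.
by exists 1; rewrite /osc_poly rmorph1 mulr1.
Qed.

Lemma osc_comp0_poly (x : A) : osc_comp 0 x -> exists p, x = osc_poly p.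
Proof. by move=> /osc_comp_homog[p ->]; exists p; rewrite /= expr0 mul1r. Qed.

Lemma osc_comp0_comm (x y : A) : osc_comp 0 x -> osc_comp 0 y -> x * y = y * x.
Proof.
by move=> /osc_comp0_poly[p ->] /osc_comp0_poly[r ->]; rewrite -!osc_polyM mulrC.
Qed.

Lemma osc_mono_comp n : @osc_comp R q n (osc_mono n).
Proof.
case: n => k.
  elim: k => [|k IH]; first exact: osc_comp_1.
  by rewrite /= exprSr -addn1 PoszD; apply: osc_comp_mul IH (osc_comp_a q).
elim: k => [|k IH]; first exact: osc_comp_star_a.
rewrite /= exprSr NegzE -addn1 PoszD opprD -NegzE.
exact: osc_comp_mul IH (osc_comp_star_a q).
Qed.

Lemma osc_N_comp : @osc_comp R q 0 N.
Proof. by rewrite -(addNr (1 : int)); apply: osc_comp_mul (osc_comp_star_a q) (osc_comp_a q). Qed.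

Lemma osc_poly_comp p : osc_comp 0 (osc_poly p).
Proof.
elim/poly_ind: p => [|p c IH]; first by rewrite /osc_poly raddf0; apply: osc_comp_0.
rewrite osc_polyD osc_polyM osc_polyX osc_polyC addrC; apply: osc_comp_lin.
  exact: osc_comp_1.
by rewrite -(addr0 (0 : int)); apply: osc_comp_mul osc_N_comp.
Qed.

Lemma osc_comp0_mono n (b : A) : osc_comp 0 b ->
  exists2 b', osc_comp 0 b' & b * osc_mono n = osc_mono n * b'.
Proof.
move=> b0; have := osc_comp_mul b0 (osc_mono_comp n); rewrite add0r.
by move=> /osc_comp_homog[p ->]; exists (osc_poly p) => //; apply: osc_poly_comp.
Qed.

(* (1 - q) N - 1: for q <> 1, a multiple of N minus the fixed point of t |-> q t + 1. *)
Definition osc_W : A := osc_poly ((1 - qc) *: 'X - 1).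
Local Notation W := osc_W.

Lemma osc_W_shift n (x : A) : osc_comp n x -> W * x = qc ^ (- n) *: (x * W).
Proof.
have qV : (qc^-1)%:P * qc%:P = 1 by rewrite -polyCM mulVf.
have polyZ c p : osc_poly (c *: p) = c *: osc_poly p.
  by rewrite -mul_polyC osc_polyM osc_polyC -scalerAl mul1r.
elim=> {n x} [||| n|n c x y _ IHx _ IHy|m n x y _ IHx _ IHy].
- rewrite /W (osc_poly_shift osc_poly_a) exprN1 scalerAr -polyZ; congr (_ * osc_poly _).
  rewrite comp_polyB comp_polyZ comp_polyX comp_polyC -!mul_polyC polyCB polyC1.
  by ring: qV.
- rewrite /W (osc_poly_shift osc_poly_star) opprK expr1z scalerAr -polyZ; congr (_ * osc_poly _).
  rewrite comp_polyB comp_polyZ comp_polyX comp_polyC -!mul_polyC polyCB polyC1.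
  by ring.
- by rewrite oppr0 expr0z scale1r mulr1 mul1r.
- by rewrite mulr0 mul0r scaler0.
- by rewrite mulrDr mulrDl -scalerAr IHx IHy scalerDr -scalerAl scalerA mulrC -scalerA.
- rewrite mulrA IHx -scalerAl -[x * W * y]mulrA IHy -scalerAr scalerA mulrA.
  by rewrite opprD expfzDr.
Qed.

(** For q = 1 the element [osc_W] is the constant -1 and separates nothing; the eigenvalues of N are
    translated instead of scaled. *)
Lemma osc_N_shift n (x : A) : q = 1 -> osc_comp n x -> N * x = x * N - n%:~R *: x.
Proof.
move=> q1; have qc1 : qc = 1 by rewrite q1.
elim=> {n x} [||| n|n c x y _ IHx _ IHy|m n x y _ IHx _ IHy].
- by rewrite osc_Na qc1 invr1 scale1r mulrBr mulr1 scale1r.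
- by rewrite osc_Nstar qc1 scale1r mulrDr mulr1 scaleN1r opprK.
- by rewrite mulr1 mul1r scale0r subr0.
- by rewrite mulr0 mul0r scaler0 subr0.
- rewrite mulrDr mulrDl -scalerAr IHx IHy scalerBr scalerDr -scalerAl opprD addrACA.
  by rewrite !scalerA [c * _]mulrC.
- rewrite mulrA IHx mulrBl -[x * N * y]mulrA IHy mulrBr -scalerAl -scalerAr mulrA.
  by rewrite -addrA -opprD -scalerDl addrC rmorphD addrC [n%:~R + _]addrC.
Qed.

Lemma osc_ind (S : A -> Prop) : S a -> S (star a) -> (forall c, S (c *: 1)) ->
  (forall x y, S x -> S y -> S (x + y)) -> (forall x y, S x -> S y -> S (x * y)) -> forall x, S x.
Proof.
move=> Sa Ss Sc SD SM x; have [t ->] := osc_piK x; elim: t => [||c|y IHy z IHz|y IHy z IHz].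
- exact: Sa.
- by rewrite -osc_star_aE.
- by rewrite osc_piC.
- by rewrite osc_piD; apply: SD.
- by rewrite osc_piM; apply: SM.
Qed.

End OscillatorAlgebra.

(** * Representations induced from a vector state *)

Lemma norm_realc (R : rcfType) (k : R) : `|k%:C%C| = `|k|%:C%C.
Proof. by rewrite normc_def /= expr0n addr0 sqrtr_sqr. Qed.

(* An alias, since the completeness instance of the library for [R^o] would shadow
   one declared for [R[i]^o]. *)
Definition Cline (R : realType) : Type := R[i]^o.

Section ComplexLine.
Context (R : realType).
Local Notation K := (Cline R).

HB.instance Definition _ := NormedModule.copy K R[i]^o.

Fact Cline_complete (F : set_system K) : ProperFilter F -> cauchy F -> cvg F.
Proof.
move=> FF /cauchy_ballP Fc.
have part (f : K -> R) : (forall x y : K, `|f x - f y|%:C%C <= `|x - y|) -> cvg (f @ F).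
  move=> fl; apply: cauchy_cvg; apply/cauchy_ballP => e e0.
  have e0c : 0 < e%:C%C :> R[i] by rewrite ltcR.
  have := Fc _ e0c; rewrite /nbhs /= => -[[P Q] /= [FP FQ] PQ].
  exists (f @` P, f @` Q) => /=; first split; rewrite /nbhs /=.
  - by apply: filterS FP => x; exists x.
  - by apply: filterS FQ => x; exists x.
  move=> [_ _] /= [[x Px <-] [y Qy <-]]; have := PQ (x, y) (conj Px Qy).
  by rewrite -!ball_normE /ball_ /= => xy; rewrite -ltcR; apply: le_lt_trans xy.
have /cvg_ex[/= a Fa] : cvg ((@complex.Re R) @ F).
  by apply: part => -[x1 x2] [y1 y2]; apply: (normc_ge_Re ((x1 +i* x2)%C - (y1 +i* y2)%C)).
have /cvg_ex[/= b Fb] : cvg ((@complex.Im R) @ F).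
  apply: part => -[x1 x2] [y1 y2].
  have := normc_ge_Re (((x1 +i* x2)%C - (y1 +i* y2)%C) * 'i%C); rewrite ReiNIm normrN normrM.
  by rewrite complexiE normCi mulr1.
apply/cvg_ex; exists (a +i* b)%C; apply/cvgrPdist_lt => _ /posC[e e0 ->].
have e2 : 0 < e / 2 by rewrite divr_gt0.
move/cvgrPdist_lt/(_ _ e2): Fa => Fa; move/cvgrPdist_lt/(_ _ e2): Fb => Fb.
apply: filterS (filterI Fa Fb) => -[x y] [/= ax bY].
have -> : (a +i* b)%C - (x +i* y)%C = (a - x)%:C%C + 'i * (b - y)%:C%C.
  by rewrite -complexiE; apply/eqP; rewrite eq_complex /= !(mul0r, mul1r, subr0, add0r, addr0) ?eqxx.
apply: le_lt_trans (ler_normD _ _) _; rewrite normrM normCi mul1r.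
rewrite !norm_realc.
by rewrite -rmorphD ltcR; lra.
Qed.

HB.instance Definition _ := Uniform_isComplete.Build K Cline_complete.

Definition Cline_inner (u v : K) : R[i] := (u : R[i]) * (v : R[i])^*.

Fact Cline_inner_linearl (c : R[i]) (u v w : K) :
  Cline_inner (c *: u + v) w = c * Cline_inner u w + Cline_inner v w.
Proof. by rewrite /Cline_inner [_ + _ in LHS]/(c * (u : R[i]) + (v : R[i])) mulrDl mulrA. Qed.

Fact Cline_innerC (u v : K) : Cline_inner v u = (Cline_inner u v)^*.
Proof. by rewrite /Cline_inner rmorphM /= conjCK mulrC. Qed.

Fact Cline_inner_norm (u : K) : Cline_inner u u = `|u| ^+ 2.
Proof. by rewrite /Cline_inner -normCK. Qed.

HB.instance Definition _ := CompleteNormedModule_isHilbert.Build R K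
  Cline_inner_linearl Cline_innerC Cline_inner_norm.

End ComplexLine.

Section StarRepTheory.
Context (R : realType) (A : starAlgType R) (E : hilbertType R) (pi : star_rep A E).
Implicit Types (x y : A) (u v : E).

Lemma ract_vec0 x : ract pi x 0 = 0.
Proof.
have := ract_linear x 1 (rdom0 pi) (rdom0 pi); rewrite !scale1r addr0 => /eqP.
by rewrite -subr_eq0 opprD addrA subrr add0r oppr_eq0 => /eqP.
Qed.

Lemma ractZ x c u : rdom pi u -> ract pi x (c *: u) = c *: ract pi x u.
Proof.
move=> du; rewrite -[c *: u]addr0 ract_linear //; last exact: rdom0.
by rewrite ract_vec0 addr0.
Qed.

Lemma ractD x u v : rdom pi u -> rdom pi v -> ract pi x (u + v) = ract pi x u + ract pi x v.
Proof. by move=> du dv; rewrite -[u]scale1r ract_linear // !scale1r. Qed.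

Lemma rdomZ c u : rdom pi u -> rdom pi (c *: u).
Proof. by move=> du; rewrite -[_ *: _]addr0; apply: rdom_linear => //; apply: rdom0. Qed.

Lemma rdomD u v : rdom pi u -> rdom pi v -> rdom pi (u + v).
Proof. by move=> du dv; rewrite -[u]scale1r; apply: rdom_linear. Qed.

Lemma rdomB u v : rdom pi u -> rdom pi v -> rdom pi (u - v).
Proof. by move=> du dv; rewrite addrC -scaleN1r; apply: rdom_linear. Qed.

Lemma ractB x u v : rdom pi u -> rdom pi v -> ract pi x (u - v) = ract pi x u - ract pi x v.
Proof.
move=> du dv; rewrite ractD //; last by rewrite -scaleN1r; apply: rdomZ.
by rewrite -scaleN1r ractZ // scaleN1r.
Qed.

Lemma rdom_sum I (r : seq I) (f : I -> E) :
  (forall i, rdom pi (f i)) -> rdom pi (\sum_(i <- r) f i).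
Proof. by move=> df; elim/big_ind: _ => //; [apply: rdom0|apply: rdomD]. Qed.

Lemma ract_sum x I (r : seq I) (f : I -> E) : (forall i, rdom pi (f i)) ->
  ract pi x (\sum_(i <- r) f i) = \sum_(i <- r) ract pi x (f i).
Proof.
move=> df; elim: r => [|i r IH]; first by rewrite !big_nil ract_vec0.
by rewrite !big_cons ractD ?IH //; apply: rdom_sum.
Qed.

Lemma ract0 u : rdom pi u -> ract pi 0 u = 0.
Proof. by move=> du; have := ract_algZ 0 0 du; rewrite !scale0r. Qed.

Lemma ract_alg_sum I (r : seq I) (f : I -> A) u : rdom pi u ->
  ract pi (\sum_(i <- r) f i) u = \sum_(i <- r) ract pi (f i) u.
Proof.
move=> du; elim: r => [|i r IH]; first by rewrite !big_nil ract0.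
by rewrite !big_cons ract_algD ?IH.
Qed.

Lemma ract_star_r x u v : rdom pi u -> rdom pi v ->
  inner u (ract pi x v) = inner (ract pi (star x) u) v.
Proof. by move=> du dv; rewrite ract_star // starK. Qed.

End StarRepTheory.

Section InducedFromVector.
Context (R : realType) (A : starAlgType R) (gr : grading A) (H : zmodClosed int).
Context (E : hilbertType R) (pi : star_rep A E) (e0 : E).
Hypotheses (pi_closed : closed_rep pi) (e0_dom : rdom pi e0) (e0_unit : inner e0 e0 = 1).
Hypothesis e0_eigen : forall x, graded_span gr H x ->
  ract pi x e0 = inner (ract pi x e0) e0 *: e0.
Hypothesis e0_orth : forall x, graded_span gr [predC H] x -> inner (ract pi x e0) e0 = 0.
(** The approximants [w n] do not depend on x, so the convergence is in the graph topology and pi(A)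
    e_0 is a core. *)
Hypothesis e0_cyclic : forall u, rdom pi u -> exists w : nat -> A, forall x,
  (fun n => ract pi x (ract pi (w n) e0)) @ \oo --> ract pi x u.
Local Notation K := (Cline R).

Definition vector_state (x : subalg gr H) : R[i] := inner (ract pi (val x) e0) e0.

Let stateE (x : subalg gr H) : ract pi (val x) e0 = vector_state x *: e0.
Proof. by apply: e0_eigen; apply/asboolP/(subalg_valP x). Qed.

Let state_act (x : subalg gr H) (u : K) : K := vector_state x * (u : R[i]).

Let state_linear x (c : R[i]) (u v : K) : setT u -> setT v ->
  state_act x (c *: u + v) = c *: state_act x u + state_act x v.
Proof.
move=> _ _; rewrite /state_act [_ + _ in LHS]/(c * (u : R[i]) + (v : R[i])).
by rewrite mulrDr mulrCA.
Qed.

Let state_algD x y (u : K) : setT u -> state_act (x + y) u = state_act x u + state_act y u.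
Proof. by move=> _; rewrite /state_act /vector_state raddfD /= ract_algD // innerDl mulrDl. Qed.

Let state_algZ (c : R[i]) x (u : K) : setT u -> state_act (c *: x) u = c *: state_act x u.
Proof.
move=> _; rewrite /state_act /vector_state.
have -> : val (c *: x) = c *: val x by exact: linearZ.
by rewrite ract_algZ // innerZl -mulrA.
Qed.

Let state_algM x y (u : K) : setT u -> state_act (x * y) u = state_act x (state_act y u).
Proof.
move=> _; rewrite /state_act mulrA; congr (_ * _).
rewrite {1}/vector_state rmorphM /= ract_algM // (stateE y) ractZ // stateE.
by rewrite !innerZl e0_unit mulr1 mulrC.
Qed.

Let state_alg1 (u : K) : setT u -> state_act 1 u = u.
Proof. by move=> _; rewrite /state_act /vector_state rmorph1 ract_alg1 // e0_unit mul1r. Qed.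

Let state_star x (u v : K) : setT u -> setT v ->
  inner (state_act x u) v = inner u (state_act (star x) v).
Proof.
move=> _ _; rewrite /state_act /inner /= /Cline_inner.
have -> : vector_state (star x) = (vector_state x)^*.
  by rewrite /vector_state /= ract_star // starK -innerC.
by rewrite rmorphM /= conjCK mulrAC mulrC mulrA.
Qed.

Definition state_rep : star_rep (subalg gr H) K :=
  @StarRep _ _ K setT state_act I (fun _ _ _ _ _ => I)
    (fun O O0 _ => match O0 with ex_intro x Ox => ex_intro _ x (conj Ox I) end)
    (fun _ _ _ => I) state_linear state_algD state_algZ state_algM state_alg1 state_star.

Lemma state_rep_one_dimensional : one_dimensional state_rep.
Proof.
exists (1 : R[i]); first exact: oner_neq0.
by apply/seteqP; split=> // u _; exists (u : R[i]) => //; rewrite /GRing.scale /= mulr1.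
Qed.

(** The domain of rho is the complex line and x (x) c = c x (x) 1, so a single algebra element
    represents a whole tensor. *)
Definition formal_vector (s : formal_sum state_rep) : A :=
  \sum_(p <- s) ((val p.2 : K) : R[i]) *: p.1.

Lemma formal_vector_eq s t : tensor_eq s t ->
  ract pi (formal_vector s) e0 = ract pi (formal_vector t) e0.
Proof.
elim=> {s t} //=.
- by move=> s t w _ -> _ ->.
- move=> s s' t t' _ IHs _ IHt; rewrite /formal_vector !big_cat /=.
  by rewrite !ract_algD // -!/(formal_vector _) IHs IHt.
- by move=> s t; rewrite /formal_vector !big_cat /= addrC.
- by move=> u; rewrite /formal_vector big_seq1 big_nil scaler0.
- by move=> x y u; rewrite /formal_vector !big_cons !big_nil /= !addr0 scalerDr.
- move=> x u v w uvw; rewrite /formal_vector !big_cons !big_nil /= !addr0 uvw.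
  by rewrite -scalerDl.
- move=> x h u v uv; rewrite /formal_vector !big_cons !big_nil /= !addr0 uv.
  rewrite !ract_algZ // ract_algM // stateE ractZ // scalerA.
  by rewrite [X in _ = X *: _]/(vector_state h * _) mulrC.
Qed.

Definition state_iota (z : tensor state_rep) : E := ract pi (formal_vector (repr z)) e0.

Lemma state_iotaE s : state_iota (tensor_pi s) = ract pi (formal_vector s) e0.
Proof. by apply: formal_vector_eq; apply: tensor_repr. Qed.

Lemma formal_vectorM x s : formal_vector (formal_mul x s) = x * formal_vector s.
Proof.
rewrite /formal_vector /formal_mul big_map mulr_sumr.
by apply: eq_bigr => p _; rewrite scalerAr.
Qed.

Fact state_iota_linear : linear state_iota.
Proof.
move=> c z w; have [s ->] := tensor_piK z; have [t ->] := tensor_piK w.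
rewrite [X in state_iota (X + _)]tensor_scaleE [X in state_iota X]tensor_addE.
rewrite !state_iotaE /formal_vector big_cat /= ract_algD // -!/(formal_vector _).
by rewrite formal_vectorM -scalerAl mul1r ract_algZ.
Qed.

HB.instance Definition _ := GRing.isLinear.Build R[i] (tensor state_rep) E _ state_iota
  state_iota_linear.

(** x and its projection to A_H differ by degrees outside H, where the vector state vanishes; hence
    the induced form is the inner product of E, which also gives positivity. *)
Lemma state_form s t :
  inner (state_iota (tensor_pi s)) (state_iota (tensor_pi t)) = induced_form s t.
Proof.
have proj x : inner (ract pi x e0) e0 = vector_state (gproj gr H x).
  have /e0_orth := (@gprojP R A gr H x _).2 erefl.
  rewrite -scaleN1r ract_algD // ract_algZ // scaleN1r innerBl => /eqP.
  by rewrite subr_eq0 => /eqP.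
rewrite !state_iotaE /induced_form /formal_vector !ract_alg_sum // inner_suml.
apply: eq_bigr => p _; rewrite inner_sumr; apply: eq_bigr => r _.
rewrite !ract_algZ // innerZl innerZr ract_star_r; try exact: ract_dom; last by [].
rewrite -ract_algM // proj /inner /= /Cline_inner /state_act.
by rewrite mulrA mulrC mulrA.
Qed.

Lemma state_rep_inducible : inducible state_rep.
Proof. by move=> s; rewrite -state_form inner_ge0. Qed.

Let cdom : set E := [set ract pi x e0 | x in [set: A]].

Let cdomP u : cdom u -> rdom pi u.
Proof. by move=> [x _ <-]; apply: ract_dom. Qed.

Let cdom0 : cdom 0.
Proof. by exists 0 => //; rewrite ract0. Qed.

Let cdom_linear (c : R[i]) u v : cdom u -> cdom v -> cdom (c *: u + v).
Proof.
by move=> [x _ <-] [y _ <-]; exists (c *: x + y) => //; rewrite ract_algD ?ract_algZ.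
Qed.

Let cdom_cvg (w : nat -> A) u : rdom pi u ->
  (fun n => ract pi 1 (ract pi (w n) e0)) @ \oo --> ract pi 1 u ->
  (fun n => ract pi (w n) e0) @ \oo --> u.
Proof.
move=> du; have -> : (fun n => ract pi 1 (ract pi (w n) e0)) = (fun n => ract pi (w n) e0).
  by apply/funext => n; rewrite ract_alg1 //; apply: ract_dom.
by rewrite ract_alg1.
Qed.

Let cdom_dense : dense cdom.
Proof.
move=> O O0 oO; have [u [Ou du]] := @rdom_dense _ _ _ pi O O0 oO.
have [w /(_ 1)/(cdom_cvg du) wu] := e0_cyclic du.
have /filter_ex[n On] : \forall n \near \oo, O (ract pi (w n) e0).
  exact: wu _ (open_nbhs_nbhs (conj oO Ou)).
by exists (ract pi (w n) e0); split => //; exists (w n).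
Qed.

Let cdom_act x u : cdom u -> cdom (ract pi x u).
Proof. by move=> [y _ <-]; exists (x * y) => //; rewrite ract_algM. Qed.

Definition cyclic_rep : star_rep A E := @StarRep _ _ E cdom (ract pi) cdom0 cdom_linear
  cdom_dense cdom_act
  (fun x c u v du dv => ract_linear x c (cdomP du) (cdomP dv))
  (fun x y u du => ract_algD x y (cdomP du))
  (fun c x u du => ract_algZ c x (cdomP du))
  (fun x y u du => ract_algM x y (cdomP du))
  (fun u du => ract_alg1 (cdomP du))
  (fun x u v du dv => ract_star x (cdomP du) (cdomP dv)).

(** The sequences of [e0_cyclic] are Cauchy in the graph topology, which puts D(pi) into the
    completion; conversely pi is closed, and a graph limit is also the norm limit. *)
Lemma cyclic_rep_closure : is_closure cyclic_rep pi.
Proof.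
split; last first.
  move=> x u du; have [w wu] := e0_cyclic du.
  have w1 := cdom_cvg du (wu 1).
  have wx := wu x.
  pose f n : E * E := (ract pi (w n) e0, ract pi x (ract pi (w n) e0)).
  have fu : f @ \oo --> (u, ract pi x u) by exact: cvg_pair w1 wx.
  apply: (closed_cvg _ (@closed_closure _ _) _ _ fu).
  by apply: nearW => n; apply: subset_closure; split=> //; exists (w n).
apply/seteqP; split=> u.
  move=> du; have [w wu] := e0_cyclic du.
  have w1 := cdom_cvg du (wu 1).
  exists ((fun n => ract pi (w n) e0) @ \oo).
  split; [exact: fmap_proper_filter| |exact: w1].
  split=> [|x e egt0]; first by exists 0%N => // n _; exists (w n).
  have e4 : 0 < e / 4 by rewrite divr_gt0.
  exists [set v | exists2 y : A, v = ract pi y e0 &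
      `|u - v| < e / 4 /\ `|ract pi x u - ract pi x v| < e / 4].
    move/cvgrPdist_lt/(_ _ e4): w1 => w1; move/cvgrPdist_lt/(_ _ e4): (wu x) => wx.
    by apply: filterS (filterI w1 wx) => n [n1 n2]; exists (w n).
  move=> v1 v2 [y1 _ [a1 b1]] [y2 _ [a2 b2]] /cdomP d1 /cdomP d2; rewrite /= ractB //.
  have -> : e = (e / 4 + e / 4) + (e / 4 + e / 4) by field.
  by apply: ltrD; apply: le_lt_trans (ler_distD _ _ _) (ltrD _ _);
    [rewrite distrC; exact: a1|exact: a2|rewrite distrC; exact: b1|exact: b2].
move=> [F [FF [Fc FC] Fu]].
have Fpi : graph_cauchy pi F.
  split=> [|x e egt0]; first by apply: filterS Fc => v /cdomP.
  have [S FS HS] := FC x e egt0; exists (S `&` cdom); first exact: filterI.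
  by move=> v1 v2 [s1 c1] [s2 c2] _ _; apply: HS.
have [u' du' Fu'] := pi_closed FF Fpi.
suff -> : u = u' by [].
apply: (cvg_unique (@norm_hausdorff _ _) Fu); apply/cvgrPdist_lt => e egt0.
apply: filterS (Fu' 1 e egt0) => v [_]; rewrite distrC; apply: le_lt_trans.
by rewrite lerDl.
Qed.

Lemma induced_from_vector : exists (H : zmodClosed int) (K : hilbertType R)
    (rho : star_rep (subalg gr H) K),
  [/\ one_dimensional rho, inducible rho
    & exists (E' : hilbertType R) (sigma : star_rep A E'),
        is_induced rho sigma /\ unitarily_equivalent pi sigma].
Proof.
exists H, K, state_rep; split.
- exact: state_rep_one_dimensional.
- exact: state_rep_inducible.
exists E, pi; split; last first.
  by exists id; split=> //; rewrite image_id.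
exists state_iota, cyclic_rep; split.
- exact: state_form.
- apply/seteqP; split=> u; last by move=> [z _ <-]; eexists.
  move=> [x _ <-].
  have K1 : rdom state_rep (1 : R[i]) by [].
  exists (tensor_pi ([:: (x, SigSub (mem_set K1))] : formal_sum state_rep)) => //.
  by rewrite [LHS]state_iotaE /formal_vector big_seq1 /= scale1r.
- move=> x s; rewrite [RHS]state_iotaE formal_vectorM ract_algM //.
  by congr (ract pi x _); apply: state_iotaE.
- exact: cyclic_rep_closure.
Qed.

End InducedFromVector.

(** * Orthogonal series and limits in the graph topology *)

Section SequenceLemmas.
Context (R : realType) (E : hilbertType R).
Implicit Types (u v w : E).

Lemma sqn_sum_orth (g : nat -> E) m n : (forall i j, i != j -> inner (g i) (g j) = 0) ->
  sqn (\sum_(m <= j < n) g j) = \sum_(m <= j < n) sqn (g j).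
Proof.
move=> go; elim: n => [|n IH].
  by rewrite !big_geq // /sqn inner0l.
have [mn|nm] := leqP m n; last by rewrite !big_geq // /sqn inner0l.
rewrite !big_nat_recr //= sqnD IH; suff -> : inner (\sum_(m <= j < n) g j) (g n) = 0.
  by rewrite mulr0 addr0.
rewrite inner_suml big_nat big1 // => i /andP[_ iltn].
by apply: go; rewrite neq_ltn iltn.
Qed.

(** The second hypothesis says that [g j] is the component of u along itself; this form admits
    vanishing terms. The partial sums are then bounded by u, which is Bessel's inequality. *)
Lemma bessel_cvg (g : nat -> E) u : (forall i j, i != j -> inner (g i) (g j) = 0) ->
  (forall j, inner u (g j) = inner (g j) (g j)) -> cvg ((fun n => \sum_(0 <= j < n) g j) @ \oo).
Proof.
move=> go gu; apply: (@monotone_sqn_cvg _ _ _ (fun n => \sum_(0 <= j < n) sqn (g j)) (sqn u)).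
  move=> m n mn; rewrite (big_cat_nat (n := m)) //= [X in sqn (X - _)]addrC addrK.
  rewrite (@big_cat_nat _ _ _ m 0 n) //= [leRHS]addrAC subrr add0r.
  by rewrite sqn_sum_orth.
move=> n; rewrite -sqn_sum_orth //; set Q := \sum_(0 <= j < n) g j.
have uQ : inner u Q = inner Q Q.
  rewrite inner_sumr inner_suml; apply: eq_big_nat => j /andP[_ jn].
  rewrite gu inner_sumr (bigD1_seq j) ?mem_index_iota ?iota_uniq //= big1 ?addr0 //.
  by move=> i ij; apply: go; rewrite eq_sym.
have := sqn_ge0 (u - Q); rewrite sqnD sqnN innerNr uQ raddfN /=.
by rewrite -[complex.Re (inner Q Q)]/(sqn Q); lra.
Qed.

Lemma cvg_sqn_cauchy (w : nat -> E) : cvg (w @ \oo) -> forall e : R, 0 < e ->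
  exists N, forall m n, (N <= m)%N -> (N <= n)%N -> `|w n - w m| < e%:C%C.
Proof.
move=> /cvg_ex[l wl] e e0; have e2 : 0 < (e / 2)%:C%C :> R[i] by rewrite ltcR divr_gt0.
move/cvgrPdist_lt/(_ _ e2): wl => -[N _ HN]; exists N => m n Nm Nn.
have -> : e%:C%C = (e / 2)%:C%C + (e / 2)%:C%C :> R[i] by rewrite -rmorphD /= -splitr.
apply: le_lt_trans (ler_distD l _ _) _; apply: ltrD; last exact: HN.
by rewrite distrC; apply: HN.
Qed.

(** Made for the estimate |pi(y) z|^2 = <pi(y^* y) z, z> <= |pi(y^* y) z| |z|, where both factors
    are controlled. *)
Lemma cvg_of_sqn_le_mul (w w' z : nat -> E) : cvg (w @ \oo) -> cvg (w' @ \oo) ->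
  (forall m n, `|z n - z m| ^+ 2 <= `|w n - w m| * `|w' n - w' m|) -> cvg (z @ \oo).
Proof.
move=> /cvg_sqn_cauchy cw /cvg_sqn_cauchy cw' zw; apply: cauchy_sqn_cvg => e e0.
have [N HN] := cw 1 ltr01; have [N' HN'] := cw' e e0.
exists (maxn N N') => m n; rewrite geq_max => /andP[Nm Nm'] mn.
rewrite -lecR sqnE; apply: le_trans (zw m n) _; rewrite -[leRHS]mul1r.
apply: ler_pM => //; apply: ltW; first exact: (HN m n Nm (leq_trans Nm mn)).
exact: (HN' m n Nm' (leq_trans Nm' mn)).
Qed.

End SequenceLemmas.

Section GraphLimits.
Context (R : realType) (A : starAlgType R) (E : hilbertType R) (pi : star_rep A E).

(** If every pi(x) w_n converges, the case x = 1 included, then w is Cauchy for each graph norm. *)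
Lemma closed_rep_seq (w : nat -> E) : closed_rep pi -> (forall n, rdom pi (w n)) ->
  (forall x, cvg ((fun n => ract pi x (w n)) @ \oo)) ->
  exists2 u, rdom pi u & forall x, (fun n => ract pi x (w n)) @ \oo --> ract pi x u.
Proof.
move=> pic dw cw.
have [|u du wu] := pic (w @ \oo) (fmap_proper_filter _ _).
  split=> [|x _ /posC[e e0 ->]]; first by exists 0%N => // n _; apply: dw.
  have e2 : 0 < e / 2 by rewrite divr_gt0.
  have [N HN] := cvg_sqn_cauchy (cw 1) e2; have [M HM] := cvg_sqn_cauchy (cw x) e2.
  exists [set w n | n in [set n | (maxn N M <= n)%N]].
    by exists (maxn N M) => // n /= hn; exists n.
  move=> _ _ [m /= mN <-] [n /= nN <-] _ _; move: mN nN.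
  rewrite !geq_max => /andP[Nm Mm] /andP[Nn Mn].
  rewrite ractB // (splitr e) rmorphD; apply: ltrD; last exact: HM Mn Mm.
  by have := HN _ _ Nn Nm; rewrite !ract_alg1.
exists u => // x; apply/cvgrPdist_lt => e e0; have [N _ HN] := wu x e e0.
exists N => // n /= Nn; have [_] := HN n Nn; apply: le_lt_trans.
by rewrite ractB // distrC lerDr.
Qed.

(* [perp] and its orthogonal complement inside the domain decompose [pi]. *)
Lemma irreducible_perp0 e0 : irreducible_rep pi -> rdom pi e0 -> e0 != 0 ->
  let perp := [set v | rdom pi v /\ forall x, inner v (ract pi x e0) = 0] in
  (forall u, rdom pi u -> exists u', [/\ rdom pi u',
     forall v, perp v -> inner u' v = 0 & perp (u - u')]) ->
  forall v, perp v -> v = 0.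
Proof.
move=> [_ irr] de0 e00 perp split_dom.
pose D1 := [set u | rdom pi u /\ forall v, perp v -> inner u v = 0].
have perp_act x v : perp v -> perp (ract pi x v).
  move=> [dv hv]; split=> [|y]; first exact: ract_dom.
  by rewrite ract_star; [rewrite -ract_algM // hv|by []|exact: ract_dom].
have [|D10|D20] := irr D1 perp.
- split.
  + split.
    * by split=> [|v _]; [exact: rdom0|rewrite inner0l].
    * move=> c u v [du hu] [dv hv]; split=> [|w hw]; first exact: rdom_linear.
      by rewrite inner_linearl hu // hv // mulr0 addr0.
    * move=> x u [du hu]; split=> [|v hv]; first exact: ract_dom.
      by rewrite ract_star //; [exact/hu/perp_act|case: hv].
  + split.
    * by split=> [|v]; [exact: rdom0|rewrite inner0l].
    * move=> c u v [du hu] [dv hv]; split=> [|w]; first exact: rdom_linear.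
      by rewrite inner_linearl hu // hv // mulr0 addr0.
    * exact: perp_act.
  + by move=> u v [_ hu] /hu.
  + apply/seteqP; split=> u.
      move=> du; have [u' [du' hu' pu']] := split_dom u du.
      by exists u' => //; exists (u - u') => //; rewrite addrC subrK.
    by move=> [v [dv _] [w [dw _] <-]]; apply: rdomD.
- suff: D1 e0 by rewrite D10 => /eqP; rewrite (negbTE e00).
  by split=> // v [dv hv]; rewrite innerC -[e0](ract_alg1 de0) hv rmorph0.
- by move=> v; rewrite -[perp v]/(perp v) D20.
Qed.

End GraphLimits.

(** * Free orbits *)

Section FreeOrbit.
Context (R : realType) (q : R) (q_gt0 : 0 < q) (E : hilbertType R).
Context (pi : star_rep (oscillator q) E) (e0 : E).
Local Notation A := (oscillator q).
Local Notation qc := (q%:C%C : R[i]).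
Hypotheses (pi_closed : closed_rep pi) (pi_irr : irreducible_rep pi).
Hypotheses (e0_dom : rdom pi e0) (e0_unit : inner e0 e0 = 1).
Hypothesis e0_eigen : forall b : A, osc_comp 0 b -> exists mu, ract pi b e0 = mu *: e0.
(** The point t of e_0 is not fixed by t |-> q t + 1: there is no fixed point for q = 1, and
    otherwise W multiplies e_0 by (1 - q) t - 1. *)
Hypothesis e0_not_fixed : q = 1 \/ q <> 1 /\ ract pi (osc_W q) e0 <> 0.

Let e0_neq0 : e0 != 0.
Proof. by apply: contra_eq_neq e0_unit => ->; rewrite inner0l eq_sym oner_eq0. Qed.

Let e0_eigenE (b : A) : osc_comp 0 b -> ract pi b e0 = inner (ract pi b e0) e0 *: e0.
Proof. by move=> /e0_eigen[mu ->]; rewrite innerZl e0_unit mulr1. Qed.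

Let star0_comp (b : A) : osc_comp 0 b -> osc_comp 0 (star b).
Proof. by move=> b0; rewrite -oppr0; apply: osc_comp_star. Qed.

(* z is moved past N (q = 1) or W (q <> 1), which changes their eigenvalue at [e0]. *)
Lemma vector_state_homog n (z : A) : n != 0 -> osc_comp n z -> inner (ract pi z e0) e0 = 0.
Proof.
move=> n0 zn.
have comm (b : A) : osc_comp 0 b ->
    inner (ract pi (b * z) e0) e0 = inner (ract pi b e0) e0 * inner (ract pi z e0) e0.
  move=> b0; rewrite ract_algM // ract_star //; last exact: ract_dom.
  rewrite (e0_eigenE (star0_comp b0)) innerZr -innerC; congr (_ * _).
  by rewrite ract_star_r // starK.
have comm' (b : A) : osc_comp 0 b ->
    inner (ract pi (z * b) e0) e0 = inner (ract pi b e0) e0 * inner (ract pi z e0) e0.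
  by move=> b0; rewrite ract_algM // (e0_eigenE b0) ractZ // !innerZl e0_unit mulr1.
case: e0_not_fixed => [q1|[q1 W0]].
  have := comm _ (osc_N_comp q); rewrite (osc_N_shift q_gt0 q1 zn) -scaleNr.
  rewrite ract_algD // ract_algZ // innerDl innerZl comm'; last exact: osc_N_comp.
  move=> /eqP; rewrite -subr_eq0 addrAC subrr add0r mulf_eq0 oppr_eq0 intr_eq0 (negbTE n0).
  by move=> /eqP.
have Wc : osc_comp 0 (osc_W q) by exact: osc_poly_comp.
have := comm _ Wc; rewrite (osc_W_shift q_gt0 zn) ract_algZ // innerZl comm' //.
set om := inner (ract pi (osc_W q) e0) e0; set x := inner (ract pi z e0) e0.
have om0 : om != 0 by apply: contra_not_neq W0 => om0; rewrite e0_eigenE // -/om om0 scale0r.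
move=> /eqP; rewrite -subr_eq0 -[X in _ - X]mul1r -mulrBl !mulf_eq0 (negbTE om0) /=.
rewrite subr_eq0 => /orP[|/eqP //].
have -> : qc ^ (- n) = (q ^ (- n))%:C%C by rewrite -fmorphXz.
rewrite -[1]/((1 : R)%:C%C) (inj_eq (@complexI _)) -(expr0z q) (inj_eq (ieexprIz _ _)) //.
  by rewrite oppr_eq0 (negbTE n0).
exact/eqP.
Qed.

Let e k : E := ract pi (osc_mono q k) e0.

Let e_dom k : rdom pi (e k).
Proof. exact: ract_dom. Qed.

Let e_orth k l : k != l -> inner (e k) (e l) = 0.
Proof.
move=> kl; rewrite ract_star_r // -ract_algM //.
apply: (@vector_state_homog (- l + k)); first by rewrite addrC subr_eq0.
by apply: osc_comp_mul (osc_mono_comp q k); apply/osc_comp_star/osc_mono_comp.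
Qed.

Let e_eigen k (b : A) : osc_comp 0 b -> exists mu, ract pi b (e k) = mu *: e k.
Proof.
move=> /(osc_comp0_mono q_gt0 k)[b' /e0_eigen[mu b'e] bb'].
by exists mu; rewrite -ract_algM // bb' ract_algM // b'e ractZ.
Qed.

Let homog_e k (x : A) : osc_comp k x -> exists c, ract pi x e0 = c *: e k.
Proof.
move=> /(osc_comp_homog q_gt0)[p ->]; have [mu pe] := e0_eigen (osc_poly_comp q p).
by exists mu; rewrite ract_algM // pe ractZ.
Qed.

(** [e k] may vanish, when the orbit ends at 0; division by 0 then makes the coefficient 0. *)
Let coef k u : R[i] := inner u (e k) / inner (e k) (e k).
Let proj k u : E := coef k u *: e k.

Let inner_proj k u : inner (proj k u) (e k) = inner u (e k).
Proof.
rewrite /proj innerZl /coef; have [ek0|ek0] := eqVneq (inner (e k) (e k)) 0.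
  by rewrite (inner_eq0 ek0) !inner0r mulr0.
by rewrite divfK.
Qed.

Let proj_act k u (b : A) : osc_comp 0 b -> rdom pi u -> ract pi b (proj k u) = proj k (ract pi b u).
Proof.
move=> b0 du; rewrite /proj ractZ // /coef.
have [ek0|ek0] := eqVneq (inner (e k) (e k)) 0.
  by rewrite (inner_eq0 ek0) ract_vec0 !scaler0.
have [mu bmu] := e_eigen k b0; have [nu bnu] := e_eigen k (star0_comp b0).
rewrite ract_star // bnu bmu innerZr scalerA; congr (_ *: _).
suff -> : mu = nu^* by rewrite mulrC mulrA.
by apply: (mulIf ek0); rewrite -innerZr -innerZl -bnu -bmu ract_star.
Qed.

(** Pairing the degrees j and - (j + 1) turns a sum over Z into a series over nat. *)
Let g u j : E := proj (Posz j) u + proj (Negz j) u.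

Let g_orth u i j : i != j -> inner (g u i) (g u j) = 0.
Proof.
move=> ij; have pp : Posz i != Posz j by apply: contra ij => /eqP[->].
have nn : Negz i != Negz j by apply: contra ij => /eqP[->].
by rewrite /g /proj !innerDl !innerDr !innerZl !innerZr !e_orth // !mulr0 !addr0.
Qed.

Let inner_g u j : inner u (g u j) = inner (g u j) (g u j).
Proof.
have pg k (z : E) : inner z (e k) = inner u (e k) -> inner z (proj k u) = inner u (proj k u).
  by move=> zu; rewrite /proj !innerZr zu.
rewrite /g [LHS]innerDr [RHS]innerDr; congr (_ + _); apply/esym/pg.
  by rewrite innerDl inner_proj /proj innerZl e_orth // mulr0 addr0.
by rewrite innerDl inner_proj /proj innerZl e_orth // mulr0 add0r.
Qed.

Let Q u n : E := \sum_(0 <= j < n) g u j.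

Let Q_cvg u : cvg (Q u @ \oo).
Proof. by apply: (bessel_cvg (u := u)); [exact: g_orth|exact: inner_g]. Qed.

Let Q_vec u n : exists w : A, Q u n = ract pi w e0.
Proof.
exists (\sum_(0 <= j < n) (coef (Posz j) u *: osc_mono q (Posz j) + coef (Negz j) u *: osc_mono q (Negz j))).
rewrite ract_alg_sum //; apply: eq_bigr => j _.
by rewrite ract_algD // !ract_algZ.
Qed.

Let Q_dom u n : rdom pi (Q u n).
Proof. by have [w ->] := Q_vec u n; apply: ract_dom. Qed.

Let Q_act u n (b : A) : osc_comp 0 b -> rdom pi u -> ract pi b (Q u n) = Q (ract pi b u) n.
Proof.
move=> b0 du; rewrite /Q ract_sum; last by move=> i; apply: rdomD; apply: rdomZ.
by apply: eq_bigr => j _; rewrite /g ractD ?proj_act //; apply: rdomZ.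
Qed.

(* For homogeneous y, |pi(y) w|^2 = <pi(y^* y) w, w> and y^* y has degree 0, so [Q_act]
   and Cauchy-Schwarz give convergence in the graph topology. *)
Let Q_graph_cvg u x : rdom pi u -> cvg ((fun n => ract pi x (Q u n)) @ \oo).
Proof.
move=> du; have [s [hs ->]] := comp_span (osc_grading q) x.
have -> : (fun n => ract pi (\sum_(y <- s) y) (Q u n)) =
    (fun n => \sum_(y <- s) ract pi y (Q u n)).
  by apply/funext => n; rewrite ract_alg_sum.
elim: s hs => [|y s IH] hs.
  by under eq_fun do rewrite big_nil; apply: is_cvg_cst.
under eq_fun do rewrite big_cons.
apply: is_cvgD; last by apply: IH => z zs; apply: hs; rewrite inE zs orbT.
have [k yk] : exists k, osc_comp k y by apply: hs; rewrite inE eqxx.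
have b0 : osc_comp 0 (star y * y).
  by rewrite -(addNr k); apply: osc_comp_mul (osc_comp_star yk) yk.
apply: (cvg_of_sqn_le_mul (@Q_cvg (ract pi (star y * y) u)) (@Q_cvg u)) => m n.
have dw : rdom pi (Q u n - Q u m) by apply: rdomB.
rewrite -!Q_act // -!ractB // -(ger0_norm (exprn_ge0 2 (normr_ge0 _))) -inner_norm.
by rewrite ract_star_r ?ract_algM //; [exact: cauchy_schwarz|exact: ract_dom].
Qed.

Let Q_inner u n k : (match k with Posz j | Negz j => j < n end)%N -> inner (u - Q u n) (e k) = 0.
Proof.
move=> kn; rewrite innerBl /Q inner_suml.
pose j := match k with Posz j | Negz j => j end.
rewrite (bigD1_seq j) ?mem_index_iota ?iota_uniq //=; last by case: k kn @j.
rewrite big1 => [|i ij].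
  rewrite addr0 /g innerDl; case: k kn @j => i _ /=.
    by rewrite inner_proj /proj innerZl e_orth // mulr0 addr0 subrr.
  by rewrite inner_proj /proj innerZl e_orth // mulr0 add0r subrr.
rewrite /g /proj innerDl !innerZl !e_orth ?mulr0 ?addr0 //.
  by apply: contra ij; rewrite /j => /eqP <-.
by apply: contra ij; rewrite /j => /eqP <-.
Qed.

Theorem free_orbit_induced : exists (H : zmodClosed int) (K : hilbertType R)
    (rho : star_rep (subalg (osc_grading q) H) K),
  [/\ one_dimensional rho, inducible rho
    & exists (E' : hilbertType R) (sigma : star_rep A E'),
        is_induced rho sigma /\ unitarily_equivalent pi sigma].
Proof.
pose perp := [set v | rdom pi v /\ forall x, inner v (ract pi x e0) = 0].
(* u' is the component of u in the closed span of the [e k]; convergence in the graph topology keeps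
   it in D(pi). *)
have lim u : rdom pi u -> exists u', [/\ rdom pi u', perp (u - u'), Q u @ \oo --> u'
    & forall x, (fun n => ract pi x (Q u n)) @ \oo --> ract pi x u'].
  move=> du; have [|u' du' uu'] := @closed_rep_seq _ _ _ pi (Q u) pi_closed (Q_dom u).
    by move=> x; apply: Q_graph_cvg.
  have Qu : Q u @ \oo --> u'.
    have := uu' 1; have -> : (fun n => ract pi 1 (Q u n)) = Q u.
      by apply/funext => n; rewrite ract_alg1.
    by rewrite ract_alg1.
  exists u'; split=> //; split=> [|x]; first exact: rdomB.
  have [s [hs ->]] := comp_span (osc_grading q) x.
  rewrite ract_alg_sum // inner_sumr big_seq big1 // => y /hs[k /homog_e[c ->]].
  rewrite innerZr; suff -> : inner (u - u') (e k) = 0 by rewrite mulr0.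
  apply: (@cvg_orth _ _ (fun n => u - Q u n)); first by apply: cvgB => //; apply: cvg_cst.
  by case: k => j; exists j.+1 => // n /= jn; apply: Q_inner.
have perp0 v : perp v -> v = 0.
  apply: irreducible_perp0 => // u du; have [u' [du' pu' Qu _]] := lim u du; exists u'.
  split=> // w [dw hw]; apply: cvg_orth Qu _; apply: nearW => n.
  by have [x ->] := Q_vec u n; rewrite innerC hw rmorph0.
have int0E n : n \in int0 -> n = 0 by move=> /eqP.
apply: (@induced_from_vector _ _ (osc_grading q) int0 _ _ e0) => //.
- move=> x; elim=> [|n y z /int0E -> yn _ IH]; first by rewrite ract0 // inner0l scale0r.
  by rewrite ract_algD // innerDl scalerDl -IH -e0_eigenE.
- move=> x; elim=> [|n y z n0 yn _ IH]; first by rewrite ract0 // inner0l.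
  by rewrite ract_algD // innerDl IH addr0; apply: vector_state_homog yn.
- move=> u du; have [u' [du' /perp0/eqP + _ uu']] := lim u du.
  rewrite subr_eq0 => /eqP {1}->.
  have [w Hw] := choice (Q_vec u); exists w => x.
  have -> : (fun n => ract pi x (ract pi (w n) e0)) = (fun n => ract pi x (Q u n)).
    by apply/funext => n; rewrite -Hw.
  exact: uu'.
Qed.

End FreeOrbit.

(** * The fixed point *)

Section AbsoluteValue.
Context (R : realType) (E : hilbertType R) (S : E -> E).
Implicit Types (u v : E) (c : R[i]) (T : E -> E).
Hypothesis S_lin : forall c u v, S (c *: u + v) = c *: S u + S v.
Hypothesis S_self : forall u v, inner (S u) v = inner u (S v).
Hypothesis S_contr : forall u, `|S u| <= `|u|.

Let X u : E := u - S (S u).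

(* For a self-adjoint contraction S, the iterates increase to Y = 1 - |S|, the solution
   of 2 Y = X + Y^2 with X = 1 - S^2; the scalar iteration [abs_bound] dominates them. *)
Fixpoint abs_iter (n : nat) (u : E) : E :=
  if n is m.+1 then 2^-1 *: (X u + abs_iter m (abs_iter m u)) else 0.
Local Notation y := abs_iter.

Fixpoint abs_bound (n : nat) : R :=
  if n is m.+1 then 2^-1 * (1 + abs_bound m ^+ 2) else 0.
Local Notation r := abs_bound.

Let rE n : r n.+1 = 2^-1 * (1 + r n ^+ 2). Proof. by []. Qed.
Let yE n u : y n.+1 u = 2^-1 *: (X u + y n (y n u)). Proof. by []. Qed.
Local Arguments abs_iter : simpl never.
Local Arguments abs_bound : simpl never.

Let r_ge0 n : 0 <= r n.
Proof. by case: n => [|n] //; rewrite rE mulr_ge0 // addr_ge0 // sqr_ge0. Qed.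

Let r_le1 n : r n <= 1.
Proof. by elim: n => [|n IH]; [exact: ler01|rewrite rE; have := r_ge0 n; nra]. Qed.

Let r_incr n : r n <= r n.+1.
Proof. by rewrite rE; have := r_ge0 n; have := r_le1 n; nra. Qed.

Let r_mono m n : (m <= n)%N -> r m <= r n.
Proof. by move=> /subnK <-; elim: (n - m)%N => //= k /le_trans; apply; exact: r_incr. Qed.

Let X_contr u : `|X u| <= `|u|.
Proof.
rewrite -(@ler_pXn2r _ 2) ?nnegrE // -!sqnE lecR /X sqnD sqnN innerNr.
rewrite -S_self.
have -> : complex.Re (- inner (S u) (S u)) = - sqn (S u) by rewrite raddfN.
have le2 v : sqn (S v) <= sqn v by rewrite -lecR !sqnE ler_pXn2r ?nnegrE.
by have := le2 (S u); have := sqn_ge0 (S u); lra.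
Qed.

Let y_lin n c u v : y n (c *: u + v) = c *: y n u + y n v.
Proof.
elim: n c u v => [|n IH] c u v; first by rewrite /abs_iter scaler0 addr0.
rewrite !yE !IH /X !S_lin scalerA [c * _]mulrC -scalerA -scalerDr; congr (_ *: _).
by rewrite !scalerDr scalerN opprD (addrACA (c *: u) v) (addrACA (c *: u - _)).
Qed.

Let y_bound n u : `|y n u| <= (r n)%:C%C * `|u|.
Proof.
elim: n u => [|n IH] u; first by rewrite normr0 mul0r.
rewrite yE rE normrZ rmorphM rmorphD rmorphXn /= rmorph1 -mulrA.
have -> : `|2^-1| = (2^-1)%:C%C :> R[i] by rewrite normfV normr_nat fmorphV rmorph_nat.
rewrite ler_pM2l ?ltcR ?invr_gt0 //; apply: le_trans (ler_normD _ _) _.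
rewrite mulrDl mul1r lerD // expr2 -mulrA; apply: le_trans (IH _) _.
by rewrite ler_wpM2l // lecR.
Qed.

Let y_step n u : `|y n.+1 u - y n u| <= (r n.+1 - r n)%:C%C * `|u|.
Proof.
elim: n u => [|n IH] u.
  rewrite subr0; have := y_bound 1 u; by rewrite [r 0]/0 subr0.
(* The difference of two squares is split without exchanging factors; the scalar recursion is split
   in the same way, and the terms are compared one by one. *)
have -> : y n.+2 u - y n.+1 u = 2^-1 *: (y n.+1 (y n.+1 u - y n u) + (y n.+1 (y n u) - y n (y n u))).
  rewrite [y n.+2 u]yE [X in _ - X = _]yE -scalerBr opprD addrACA subrr add0r; congr (_ *: _).
  by rewrite (linear_opB _ _ (y_lin n.+1)) addrA subrK.
have -> : r n.+2 - r n.+1 = 2^-1 * (r n.+1 * (r n.+1 - r n) + (r n.+1 - r n) * r n).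
  by rewrite rE [X in _ - X = _]rE; ring.
rewrite normrZ rmorphM /= -mulrA.
have -> : `|2^-1| = (2^-1)%:C%C :> R[i] by rewrite normfV normr_nat fmorphV rmorph_nat.
rewrite ler_pM2l ?ltcR ?invr_gt0 //; apply: le_trans (ler_normD _ _) _.
have rw (a b c : R) (z : R[i]) :
    (a * b + b * c)%:C%C * z = a%:C%C * (b%:C%C * z) + b%:C%C * (c%:C%C * z).
  by rewrite rmorphD !rmorphM /= mulrDl !mulrA.
rewrite rw; apply: lerD.
  by apply: le_trans (y_bound _ _) _; rewrite ler_wpM2l // lecR.
apply: le_trans (IH _) _; rewrite ler_wpM2l //; first by rewrite lecR subr_ge0.
Qed.

Let y_diff m n u : (m <= n)%N -> `|y n u - y m u| <= (r n - r m)%:C%C * `|u|.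
Proof.
move=> /subnK <-; elim: (n - m)%N => [|k IH]; first by rewrite add0n !subrr normr0 mul0r.
rewrite addSn -(subrKA (y (k + m) u)) -(subrKA (r (k + m))) rmorphD mulrDl.
by apply: le_trans (ler_normD _ _) (lerD (y_step _ _) IH).
Qed.

Let y_cvg u : cvg ((fun n => y n u) @ \oo).
Proof.
apply: (@monotone_sqn_cvg _ _ _ (fun n => r n * sqn u) (sqn u)) => [m n mn|n]; last first.
  by rewrite -[leRHS]mul1r ler_wpM2r // sqn_ge0.
(* An increment of r lies in [0, 1], so its square is at most the increment, as [monotone_sqn_cvg]
   requires. *)
apply: (@le_trans _ _ ((r n - r m) ^+ 2 * sqn u)).
  rewrite -lecR rmorphM rmorphXn /= !sqnE -exprMn ler_pXn2r ?nnegrE ?y_diff //.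
  by rewrite mulr_ge0 // lecR subr_ge0 r_mono.
rewrite -mulrBl ler_wpM2r ?sqn_ge0 //.
by have := r_mono mn; have := r_le1 n; have := r_ge0 m; nra.
Qed.

Let Y u : E := lim ((fun n => y n u) @ \oo).

Let YP u : (fun n => y n u) @ \oo --> Y u.
Proof. exact: y_cvg. Qed.

Let Y_uniq (w : nat -> E) u v : (forall n, w n = y n u) -> w @ \oo --> v -> v = Y u.
Proof.
move=> wy wv; apply: (cvg_unique (@norm_hausdorff _ _) wv).
have -> : w = (fun n => y n u) by apply/funext.
exact: YP.
Qed.

Let Y_lin c u v : Y (c *: u + v) = c *: Y u + Y v.
Proof.
apply/esym; apply: (@Y_uniq (fun n => c *: y n u + y n v)) => [n|]; first by rewrite y_lin.
by apply: cvgD (@YP v); apply: cvgZr (@YP u).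
Qed.

Let Y_contr u : `|Y u| <= `|u|.
Proof.
rewrite -(@ler_pXn2r _ 2) ?nnegrE // -!sqnE lecR.
apply: sqn_cvg_le (@YP u) _ => e e0; apply: nearW => n.
apply: (@le_trans _ _ (sqn u)); last by rewrite lerDl ltW.
rewrite -lecR !sqnE ler_pXn2r ?nnegrE //; apply: le_trans (y_bound _ _) _.
by rewrite -[leRHS]mul1r ler_wpM2r // lecR.
Qed.

Lemma lipschitz_cvg T (M : R) (w : nat -> E) u : 0 <= M ->
  (forall v, `|T v - T u| <= M%:C%C * `|v - u|) -> w @ \oo --> u -> (T \o w) @ \oo --> T u.
Proof.
move=> M0 TM /cvgrPdist_lt wu; apply/cvgrPdist_lt => _ /posC[e e0 ->].
have M1 : 0 < M + 1 by lra.
have e1 : 0 < (e / (M + 1))%:C%C :> R[i] by rewrite ltcR divr_gt0.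
apply: filterS (wu _ e1) => n /= hn; rewrite distrC; apply: le_lt_trans (TM _) _.
rewrite distrC; apply: (@le_lt_trans _ _ ((M + 1)%:C%C * `|u - w n|)).
  by rewrite ler_wpM2r // lecR lerDl.
have -> : e%:C%C = (M + 1)%:C%C * (e / (M + 1))%:C%C :> R[i].
  by rewrite -rmorphM /= mulrC divfK // gt_eqF.
by rewrite ltr_pM2l // ltcR.
Qed.

Let Y_eq u : 2 *: Y u = X u + Y (Y u).
Proof.
have YY : (fun n => y n (y n u)) @ \oo --> Y (Y u).
  (* All [y n] are contractions, so [y n] applied to [y n u - Y u] tends to 0. *)
  have -> : (fun n => y n (y n u)) = (fun n => y n (y n u - Y u) + y n (Y u)).
    by apply/funext => n; have := y_lin n 1 (y n u - Y u) (Y u); rewrite !scale1r subrK.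
  rewrite -[Y (Y u)]add0r; apply: cvgD (@YP (Y u)).
  apply/cvgrPdist_lt => e e0; have /cvgrPdist_lt/(_ _ e0) := @YP u.
  apply: filterS => n hn; rewrite sub0r normrN distrC in hn *.
  apply: le_lt_trans hn; apply: le_trans (y_bound _ _) _.
  by rewrite -[leRHS]mul1r distrC ler_wpM2r // lecR.
have s1 : (fun n => y n.+1 u) @ \oo --> Y u by have := @YP u; rewrite -(cvg_shiftS (fun n => y n u)).
have s2 : (fun n => y n.+1 u) @ \oo --> 2^-1 *: (X u + Y (Y u)).
  by apply: cvgZr; apply: cvgD YY; apply: cvg_cst.
rewrite [in LHS](cvg_unique (@norm_hausdorff _ _) s1 s2) scalerA mulfV ?pnatr_eq0 //.
by rewrite scale1r.
Qed.

Let y_comm n T : (forall c u v, T (c *: u + v) = c *: T u + T v) ->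
  (forall u, T (S u) = S (T u)) -> forall u, T (y n u) = y n (T u).
Proof.
move=> Tl TS.
have T0 := linear_op0 Tl.
have TZ c u : T (c *: u) = c *: T u by rewrite -[c *: u]addr0 Tl T0 addr0.
elim: n => [|n IH] u; first by [].
rewrite !yE TZ -[X u]scale1r Tl scale1r -!IH; congr (_ *: (_ + _)).
by rewrite /X (linear_opB _ _ Tl) !TS.
Qed.

(** The operator is 1 - Y: from 2 Y = X + Y^2 its square is 1 - X = S^2, and it is positive because
    Y is a contraction. The iterates are polynomials in S, so whatever commutes with S commutes with
    the limit. *)
Lemma absolute_value_exists : exists A : E -> E,
  [/\ forall c u v, A (c *: u + v) = c *: A u + A v,
      forall u, A (A u) = S (S u),
      forall u, `|A u| <= 2 * `|u|,
      forall u, 0 <= complex.Re (inner (A u) u)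
    & forall T (M : R), (forall c u v, T (c *: u + v) = c *: T u + T v) ->
        (forall u, `|T u| <= M%:C%C * `|u|) ->
        (forall u, T (S u) = S (T u)) -> forall u, T (A u) = A (T u)].
Proof.
have YB u v : Y (u - v) = Y u - Y v by exact: linear_opB Y_lin.
exists (fun u => u - Y u); split.
- by move=> c u v; rewrite Y_lin opprD addrACA -scalerBr.
- move=> u; have -> : S (S u) = u - X u by rewrite subKr.
  have -> : X u = Y u + Y u - Y (Y u) by rewrite -mulr2n -scaler_nat Y_eq addrK.
  by rewrite YB !opprB -addrA opprD; congr (_ + _); rewrite addrCA.
- move=> u; apply: le_trans (ler_normB _ _) _.
  by rewrite mulrDl !mul1r lerD2l.
- move=> u; rewrite innerBl raddfB /= subr_ge0.
  rewrite -lecR; apply: (@le_trans _ _ `|complex.Re (inner (Y u) u)|%:C%C).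
    by rewrite lecR ler_norm.
  apply: le_trans (normc_ge_Re _) _; apply: le_trans (cauchy_schwarz _ _) _.
  by rewrite -/(sqn u) sqnE expr2 ler_wpM2r.
- move=> T M Tl TM TS u.
  have TB v w : T (v - w) = T v - T w by exact: linear_opB Tl.
  rewrite TB; congr (_ - _); apply: (@Y_uniq (fun n => T (y n u))) => [n|]; first exact: y_comm.
  apply: (@lipschitz_cvg T `|M|) (@YP u) => // v; rewrite -TB; apply: le_trans (TM _) _.
  by rewrite ler_wpM2r // lecR ler_norm.
Qed.

End AbsoluteValue.

Lemma dense_seq (R : realType) (E : hilbertType R) (D : set E) (u : E) : dense D ->
  exists2 w : nat -> E, forall n, D (w n) & w @ \oo --> u.
Proof.
move=> dD; have ex n : exists v, D v /\ `|u - v| < (n.+1%:R^-1)%:C%C.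
  have n0 : 0 < (n.+1%:R^-1)%:C%C :> R[i] by rewrite ltcR invr_gt0.
  have [||v [uv Dv]] := dD (ball u (n.+1%:R^-1)%:C%C).
  - by exists u; apply: ballxx.
  - exact: ball_open.
  - by exists v; split=> //; move: uv; rewrite -ball_normE.
have [w Hw] := choice ex; exists w => [n|]; first by case: (Hw n).
apply/cvgrPdist_lt => _ /posC[e e0 ->].
exists (Num.truncn e^-1) => // n /= hn; have [_ /lt_le_trans] := Hw n; apply.
rewrite lecR -[leRHS]invrK lef_pV2 ?posrE ?ltr0n ?invr_gt0 //.
apply: ltW; apply: lt_le_trans (truncnS_gt _) _.
by rewrite ler_nat ltnS.
Qed.

(** * Bounded commutative irreducible representations act by scalars *)

Section BoundedRep.
Context (R : realType) (A : starAlgType R) (E : hilbertType R) (pi : star_rep A E).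
Hypothesis pi_closed : closed_rep pi.
Hypothesis pi_bounded : forall x, exists2 M : R, 0 <= M &
  forall u, rdom pi u -> `|ract pi x u| <= M%:C%C * `|u|.

(** When all pi(x) are bounded, norm convergence is graph convergence, so the dense domain of the
    closed pi is the whole space. *)
Lemma bounded_rep_total u : rdom pi u.
Proof.
have [w dw wu] := dense_seq u (@rdom_dense _ _ _ pi).
have [x|u' du' wu'] := closed_rep_seq pi_closed dw.
  have [M M0 HM] := pi_bounded x.
  have cw : cvg (w @ \oo) by apply/cvg_ex; exists u.
  have cMw : cvg ((fun n => M%:C%C ^+ 2 *: w n) @ \oo).
    by apply/cvg_ex; exists (M%:C%C ^+ 2 *: u); apply: cvgZr.
  apply: (cvg_of_sqn_le_mul cw cMw) => m n.
  rewrite -ractB // -scalerBr normrZ ger0_norm ?exprn_ge0 ?lecR // mulrCA -expr2 -exprMn.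
  by rewrite ler_pXn2r ?nnegrE ?mulr_ge0 ?lecR // HM //; apply: rdomB.
suff -> : u = u' by [].
apply: (cvg_unique (@norm_hausdorff _ _) wu); have := wu' 1.
rewrite ract_alg1 //; have -> // : (fun n => ract pi 1 (w n)) = w.
by apply/funext => n; rewrite ract_alg1.
Qed.

Local Notation total := bounded_rep_total.

Let act_lin x c u v : ract pi x (c *: u + v) = c *: ract pi x u + ract pi x v.
Proof. by apply: ract_linear; apply: total. Qed.

Hypothesis pi_irr : irreducible_rep pi.
Hypothesis pi_comm : forall x y u, ract pi x (ract pi y u) = ract pi y (ract pi x u).

(* (|S| - S)(|S| + S) = 0, and the kernel of |S| - S reduces the representation. *)
Lemma contraction_semidefinite h : star h = h -> (forall u, `|ract pi h u| <= `|u|) ->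
  (forall u, 0 <= complex.Re (inner (ract pi h u) u)) \/
  (forall u, complex.Re (inner (ract pi h u) u) <= 0).
Proof.
move=> hh h1; set S := ract pi h.
have S_self u v : inner (S u) v = inner u (S v).
  by rewrite /S ract_star ?hh //; apply: total.
have [A' [A_lin A2 A_bd A_ge0 A_comm]] := absolute_value_exists (act_lin h) S_self h1.
pose K := [set u | A' u = S u].
have K0 : K 0.
  by rewrite /K /= !linear_op0 //; exact: act_lin.
have K_lin c u v : K u -> K v -> K (c *: u + v).
  by rewrite /K /= A_lin /S act_lin => -> ->.
have AB u v : A' (u - v) = A' u - A' v by exact: linear_opB A_lin.
have SB u v : S (u - v) = S u - S v by exact: linear_opB (act_lin h).
have K_closed : closed K.
  rewrite closedE => u /= nKu; apply: contrapT => Ku; apply: nKu.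
  pose d := A' u - S u; have d0 : d != 0 by apply/eqP => /eqP; rewrite subr_eq0 => /eqP.
  (* A' - S is bounded by 2 + 1 = 3, so no point of K lies within |d| / 3 of u. *)
  have d3 : 0 < `|d| / 3 by rewrite divr_gt0 // normr_gt0.
  apply: filterS (nbhsx_ballx u _ d3) => v; rewrite -ball_normE /= ltr_pdivlMr // => uv Kv.
  have dE : d = A' (u - v) - S (u - v) by rewrite AB SB Kv opprB addrA subrK.
  suff /le_lt_trans/(_ uv) : `|d| <= `|u - v| * 3 by rewrite ltxx.
  rewrite dE; apply: le_trans (ler_normB _ _) _.
  have -> : `|u - v| * 3 = 2 * `|u - v| + `|u - v| by ring.
  exact: lerD (A_bd _) (h1 _).
have K_act x u : K u -> K (ract pi x u).
  move=> Ku; have [M M0 HM] := pi_bounded x.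
  rewrite /K /= -(A_comm (ract pi x) M) //.
  - by rewrite Ku /S pi_comm.
  - by move=> v; apply/HM/total.
pose K' := [set v | forall w, K w -> inner v w = 0].
have [|K_triv|K'_triv] := pi_irr.2 K K'.
- split.
  + by split.
  + split.
    * by move=> w _; rewrite inner0l.
    * by move=> c u v hu hv w Kw; rewrite inner_linearl hu // hv // mulr0 addr0.
    * by move=> x u hu w Kw; rewrite ract_star; [exact/hu/K_act|exact: total|exact: total].
  + by move=> u v Ku hv; rewrite innerC hv // rmorph0.
  + apply/seteqP; split=> u _; last exact: total.
    have [w Kw hw] := orthogonal_projection_exists u K_closed K0 K_lin.
    by exists w => //; exists (u - w) => //; rewrite addrC subrK.
(* If K = 0: A' + S maps into K, because A'^2 = S^2 and A' commutes with S. Hence S = - A' is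
   negative. *)
- right=> u; have : K (A' u + S u).
    rewrite /K /= -[A' u]scale1r A_lin /S act_lin !scale1r A2 addrC; congr (_ + _).
    by have [M M0 HM] := pi_bounded h; apply/esym/(A_comm _ M) => // v; apply/HM/total.
  rewrite K_triv => /eqP; rewrite addrC addr_eq0 => /eqP -> .
  by rewrite innerNl raddfN /= oppr_le0.
(* If the orthogonal complement of K is 0, then S = A' everywhere and S is positive. *)
- left=> u; have [w Kw hw] := orthogonal_projection_exists u K_closed K0 K_lin.
  have : K' (u - w) by [].
  rewrite K'_triv => /eqP; rewrite subr_eq0 => /eqP ->.
  by rewrite -Kw.
Qed.

(* h - s is semidefinite for every real s, so the quadratic form of h is a multiple of the norm. *)
Lemma selfadjoint_scalar h (e0 : E) : star h = h -> inner e0 e0 = 1 ->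
  exists s : R, forall u, ract pi h u = s%:C%C *: u.
Proof.
move=> hh e1; have e0d := total e0.
have [M M0 HM] := pi_bounded h.
have dich (s : R) : (forall u, s * sqn u <= complex.Re (inner (ract pi h u) u)) \/
    (forall u, complex.Re (inner (ract pi h u) u) <= s * sqn u).
  (* [k] rescales h - s to a contraction; the summand 1 keeps the denominator positive. *)
  pose k := (M + `|s| + 1)^-1.
  have k0 : 0 < k by rewrite invr_gt0; have := normr_ge0 s; lra.
  pose h' := k%:C%C *: (h + (- s%:C%C) *: 1).
  have h'E u : ract pi h' u = k%:C%C *: (ract pi h u - s%:C%C *: u).
    have du := total u; rewrite /h' ract_algZ // ract_algD // ract_algZ // ract_alg1 //.
    by rewrite scaleNr.
  have rc (r : R) : (r%:C%C)^* = r%:C%C :> R[i] by rewrite /Num.conj /= oppr0.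
  have [||H|H] := @contraction_semidefinite h'.
  - by rewrite /h' starZ starD starZ star1 hh rmorphN /= !rc.
  - move=> u; rewrite h'E normrZ norm_realc (gtr0_norm k0).
    rewrite /k fmorphV mulrC ler_pdivrMr; last by rewrite ltcR -invr_gt0.
    apply: le_trans (ler_normB _ _) _; rewrite normrZ norm_realc.
    apply: (@le_trans _ _ ((M + `|s|)%:C%C * `|u|)).
      by rewrite rmorphD mulrDl lerD2r; apply/HM/total.
    by rewrite mulrC ler_wpM2l // lecR lerDl.
  - left=> u; have := H u; rewrite h'E innerZl innerBl innerZl sqn_inner -!rmorphM.
    set x := inner _ _; have -> : complex.Re (k%:C%C * (x - (s * sqn u)%:C%C)) = k * (complex.Re x - s * sqn u).
      by case: x => x1 x2 /=; rewrite mul0r subr0.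
    by rewrite pmulr_rge0 // subr_ge0.
  - right=> u; have := H u; rewrite h'E innerZl innerBl innerZl sqn_inner -!rmorphM.
    set x := inner _ _; have -> : complex.Re (k%:C%C * (x - (s * sqn u)%:C%C)) = k * (complex.Re x - s * sqn u).
      by case: x => x1 x2 /=; rewrite mul0r subr0.
    by rewrite pmulr_rle0 // subr_le0.
have sq1 : sqn e0 = 1 by rewrite /sqn e1.
pose s := complex.Re (inner (ract pi h e0) e0); exists s => u.
have hs v : complex.Re (inner (ract pi h v) v) = s * sqn v.
  apply/eqP; rewrite eq_le; apply/andP; split.
    (* [s + t] lies strictly above the form at e_0, which excludes one alternative of [dich]; the
       denominator makes [t * sqn v] at most e. *)
    apply/ler_addgt0Pr => e egt0; pose t := e / (sqn v + 1).
    have v1 : 0 < sqn v + 1 by have := sqn_ge0 v; lra.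
    have t0 : 0 < t by rewrite divr_gt0.
    have [H|H] := dich (s + t); first by have := H e0; rewrite -/s sq1; lra.
    apply: le_trans (H v) _; rewrite mulrDl lerD2l.
    by rewrite /t mulrAC ler_pdivrMr // ler_pM2l // lerDl.
  apply/ler_addgt0Pl => e egt0; pose t := e / (sqn v + 1).
  have v1 : 0 < sqn v + 1 by have := sqn_ge0 v; lra.
  have t0 : 0 < t by rewrite divr_gt0.
  have [H|H] := dich (s - t); last by have := H e0; rewrite -/s sq1; lra.
  rewrite -lerBlDl; apply: le_trans (H v); rewrite mulrBl lerB //.
  by rewrite /t mulrAC ler_pdivrMr // ler_pM2l // lerDl.
pose B v := ract pi h v - s%:C%C *: v.
have B0 v : complex.Re (inner (B v) v) = 0.
  by rewrite /B innerBl innerZl sqn_inner -rmorphM raddfB /= hs subrr.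
have BB v w : inner (B v) w = inner v (B w).
  rewrite /B innerBl innerBr innerZl innerZr ract_star ?hh; try exact: total.
  by rewrite /Num.conj /= oppr0.
(* A symmetric B with vanishing quadratic form is 0: at u + B u the cross terms add up to twice sqn
   (B u). *)
have : sqn (B u) = 0.
  have := B0 (u + B u).
  have -> : B (u + B u) = B u + B (B u).
    by rewrite /B ractD; try exact: total; rewrite scalerDr opprD addrACA.
  rewrite innerDl (innerDr (B u) u) (innerDr (B (B u)) u) !raddfD /= !B0 (BB (B u) u) -/(sqn (B u)).
  by lra.
by move=> /sqn_eq0/eqP; rewrite /B subr_eq0 => /eqP.
Qed.

Lemma commuting_scalar x (e0 : E) : inner e0 e0 = 1 -> exists c, forall u, ract pi x u = c *: u.
Proof.
move=> e1.
have [|s Hs] := @selfadjoint_scalar (x + star x) e0 _ e1; first by rewrite starD starK addrC.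
have [|t Ht] := @selfadjoint_scalar ('i *: (x - star x)) e0 _ e1.
  by rewrite starZ starD -scaleN1r starZ starK conjCi rmorphN1 !scaleN1r scaleNr -scalerN opprD opprK addrC.
exists (2^-1 * (s%:C%C - 'i * t%:C%C)) => u.
have du := total u.
have -> : x = 2^-1 *: ((x + star x) + (- 'i) *: ('i *: (x - star x))).
  rewrite scalerA mulNr -expr2 sqrCi opprK scale1r addrACA subrr addr0.
  by rewrite -mulr2n -[x *+ 2]scaler_nat scalerA mulVf ?scale1r // pnatr_eq0.
rewrite ract_algZ // ract_algD // ract_algZ // Hs Ht -scalerA; congr (_ *: _).
by rewrite scalerA -scalerDl mulNr.
Qed.

End BoundedRep.

(** * One-dimensionality over the fixed point *)

Definition intT : {pred int} := predT.
Fact intT_closed : GRing.zmod_closed intT.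
Proof. by split. Qed.
HB.instance Definition _ := GRing.isZmodClosed.Build int intT intT_closed.

Section FixedPoint.
Context (R : realType) (q : R) (q_gt0 : 0 < q) (E : hilbertType R).
Context (pi : star_rep (oscillator q) E) (e0 : E).
Local Notation A := (oscillator q).
Local Notation a := (osc_a q).
Local Notation qc := (q%:C%C : R[i]).
Hypotheses (pi_closed : closed_rep pi) (pi_irr : irreducible_rep pi).
Hypotheses (e0_dom : rdom pi e0) (e0_unit : inner e0 e0 = 1).
Hypotheses (q_neq1 : q <> 1) (W_zero : forall u, rdom pi u -> ract pi (osc_W q) u = 0).

Let k : R := (1 - q)^-1.

Let qk : q * k + 1 = k.
Proof. by rewrite /k; field; rewrite subr_eq0; apply/eqP => /esym. Qed.

Let N_scalar u : rdom pi u -> ract pi (osc_N q) u = k%:C%C *: u.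
Proof.
move=> du; have := W_zero du.
have -> : osc_W q = (1 - qc) *: osc_N q + (-1) *: 1.
  rewrite /osc_W -mul_polyC osc_polyD osc_polyM osc_polyC osc_polyX -scalerAl mul1r.
  by rewrite -polyCN osc_polyC.
rewrite ract_algD // !ract_algZ // ract_alg1 // scaleN1r => /eqP.
rewrite subr_eq0 => /eqP {2}<-; rewrite scalerA.
have -> : k%:C%C * (1 - qc) = 1 :> R[i]; last by rewrite scale1r.
rewrite -[1 - qc]/(1%:C%C - q%:C%C) -rmorphB -rmorphM /= /k mulVf //.
by rewrite subr_eq0; apply/eqP => /esym.
Qed.

Let aas_scalar u : rdom pi u -> ract pi (a * star a) u = k%:C%C *: u.
Proof.
move=> du; rewrite osc_relE ract_algD // ract_algZ // ract_alg1 // N_scalar //.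
by rewrite scalerA -{2}[u]scale1r -scalerDl -{2}qk rmorphD rmorphM /= rmorph1.
Qed.

(** a^* a and a a^* both act as k, so both generators act as multiples of isometries; bounds pass to
    sums and products. *)
Let pi_bounded (x : A) : exists2 M : R, 0 <= M &
  forall u, rdom pi u -> `|ract pi x u| <= M%:C%C * `|u|.
Proof.
have gen (y : A) : (forall u, rdom pi u -> ract pi (star y * y) u = k%:C%C *: u) ->
    exists2 M : R, 0 <= M & forall u, rdom pi u -> `|ract pi y u| <= M%:C%C * `|u|.
  (* The estimate k <= (1 + |k|)^2 spares a square root. *)
  move=> yy; exists (1 + `|k|); first by rewrite addr_ge0.
  move=> u du; rewrite -(@ler_pXn2r _ 2) ?nnegrE ?mulr_ge0 ?lecR ?addr_ge0 //.
  rewrite -inner_norm ract_star_r //; last exact: ract_dom.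
  rewrite -ract_algM // yy // innerZl sqn_inner exprMn -sqnE -rmorphXn -!rmorphM /= lecR.
  rewrite ler_wpM2r ?sqn_ge0 //.
  by have := ler_norm k; have := normr_ge0 k; nra.
have [t ->] := osc_piK x; elim: t => [||c|y IHy z IHz|y IHy z IHz].
- exact: gen N_scalar.
- rewrite -osc_star_aE; apply: gen => u du; rewrite starK; exact: aas_scalar.
- rewrite osc_piC; exists (complex.Re `|c|).
    by rewrite -ler0c RRe_real ?normr_real.
  by move=> u du; rewrite ract_algZ // ract_alg1 // normrZ RRe_real ?normr_real.
- have [M M0 HM] := IHy; have [L L0 HL] := IHz; exists (M + L); first exact: addr_ge0.
  move=> u du; rewrite osc_piD ract_algD // rmorphD mulrDl.
  by apply: le_trans (ler_normD _ _) (lerD (HM _ du) (HL _ du)).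
- have [M M0 HM] := IHy; have [L L0 HL] := IHz; exists (M * L); first exact: mulr_ge0.
  move=> u du; rewrite osc_piM ract_algM // rmorphM -mulrA.
  apply: le_trans (HM _ (ract_dom _ du)) _.
  by rewrite ler_wpM2l ?lecR // HL.
Qed.

Let total : forall u, rdom pi u.
Proof. exact: bounded_rep_total. Qed.

(** The two generators commute, since a a^* and a^* a act by the same scalar; the commutant of an
    element is a subalgebra. *)
Let pi_comm (x y : A) u : ract pi x (ract pi y u) = ract pi y (ract pi x u).
Proof.
pose C x y := forall u, ract pi x (ract pi y u) = ract pi y (ract pi x u).
have CC x' y' : C x' y' -> C y' x' by move=> h v; rewrite h.
have Ccst x' c : C x' (c *: 1).
  by move=> v; rewrite !ract_algZ // !ract_alg1 // ractZ.
have CD x' y' z : C x' y' -> C x' z -> C x' (y' + z).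
  by move=> h1 h2 v; rewrite !ract_algD // ractD // h1 h2.
have CM x' y' z : C x' y' -> C x' z -> C x' (y' * z).
  by move=> h1 h2 v; rewrite !ract_algM // h1 h2.
have Caa : C a (star a).
  by move=> v; rewrite -!ract_algM // aas_scalar // -/(osc_N q) N_scalar.
have step x' : C x' a -> C x' (star a) -> forall y', C x' y'.
  by move=> h1 h2; apply: osc_ind => // y1 y2; [apply: CD|apply: CM].
have Cxa : C x a by apply/CC/step.
have Cxs : C x (star a) by apply/CC/step => //; apply: CC.
exact: (step x Cxa Cxs y u).
Qed.

Theorem fixed_point_induced : exists (H : zmodClosed int) (K : hilbertType R)
    (rho : star_rep (subalg (osc_grading q) H) K),
  [/\ one_dimensional rho, inducible rho
    & exists (E' : hilbertType R) (sigma : star_rep A E'),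
        is_induced rho sigma /\ unitarily_equivalent pi sigma].
Proof.
have scal x : exists c, forall u, ract pi x u = c *: u.
  exact: (commuting_scalar pi_closed pi_bounded pi_irr pi_comm x e0_unit).
have e0_neq0 : e0 != 0.
  by apply: contra_eq_neq e0_unit => ->; rewrite inner0l eq_sym oner_eq0.
(* Every operator is a scalar, so the complement of the line of e_0 is invariant and irreducibility
   removes it. *)
have perp0 v : inner v e0 = 0 -> v = 0.
  move=> ve; apply: (irreducible_perp0 pi_irr e0_dom e0_neq0) => [u _|].
    exists (inner u e0 *: e0); split=> //.
      by move=> w [_ /(_ 1)]; rewrite ract_alg1 // => we; rewrite innerZl [inner e0 w]innerC we rmorph0 mulr0.
    split=> // x; have [c ->] := scal x.
    by rewrite innerZr innerBl innerZl e0_unit mulr1 subrr mulr0.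
  by split=> // x; have [c ->] := scal x; rewrite innerZr ve mulr0.
apply: (@induced_from_vector _ _ (osc_grading q) intT _ pi e0) => //.
- by move=> x _; have [c ->] := scal x; rewrite innerZl e0_unit mulr1.
(* With H = Z no degree lies outside H. *)
- move=> x xT; have -> : x = 0; last by rewrite ract0 // inner0l.
  by elim: xT => // n y z; rewrite inE.
- move=> u _; exists (fun=> (inner u e0)%:A) => x.
  have <- : u = ract pi (inner u e0)%:A e0; last by apply: cvg_cst.
  apply/eqP; rewrite -subr_eq0; apply/eqP/perp0.
  by rewrite ract_algZ // ract_alg1 // innerBl innerZl e0_unit mulr1 subrr.
Qed.

End FixedPoint.

(** * Characters of the degree-zero part *)

Section Characters.
Context (R : realType) (q : R) (q_gt0 : 0 < q).
Local Notation A := (oscillator q).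
Local Notation gr := (osc_grading q).
Local Notation a := (osc_a q).
Local Notation N := (osc_N q).
Local Notation qc := (q%:C%C : R[i]).
Local Notation posX := (@positive_characters R A gr).
Implicit Types chi : base_fun gr.

(** Evaluates characters on A itself and spares the coercions; the value is meaningful on A_0, since
    [to_base] sends the rest to 0. *)
Definition ev chi (x : A) : R[i] := chi (to_base gr x).

Definition tau chi : R := complex.Re (ev chi N).

Lemma to_baseK x : osc_comp 0 x -> val (to_base gr x) = x.
Proof.
move=> x0; apply: insubdK; apply/asboolP.
by apply: (graded_span_comp _ (x0 : gr 0 x)); rewrite inE.
Qed.

Lemma valK_base (b : base gr) : to_base gr (val b) = b.
Proof. exact: valKd. Qed.

Lemma base_comp (b : base gr) : osc_comp 0 (val b).
Proof.
have /asboolP : val b \in graded_pred gr int0 by exact: valP.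
elim=> [|n x y /eqP -> x0 _ y0]; first exact: osc_comp_0.
by rewrite -[x]scale1r; apply: osc_comp_lin.
Qed.

Lemma ev_val chi b : ev chi (val b) = chi b.
Proof. by rewrite /ev valK_base. Qed.

Lemma osc_comp0M (x y : A) : osc_comp 0 x -> osc_comp 0 y -> osc_comp 0 (x * y).
Proof. by move=> x0 y0; rewrite -[0]addr0; apply: osc_comp_mul. Qed.

Lemma osc_comp_conj n (c b : A) : osc_comp n c -> osc_comp 0 b -> osc_comp 0 (star c * b * c).
Proof.
move=> cn b0; rewrite -(addNr n) -[- n]addr0.
exact: osc_comp_mul (osc_comp_mul (osc_comp_star cn) b0) cn.
Qed.

Lemma osc_comp_sq n (c : A) : osc_comp n c -> osc_comp 0 (star c * c).
Proof. by move=> cn; rewrite -(addNr n); apply: osc_comp_mul (osc_comp_star cn) cn. Qed.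

Section OneCharacter.
Context chi (chi_char : is_character chi).

Lemma ev_lin (c : R[i]) x y : osc_comp 0 x -> osc_comp 0 y ->
  ev chi (c *: x + y) = c * ev chi x + ev chi y.
Proof.
move=> x0 y0; have [clin _ _ _] := chi_char; rewrite /ev -clin; congr chi.
by apply: val_inj; rewrite linearP /= !to_baseK //; apply: osc_comp_lin.
Qed.

Lemma evM x y : osc_comp 0 x -> osc_comp 0 y -> ev chi (x * y) = ev chi x * ev chi y.
Proof.
move=> x0 y0; have [_ cM _ _] := chi_char; rewrite /ev -cM; congr chi.
by apply: val_inj; rewrite rmorphM /= !to_baseK //; apply: osc_comp0M.
Qed.

Lemma ev_star x : osc_comp 0 x -> ev chi (star x) = (ev chi x)^*.
Proof.
move=> x0; have [_ _ cs _] := chi_char; rewrite /ev -cs; congr chi.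
apply: val_inj; rewrite /= !to_baseK //.
by rewrite -oppr0; apply: osc_comp_star.
Qed.

Lemma ev1 : ev chi 1 = 1.
Proof.
have [_ _ _ [b b0]] := chi_char; apply: (mulfI b0).
by rewrite -ev_val -evM ?mulr1 //; [exact: base_comp|exact: osc_comp_1].
Qed.

Lemma ev0 : ev chi 0 = 0.
Proof.
have := ev_lin 1 (osc_comp_0 _ 0) (osc_comp_0 _ 0); rewrite scale1r addr0 mul1r => /eqP.
by rewrite -subr_eq0 opprD addrA subrr add0r oppr_eq0 => /eqP.
Qed.

Lemma evZ c x : osc_comp 0 x -> ev chi (c *: x) = c * ev chi x.
Proof. by move=> x0; rewrite -[c *: x]addr0 ev_lin ?ev0 ?addr0 //; apply: osc_comp_0. Qed.

Lemma ev_poly p : ev chi (osc_poly q p) = p.[ev chi N].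
Proof.
elim/poly_ind: p => [|p c IH]; first by rewrite /osc_poly raddf0 ev0 horner0.
have p0 := osc_poly_comp q p; have N0 := osc_N_comp q.
rewrite osc_polyD osc_polyM osc_polyX osc_polyC hornerMXaddC.
rewrite addrC (ev_lin c (osc_comp_1 q) (osc_comp0M p0 N0)) evM // ev1 IH mulr1.
by rewrite addrC.
Qed.

(* c d^* has degree 0, hence commutes with b. *)
Lemma ev_swap n (b c d : A) : osc_comp 0 b -> osc_comp n c -> osc_comp n d ->
  ev chi (star c * b * c) * ev chi (star d * d) = ev chi (star c * c) * ev chi (star d * b * d).
Proof.
move=> b0 cn dn; have sd := osc_comp_sq dn; have sc := osc_comp_sq cn.
have bc := osc_comp_conj cn b0; have bd := osc_comp_conj dn b0.
rewrite -!evM //; congr (ev chi).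
have cd : osc_comp 0 (c * star d) by rewrite -(subrr n); apply: osc_comp_mul cn (osc_comp_star dn).
rewrite !mulrA -[star c * b * c * star d]mulrA -[star c * b * _]mulrA.
by rewrite (osc_comp0_comm q_gt0 b0 cd) !mulrA.
Qed.

Definition alpha (c : A) : base_fun gr :=
  fun b => ev chi (star c * val b * c) / ev chi (star c * c).

Lemma ev_alpha c x : osc_comp 0 x ->
  ev (alpha c) x = ev chi (star c * x * c) / ev chi (star c * c).
Proof. by move=> x0; rewrite {1}/ev /alpha to_baseK. Qed.

Lemma alpha_character n c : osc_comp n c -> ev chi (star c * c) != 0 -> is_character (alpha c).
Proof.
move=> cn c0; have bc (b : base gr) := osc_comp_conj cn (base_comp b).
have sc := osc_comp_sq cn; split.
- move=> k x y; rewrite /alpha mulrA -mulrDl -ev_lin //; congr (ev chi _ / _).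
  by rewrite linearP /= mulrDr mulrDl -scalerAr -scalerAl.
- move=> x y.
  have cc : osc_comp 0 (c * star c) by rewrite -(subrr n); apply: osc_comp_mul cn (osc_comp_star cn).
  (* c c^* has degree 0, so it commutes with y in c^* x (c c^* y) c. *)
  have key : ev chi (star c * val x * c) * ev chi (star c * val y * c) =
    ev chi (star c * val (x * y) * c) * ev chi (star c * c).
    rewrite -!evM //; congr (ev chi); rewrite rmorphM /= !mulrA.
    rewrite -[star c * val x * c * star c]mulrA -[star c * val x * _ * val y]mulrA.
    by rewrite (osc_comp0_comm q_gt0 cc (base_comp y)) !mulrA.
  by rewrite /alpha mulrACA key mulrA mulfK.
- move=> x; rewrite /alpha rmorphM fmorphV /= -(ev_star (bc x)) -(ev_star sc).
  by rewrite !starM !starK mulrA.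
- exists 1; rewrite /alpha rmorph1 mulr1 mulfV // oner_neq0.
Qed.

End OneCharacter.

Lemma pos_char chi : posX chi -> is_character chi.
Proof. by case. Qed.

Lemma alpha_pos chi n c : posX chi -> osc_comp n c -> ev chi (star c * c) != 0 ->
  posX (alpha chi c).
Proof.
move=> [cc cpos] cn c0; split; first exact: alpha_character cc _ _ cn c0.
move=> m d dm; rewrite -/(ev _ _) ev_alpha; last exact: osc_comp_sq dm.
apply: divr_ge0; last exact: (cpos n).
have -> : star c * (star d * d) * c = star (d * c) * (d * c) by rewrite starM !mulrA.
by apply: (cpos (m + n)); apply: osc_comp_mul.
Qed.

Lemma tauE chi : posX chi -> ev chi N = (tau chi)%:C%C.
Proof.
move=> [_ cpos]; rewrite /tau RRe_real //; apply: ger0_real.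
by apply: (cpos 1); apply: osc_comp_a.
Qed.

Lemma tau_ge0 chi : posX chi -> 0 <= tau chi.
Proof. by move=> X; rewrite -lecR -tauE //; case: X => _ /(_ 1 a); apply; apply: osc_comp_a. Qed.

(** Every element of A_0 is a polynomial in N. *)
Lemma tau_inj chi chi' : posX chi -> posX chi' -> tau chi = tau chi' -> chi = chi'.
Proof.
move=> X X' tt; apply/funext => b; rewrite -!ev_val.
have [p ->] := osc_comp0_poly q_gt0 (base_comp b).
by rewrite !ev_poly ?tauE ?tt //; exact: pos_char.
Qed.

Lemma ev_aas chi : posX chi -> ev chi (a * star a) = (q * tau chi + 1)%:C%C.
Proof.
move=> X; have cc := pos_char X; rewrite osc_relE ev_lin //; last exact: osc_comp_1; last exact: osc_N_comp.
by rewrite ev1 // tauE // rmorphD rmorphM.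
Qed.

(** The value is q t + 1 >= 1: the action of a^* is defined at every positive character. *)
Let aas_neq0 chi : posX chi -> ev chi (star (star a) * star a) != 0.
Proof.
move=> X; rewrite starK ev_aas // -[0]/(0%:C%C) (inj_eq (@complexI _)).
by rewrite gt_eqF // ltr_wpDl // mulr_ge0 ?tau_ge0 // ltW.
Qed.

Lemma tau_alpha_a chi : posX chi -> tau chi != 0 -> tau (alpha chi a) = (tau chi - 1) / q.
Proof.
move=> X t0; have cc := pos_char X.
rewrite {1}/tau ev_alpha; last exact: osc_N_comp.
have -> : star a * N * a = N * (qc^-1 *: (N + (-1) *: 1)).
  by rewrite -mulrA (osc_Na q_gt0) mulrA scaleN1r.
rewrite -/(osc_N q) evM //; try exact: osc_N_comp; last first.
  rewrite -[_ *: _]addr0; apply: osc_comp_lin; last exact: osc_comp_0.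
  rewrite addrC; apply: osc_comp_lin; [exact: osc_comp_1|exact: osc_N_comp].
rewrite evZ //; last by rewrite addrC; apply: osc_comp_lin; [exact: osc_comp_1|exact: osc_N_comp].
rewrite addrC ev_lin //; [|exact: osc_comp_1|exact: osc_N_comp].
rewrite ev1 // mulr1 tauE // mulrAC mulfV ?mul1r; last first.
  by rewrite -[0]/(0%:C%C) (inj_eq (@complexI _)).
have -> : qc^-1 * (-1 + (tau chi)%:C%C) = ((tau chi - 1) / q)%:C%C; last by [].
by rewrite rmorphM fmorphV rmorphB /= rmorph1 mulrC addrC.
Qed.

Lemma tau_alpha_star chi : posX chi -> tau (alpha chi (star a)) = q * tau chi + 1.
Proof.
move=> X; have cc := pos_char X; rewrite {1}/tau ev_alpha; last exact: osc_N_comp.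
have aas0 : osc_comp 0 (a * star a) by rewrite -(subrr (1 : int)); apply: osc_comp_mul (osc_comp_a q) (osc_comp_star_a q).
have -> : star (star a) * N * star a = (a * star a) * (a * star a) by rewrite starK !mulrA.
have a0 := aas_neq0 X; rewrite starK in a0.
by rewrite evM // starK mulfK // ev_aas.
Qed.

Lemma alpha_a_alpha_star chi : posX chi -> alpha (alpha chi (star a)) a = chi.
Proof.
move=> X; have cc := pos_char X; apply/funext => b; rewrite {1}/alpha.
have aas0 : osc_comp 0 (a * star a) by rewrite -(subrr (1 : int)); apply: osc_comp_mul (osc_comp_a q) (osc_comp_star_a q).
have b0 := base_comp b; have a0 := aas_neq0 X; rewrite starK in a0.
rewrite !ev_alpha ?starK; [|exact: osc_N_comp|exact: osc_comp_conj (osc_comp_a q) b0].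
have -> : a * (star a * val b * a) * star a = (a * star a) * (val b * (a * star a)) by rewrite !mulrA.
have -> : a * (star a * a) * star a = (a * star a) * (a * star a) by rewrite !mulrA.
rewrite (evM cc aas0 (osc_comp0M b0 aas0)) (evM cc b0 aas0) (evM cc aas0 aas0) ev_val.
by move: a0; set z := ev chi (a * star a) => a0; field.
Qed.

(** In degree 1 one has c = a p(N), so chi(c^* c) has the factor chi(N) and vanishes with it;
    [ev_swap] then exchanges c for a. *)
Lemma action_dom1 chi c : posX chi -> osc_comp 1 c -> ev chi (star c * c) != 0 ->
  tau chi != 0 /\ alpha chi c = alpha chi a.
Proof.
move=> X c1 c0; have cc := pos_char X.
have t0 : ev chi N != 0.
  have [p cE] := osc_comp_homog q_gt0 c1; have p0 := osc_poly_comp q p.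
  have sp0 : osc_comp 0 (star (osc_poly q p)) by rewrite -oppr0; apply: osc_comp_star.
  apply: contraNneq c0 => N0.
  have -> : star c * c = star (osc_poly q p) * (N * osc_poly q p).
    by rewrite cE /= expr1 starM !mulrA.
  have N0' := osc_N_comp q.
  by rewrite (evM cc sp0 (osc_comp0M N0' p0)) (evM cc N0' p0) N0 mul0r mulr0.
split; first by apply: contraNneq t0 => t0; rewrite tauE // t0.
apply/funext => b; rewrite /alpha.
have := ev_swap cc (base_comp b) c1 (osc_comp_a q).
rewrite -/(osc_N q) => /(canRL (mulfK t0)) ->.
by rewrite mulrAC [ev chi (star c * c) * _]mulrC mulfK.
Qed.

Definition tau_set (S : set R) : set (base_fun gr) := [set chi | posX chi /\ S (tau chi)].

(** The image under t |-> (t - 1) / q is written as a preimage under t |-> q t + 1. All of the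
    preimage is reached: act by a^* first, which is always possible, and return by a. *)
Lemma action_image1 (S : set R) :
  action_image 1 (tau_set S `&` @action_dom R A gr 1) = tau_set [set t | S (q * t + 1)].
Proof.
apply/seteqP; split=> chi'.
  move=> [chi [c [[[X St] _] c1 c0 chiE]]].
  have [t0 aE] := action_dom1 X c1 c0.
  have -> : chi' = alpha chi a by rewrite -aE; apply/funext => b; apply: chiE.
  split; first by apply: (alpha_pos X (osc_comp_a q)); rewrite -/(osc_N q) tauE // -[0]/(0%:C%C) (inj_eq (@complexI _)).
  rewrite /= tau_alpha_a //.
  by rewrite mulrC divfK ?subrK // gt_eqF.
move=> [X St]; exists (alpha chi' (star a)), a.
have X' : posX (alpha chi' (star a)) by apply: alpha_pos X (osc_comp_star_a q) (aas_neq0 X).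
have N0 : ev (alpha chi' (star a)) (star a * a) != 0.
  rewrite -/(osc_N q) tauE // tau_alpha_star // -ev_aas //.
  by have := aas_neq0 X; rewrite starK.
split=> //; first split.
- by split=> //; rewrite tau_alpha_star.
- by split=> //; exists a => //; apply: osc_comp_a.
- exact: osc_comp_a.
- by move=> b; rewrite -{1}(alpha_a_alpha_star X).
Qed.

(** A_0 is commutative, so chi(c^* b c) = chi(c^* c) chi(b) and degree 0 acts trivially. *)
Lemma action_image0 (D : set (base_fun gr)) : D `<=` posX ->
  action_image 0 (D `&` @action_dom R A gr 0) = D.
Proof.
move=> DX; apply/seteqP; split=> chi.
  move=> [chi' [c [[D' _] c0 cn0 chiE]]]; have cc := pos_char (DX _ D').
  suff -> : chi = chi' by [].
  apply/funext => b; rewrite chiE -!/(ev _ _).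
  have sc0 : osc_comp 0 (star c) by rewrite -oppr0; apply: osc_comp_star.
  rewrite (osc_comp0_comm q_gt0 sc0 (base_comp b)) -mulrA evM ?ev_val ?mulfK //.
    exact: base_comp.
  exact: osc_comp_sq c0.
move=> Dchi; have cc := pos_char (DX _ Dchi).
have e1 : ev chi (star 1 * 1) = 1 by rewrite star1 mulr1 ev1.
exists chi, 1; split=> //.
- split=> //; split; first exact: DX.
  by exists 1; [exact: osc_comp_1|rewrite -/(ev _ _) e1 oner_neq0].
- exact: osc_comp_1.
- by rewrite -/(ev _ _) e1 oner_neq0.
- by move=> b; rewrite -!/(ev _ _) e1 star1 mul1r mulr1 divr1 ev_val.
Qed.

End Characters.

(** * Spectral measures *)

(* [scalar_measure] is a bare set function, so the integral is computed from its definition. *)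
Section PointMass.
Import HBNNSimple.
Context d (T : measurableType d) (R : realType) (mu : set T -> \bar R) (x0 : T) (c : R).
Hypotheses (c_ge0 : 0 <= c) (x0_meas : measurable [set x0]).
Hypothesis mu_point : forall D, measurable D -> mu D = (c * (x0 \in D)%:R)%:E.

Lemma sintegral_point_mass (h : {nnsfun T >-> R}) : sintegral mu h = (c * h x0)%:E.
Proof.
have mh x : mu (h @^-1` [set x]) = (c * (h x0 == x)%:R)%:E.
  rewrite mu_point; last exact: measurable_funPTI.
  have -> // : (x0 \in h @^-1` [set x]) = (h x0 == x).
  by apply/idP/eqP; [move=> /set_mem|move=> hx; apply/mem_set].
rewrite sintegralET -(fsbig_widen [set h x0]) //; last first.
  move=> x /= [_ /eqP hx]; rewrite mh eq_sym (negbTE hx) mulr0.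
  exact: mule0.
by rewrite fsbig_set1 mh eqxx mulr1 -EFinM mulrC.
Qed.

Lemma integral_point_mass (X : set T) (f : T -> R) : X x0 ->
  (\int[mu]_(x in X) (f x)%:E)%E = (c * f x0)%:E.
Proof.
move=> Xx0.
have sup (g : T -> \bar R) (r : R) : (forall x, 0 <= g x)%E -> g x0 = r%:E ->
    ereal_sup [set sintegral mu h | h in [set h : {nnsfun T >-> R} |
      forall x, ((h x)%:E <= g x)%E]] = (c * r)%:E.
  move=> g0 gx0; have r0 : 0 <= r by rewrite -lee_fin -gx0.
  apply/le_anti/andP; split.
    apply: ge_ereal_sup => _ [h /= hg <-]; rewrite sintegral_point_mass lee_fin ler_wpM2l //.
    by rewrite -lee_fin -gx0.
  (* The supremum is attained at r times the indicator of x0. *)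
  pose h := scale_nnsfun (indic_nnsfun R x0_meas) r0.
  have hE x : h x = r * (x == x0)%:R.
    have -> : h x = r * \1_[set x0] x by [].
    rewrite indicE; have -> // : (x \in [set x0]) = (x == x0).
    by apply/idP/eqP; [move=> /set_mem|move=> ->; apply/mem_set].
  have -> : (c * r)%:E = sintegral mu h.
    rewrite sintegral_point_mass; congr (c * _)%:E.
    by have := hE x0; rewrite eqxx mulr1.
  apply: ereal_sup_ubound; exists h => // x; rewrite (_ : (h x)%:E = (r * (x == x0)%:R)%:E); last exact: (congr1 EFin (hE x)).
  by have [->|_] := eqVneq x x0; rewrite ?mulr1 ?gx0 // mulr0.
have fx0 : ((fun x => (f x)%:E) \_ X) x0 = (f x0)%:E by rewrite patchE mem_set.
rewrite /integral (sup _ (Num.max (f x0) 0)) => [|x|]; last 2 first.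
- exact: funepos_ge0.
- by rewrite funeposE fx0 EFin_max.
rewrite (sup _ (Num.max (- f x0) 0)) => [|x|]; last 2 first.
- exact: funeneg_ge0.
- by rewrite funenegE fx0 EFin_max.
rewrite -EFinB -mulrBr; congr (c * _)%:E.
by rewrite !maxEle; case: ifPn; case: ifPn; lra.
Qed.

End PointMass.

(** * Projections and null sets of a spectral measure *)

Section SpectralNull.
Context d (T : measurableType d) (R : realType) (E : hilbertType R).
Context (X : set T) (P : set T -> E -> E) (P_sm : spectral_measure X P).
Implicit Types D B : set T.

Let P_add (D : (set T)^nat) u : (forall n, measurable (D n) /\ D n `<=` X) ->
  trivIset setT D -> series (fun n => P (D n) u) @ \oo --> P (\bigcup_n D n) u.
Proof. by move=> DX tD; have [_ _] := P_sm; apply. Qed.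

(** The constant sequence of empty sets gives a convergent series with constant terms, which must
    vanish. *)
Lemma spectral_set0 u : P set0 u = 0.
Proof.
have := @P_add (fun=> set0) u; rewrite bigcup0 // => H.
have /cvg_series_cvg_0 H0 : cvgn (series (fun _ : nat => P set0 u)).
  by apply/cvg_ex; exists (P set0 u); apply: H => [n|i j _ _ [x []] //]; split.
apply: (cvg_unique (@norm_hausdorff _ _) _ H0); exact: cvg_cst.
Qed.

Lemma spectral_setU D B u : measurable D -> measurable B -> D `<=` X -> B `<=` X ->
  D `&` B = set0 -> P (D `|` B) u = P D u + P B u.
Proof.
move=> mD mB DX BX DB; have := @P_add (bigcup2 D B) u; rewrite bigcup2E => H.
apply: (cvg_unique (@norm_hausdorff _ _) (H _ _)).
- by move=> [|[|n]] /=; split=> //; rewrite /bigcup2 /=.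
- by rewrite -trivIset_bigcup2 //; apply/eqP.
- apply: (@cvg_near_cst) => //; exists 2%N => // -[|[|n]] //= _.
  rewrite /series /= big_nat_recl // big_nat_recl //= addrA big1 ?addr0 // => i _.
  by rewrite /bigcup2 /= spectral_set0.
Qed.

Lemma spectral_proj D : measurable D -> D `<=` X -> orthogonal_projection (P D).
Proof. by move=> mD DX; have [+ _ _] := P_sm; apply. Qed.

Lemma spectral_inner D u : measurable D -> D `<=` X -> inner (P D u) u = (sqn (P D u))%:C%C.
Proof.
move=> mD DX; have [_ Pid Psym] := spectral_proj mD DX.
by rewrite -{1}(Pid u) Psym sqn_inner.
Qed.

(** For v in the range of P B, additivity gives |P (D U B) v|^2 = |P D v|^2 + |v|^2, and a
    projection does not increase norms. *)
Lemma spectral_disjoint D B u : measurable D -> measurable B -> D `<=` X -> B `<=` X ->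
  D `&` B = set0 -> P D (P B u) = 0.
Proof.
move=> mD mB DX BX DB; have [_ Bid _] := spectral_proj mB BX.
have mU : measurable (D `|` B) by apply: measurableU.
have UX : D `|` B `<=` X by rewrite subUset.
set v := P B u; have [_ Uid Usym] := spectral_proj mU UX.
apply: sqn_eq0; apply/eqP; rewrite eq_le sqn_ge0 andbT.
have Uv : sqn (P (D `|` B) v) = sqn (P D v) + sqn v.
  have e1 := spectral_inner v mU UX.
  have e2 := spectral_inner v mD DX.
  apply: complexI; rewrite rmorphD /= -e1 -e2 spectral_setU // innerDl /v Bid.
  by rewrite sqn_inner.
have : sqn (P (D `|` B) v) <= sqn v; last by rewrite Uv gerDr.
have : inner (v - P (D `|` B) v) (P (D `|` B) v) = 0.
  by rewrite innerBl [inner (P _ v) _]Usym Uid subrr.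
move=> o; rewrite -[X in _ <= sqn X](subrK (P (D `|` B) v)) sqnD o mulr0 addr0.
by rewrite lerDr sqn_ge0.
Qed.

Lemma spectral_subset D B u : measurable D -> measurable B -> D `<=` B -> B `<=` X ->
  P D (P B u) = P D u.
Proof.
move=> mD mB DB BX; have DX := subset_trans DB BX.
have mC : measurable (B `\` D) by apply: measurableD.
have CX : B `\` D `<=` X by move=> x [/BX].
have -> : P B u = P D u + P (B `\` D) u.
  by rewrite -spectral_setU //; [rewrite setDUK|exact: setDIK].
have [Dlin Did _] := spectral_proj mD DX.
rewrite -[P D u]scale1r Dlin !scale1r Did spectral_disjoint ?addr0 //.
by rewrite setDIK.
Qed.

Lemma spectral_superset D B u : measurable D -> measurable B -> D `<=` B -> B `<=` X ->
  P B (P D u) = P D u.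
Proof.
move=> mD mB DB BX; have DX := subset_trans DB BX.
have mC : measurable (B `\` D) by apply: measurableD.
have CX : B `\` D `<=` X by move=> x [/BX].
have [_ Did _] := spectral_proj mD DX.
have -> : P B (P D u) = P D (P D u) + P (B `\` D) (P D u).
  by rewrite -spectral_setU //; [rewrite setDUK|exact: setDIK].
by rewrite Did spectral_disjoint ?addr0 // setIC setDIK.
Qed.

Lemma spectral_bigcup0 (D : (set T)^nat) u : (forall n, measurable (D n)) ->
  (forall n, D n `<=` X) -> (forall n, P (D n) u = 0) -> P (\bigcup_n D n) u = 0.
Proof.
move=> mD DX D0; rewrite seqDU_bigcup_eq.
have mS := seqDU_measurable mD.
have := @P_add (seqDU D) u => H; apply: (cvg_unique (@norm_hausdorff _ _) (H _ _)).
- by move=> n; split=> //; apply: subset_trans (DX n); apply: subset_seqDU.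
- exact: trivIset_seqDU.
apply: cvg_near_cst; apply: nearW => n; rewrite /series /= big1 // => i _.
rewrite -(@spectral_subset _ (D i)) // ?D0; last exact: subset_seqDU.
have [lin _ _] := spectral_proj (mS i) (subset_trans (@subset_seqDU _ _ _) (DX i)).
exact: linear_op0 lin.
Qed.

Lemma spectral_complement D u : measurable X -> measurable D -> D `<=` X ->
  P (X `\` D) u = u - P D u.
Proof.
move=> mX mD DX; have [_ PX _] := P_sm.
have mC : measurable (X `\` D) by apply: measurableD.
apply: (addrI (P D u)); rewrite -spectral_setU //; last exact: setDIK.
by rewrite setDUK // PX addrC subrK.
Qed.

End SpectralNull.

(** * Measurability of the coordinate [tau] *)

Section TauMeas.
Context (R : realType) (q : R) (q_gt0 : 0 < q).
Local Notation A := (oscillator q).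
Local Notation gr := (osc_grading q).
Local Notation posX := (@positive_characters R A gr).
Local Notation T := (character_space gr).
Lemma eval_continuous (b : base gr) : continuous (fun chi : base_fun gr => chi b : R[i]^o).
Proof. exact: (@proj_continuous _ (fun=> R[i]^o) b). Qed.

Lemma Re_continuous : continuous (fun z : R[i]^o => complex.Re z : R).
Proof.
move=> z; have FF : Filter (nbhs (z : R[i]^o)) by exact: nbhs_filter.
suff H : forall e : R, 0 < e -> nbhs (z : R[i]^o) [set w : R[i]^o | `|complex.Re z - complex.Re w| < e].
  exact: (iffRL (@cvgrPdist_lt _ _ _ (nbhs (z : R[i]^o)) FF (fun w : R[i]^o => complex.Re w : R) (complex.Re z))).
move=> e e0; have e0c : 0 < e%:C%C :> R[i] by rewrite ltcR.
exists e%:C%C => //= w zw.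
suff : `|complex.Re z - complex.Re w|%:C%C < e%:C%C by rewrite ltcR.
apply: le_lt_trans zw; case: z w {FF} => [z1 z2] [w1 w2].
exact: (normc_ge_Re ((z1 +i* z2)%C - (w1 +i* w2)%C)).
Qed.

Lemma tau_continuous : continuous (@tau R q).
Proof.
by move=> chi; apply: continuous_comp; [exact: eval_continuous|exact: Re_continuous].
Qed.

Lemma measurable_posX : measurable (posX : set T).
Proof.
apply: sub_gen_smallest; exists setT; [exact: openT|by rewrite setIT].
Qed.

Lemma measurable_tau : measurable_fun (posX : set T) (@tau R q : T -> R).
Proof.
apply: (@measurability _ _ T _ _ _ _ (RGenOpens.measurableE R)).
move=> _ [_ [x [y ->]] <-]; apply: sub_gen_smallest.
exists (@tau R q @^-1` `]x, y[%classic) => //.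
exact: (continuousP _).1 tau_continuous _ (@interval_open _ _ _ _ _).
Qed.

Lemma measurable_tau_set S : measurable S -> measurable (tau_set S : set T).
Proof. by move=> mS; apply: measurable_tau => //; exact: measurable_posX. Qed.

End TauMeas.

(** * Well-behaved representations and the zero-one law *)

Section WellBehaved.
Context (R : realType) (q : R) (q_gt0 : 0 < q) (E : hilbertType R).
Context (pi : star_rep (oscillator q) E).
Local Notation A := (oscillator q).
Local Notation gr := (osc_grading q).
Local Notation posX := (@positive_characters R A gr).
Local Notation T := (character_space gr).
Local Notation a := (osc_a q).
Context (P : set T -> E -> E).
Hypothesis P_sm : spectral_measure (posX : set T) P.
Hypothesis P_int : forall b : base gr, closure (rop pi (val b)) =
  spectral_integral (posX : set T) P (fun chi : base_fun gr => chi b).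
Hypothesis P_cov : forall n c (D : set T), gr n c -> measurable D -> D `<=` posX ->
  op_comp (op_fun (P (action_image n (D `&` @action_dom R A gr n)))) (rop pi c)
    `<=` op_comp (rop pi c) (op_fun (P D)).
Hypothesis pi_irr : irreducible_rep pi.

Local Notation D_ S := (tau_set S : set T).

Let tau_setX S : D_ S `<=` posX.
Proof. by move=> chi []. Qed.

Let mX := @measurable_posX R q.

(** The left operator of the inclusion has domain D(pi), so the inclusion also says that P D maps
    D(pi) into itself. *)
Lemma covariance n c (D : set T) u : osc_comp n c -> measurable D -> D `<=` posX -> rdom pi u ->
  rdom pi (P D u) /\
  P (action_image n (D `&` @action_dom R A gr n)) (ract pi c u) = ract pi c (P D u).
Proof.
move=> cn mD DX du.
have : op_comp (op_fun (P (action_image n (D `&` @action_dom R A gr n)))) (rop pi c)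
    (u, P (action_image n (D `&` @action_dom R A gr n)) (ract pi c u)).
  by exists (ract pi c u).
move=> /(P_cov cn mD DX)[v [vE [/= dv ->]]]; rewrite /op_fun /= in vE.
by rewrite vE in dv *.
Qed.

Lemma spectral_dom_inv (D : set T) u : measurable D -> D `<=` posX -> rdom pi u -> rdom pi (P D u).
Proof. by move=> mD DX du; have [] := covariance (osc_comp_1 q) mD DX du. Qed.

Lemma spectral_comm0 (D : set T) b u : osc_comp 0 b -> measurable D -> D `<=` posX -> rdom pi u ->
  P D (ract pi b u) = ract pi b (P D u).
Proof.
by move=> b0 mD DX du; have [_] := covariance b0 mD DX du; rewrite action_image0.
Qed.

(** On the range of the projection of a single character, the spectral integral of b is
    multiplication by chi(b). Testing it against z = pi(b) u - chi(b) u gives <z, z> = 0. *)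
Lemma point_eigenvector chi u : posX chi -> rdom pi u -> P (D_ [set tau chi]) u = u ->
  forall b : A, osc_comp 0 b -> ract pi b u = ev chi b *: u.
Proof.
move=> X du Pu b b0; set D := D_ [set tau chi] in Pu *.
have DE : D = [set chi : T].
  apply/seteqP; split=> chi' /=; first by move=> [X' tt]; apply: (tau_inj q_gt0).
  by move=> ->.
have mD : measurable D by apply: measurable_tau_set; exact: measurable_set1.
have [Dlin _ _] := spectral_proj P_sm mD (@tau_setX _).
set w := ract pi b u; pose z := w - ev chi b *: u.
have Dw : P D w = w by rewrite /w spectral_comm0 ?Pu //; exact: tau_setX.
have Dz : P D z = z by rewrite /z addrC -scaleNr Dlin Dw Pu.
(* u and z lie in the range of P D, where every scalar measure is concentrated at chi. *)
have meas v : P D v = v -> forall B, measurable B ->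
    scalar_measure (posX : set T) P v B = (sqn v * ((chi : T) \in B)%:R)%:E.
  move=> Dv B mB; rewrite /scalar_measure; congr EFin.
  have mBX : measurable (B `&` posX) by apply: measurableI.
  have BX : B `&` posX `<=` posX by move=> x [].
  have [cB|cB] := boolP ((chi : T) \in B); rewrite ?mulr1 ?mulr0.
    rewrite -Dv (spectral_superset P_sm) ?Dv //.
    by rewrite DE => _ ->; split=> //; exact: set_mem.
  rewrite -{1}Dv (spectral_disjoint P_sm) ?inner0l //; first exact: tau_setX.
  rewrite DE; apply/seteqP; split=> // chi' [[B' _] /= E']; rewrite E' in B'.
  by rewrite (mem_set B') in cB.
have mchi : measurable [set chi : T] by rewrite -DE.
have point (f : T -> R) v : P D v = v ->
    (\int[scalar_measure (posX : set T) P v]_(t in (posX : set T)) (f t)%:E)%E = (sqn v * f chi)%:E.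
  by move=> Dv; apply: (integral_point_mass (sqn_ge0 v) mchi (meas v Dv)).
have : spectral_integral (posX : set T) P (fun chi' : base_fun gr => chi' (to_base gr b)) (u, w).
  by rewrite -P_int; apply: subset_closure; rewrite to_baseK.
move=> [_ /(_ z)].
(* The vectors u + i^k z stay in the range of P D, so each of the four polarised integrals is chi(b)
   times a squared norm. *)
have -> : spectral_form (posX : set T) P (fun chi' : base_fun gr => chi' (to_base gr b)) u z =
    ev chi b * inner u z.
  rewrite polarization /spectral_form [RHS]mulrCA [in RHS]mulr_sumr; congr (_ * _).
  apply: eq_bigr => k _; rewrite [RHS]mulrCA; congr (_ * _).
  have Duz : P D (u + 'i ^+ k *: z) = u + 'i ^+ k *: z by rewrite addrC Dlin Dz Pu.
  rewrite /complex_integral !point // -sqnE /=.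
  by rewrite /ev; case: (chi _) => x y; apply/eqP; rewrite eq_complex /=; apply/andP; split; apply/eqP; ring.
move=> wz; have {wz} : inner w z = ev chi b * inner u z.
  by apply: wz; rewrite /spectral_dom /= point // ltry.
move=> /eqP; rewrite -subr_eq0 -innerZl -innerBl => /eqP/inner_eq0/eqP.
by rewrite subr_eq0 => /eqP.
Qed.

Definition tau_null (S : set R) := forall u, P (D_ S) u = 0.

Lemma tau_null_dom (D : set T) : measurable D -> D `<=` posX ->
  (forall u, rdom pi u -> P D u = 0) -> forall u, P D u = 0.
Proof.
move=> mD DX D0 u; have [_ _ Dsym] := spectral_proj P_sm mD DX.
apply: (dense_orth (@rdom_dense _ _ _ pi)) => v dv.
by rewrite Dsym D0 // inner0r.
Qed.

(* P (D_ S) commutes with pi(a) by covariance, hence with its adjoint. *)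
Lemma tau_zero_one (S : set R) : measurable S -> (forall t, S (q * t + 1) <-> S t) ->
  tau_null S \/ tau_null (~` S).
Proof.
move=> mS Sinv; set D := D_ S.
have mD : measurable D by apply: measurable_tau_set.
have DX : D `<=` posX by exact: tau_setX.
have [Dlin Did Dsym] := spectral_proj P_sm mD DX.
have dD u : rdom pi u -> rdom pi (P D u) by exact: spectral_dom_inv.
have Da u : rdom pi u -> P D (ract pi a u) = ract pi a (P D u).
  move=> du; have [_] := covariance (osc_comp_a q) mD DX du.
  rewrite action_image1 //; have -> // : [set t | S (q * t + 1)] = S.
  by apply/seteqP; split=> t /=; case: (Sinv t).
have Dx x u : rdom pi u -> P D (ract pi x u) = ract pi x (P D u).
  move: x u; apply: osc_ind => //.
  - move=> u du; apply/eqP; rewrite -subr_eq0; apply/eqP.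
    apply: (dense_orth (@rdom_dense _ _ _ pi)) => v dv.
    rewrite innerBl Dsym !ract_star //; [|exact: dD|exact: dD].
    by rewrite starK -Da // -Dsym subrr.
  - move=> c u du; rewrite !ract_algZ ?ract_alg1 //; try exact: dD.
    by rewrite -[c *: u]addr0 Dlin (linear_op0 Dlin) addr0.
  - move=> x y hx hy u du; rewrite !ract_algD //; last exact: dD.
    by rewrite -[ract pi x u]scale1r Dlin !scale1r hx // hy.
  - move=> x y hx hy u du; rewrite !ract_algM //; last exact: dD.
    by rewrite hx ?hy //; apply: ract_dom.
have D0 := linear_op0 Dlin.
pose D1 := [set u | rdom pi u /\ P D u = u]; pose D2 := [set u | rdom pi u /\ P D u = 0].
have DsubE u : P D (u - P D u) = 0.
  by rewrite (linear_opB _ _ Dlin) Did subrr.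
have [|D10|D20] := pi_irr.2 D1 D2.
- split.
  + split; first by split=> //; exact: rdom0.
    * move=> c u v [du hu] [dv hv]; split; first exact: rdom_linear.
      by rewrite Dlin hu hv.
    * by move=> x u [du hu]; split; [exact: ract_dom|rewrite Dx // hu].
  + split; first by split=> //; exact: rdom0.
    * move=> c u v [du hu] [dv hv]; split; first exact: rdom_linear.
      by rewrite Dlin hu hv scaler0 addr0.
    * by move=> x u [du hu]; split; [exact: ract_dom|rewrite Dx // hu ract_vec0].
  + by move=> u v [_ <-] [_ hv]; rewrite Dsym hv inner0r.
  + apply/seteqP; split=> u; last by move=> [v [dv _] [w [dw _] <-]]; apply: rdomD.
    move=> du; exists (P D u); first by split; [exact: dD|exact: Did].
    exists (u - P D u); last by rewrite addrC subrK.
    by split; [apply: rdomB => //; exact: dD|exact: DsubE].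
- left; apply: tau_null_dom => // u du.
  have : D1 (P D u) by split; [exact: dD|exact: Did].
  by rewrite D10.
- right; rewrite /tau_null; have -> : D_ (~` S) = posX `\` D.
    by apply/seteqP; split=> chi [X nS]; split=> //; [case|move=> Schi; apply: nS].
  apply: tau_null_dom => [||u du]; [exact: measurableD|by move=> chi []|].
  rewrite (spectral_complement P_sm) //.
  have : D2 (u - P D u) by split; [apply: rdomB => //; exact: dD|exact: DsubE].
  by rewrite D20.
Qed.

(** The inclusion is tested only at values of [tau]; this is how the constraint on those values
    enters the search for an atom. *)
Lemma tau_null_sub (S S' : set R) : measurable S -> measurable S' ->
  (forall chi, posX chi -> S (tau chi) -> S' (tau chi)) -> tau_null S' -> tau_null S.
Proof.
move=> mS mS' SS' nS' u.
have D0 : P (D_ S) 0 = 0.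
  have [Dlin _ _] := spectral_proj P_sm (@measurable_tau_set R q S mS) (@tau_setX _).
  exact: linear_op0 Dlin.
rewrite -(@spectral_subset _ _ _ _ _ _ P_sm _ (D_ S')) ?nS' //; first exact: measurable_tau_set.
  exact: measurable_tau_set.
by move=> chi [X Schi]; split=> //; apply: SS'.
Qed.

Lemma tau_null_bigcup (S : (set R)^nat) : (forall n, measurable (S n)) ->
  (forall n, tau_null (S n)) -> tau_null (\bigcup_n S n).
Proof.
move=> mS nS u; have -> : D_ (\bigcup_n S n) = \bigcup_n (D_ (S n)).
  apply/seteqP; split=> chi; first by move=> [X [n _ Sn]]; exists n.
  by move=> [n _ [X Sn]]; split=> //; exists n.
apply: (spectral_bigcup0 P_sm) => n; [exact: measurable_tau_set|exact: tau_setX|exact: nS].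
Qed.

Lemma tau_not_null : ~ tau_null setT.
Proof.
move=> n0; have [nontriv _] := pi_irr; apply: nontriv.
have [_ PX _] := P_sm.
have z (u : E) : u = 0.
  by rewrite -(n0 u); have -> : D_ setT = posX; [apply/seteqP; split=> chi //= []|rewrite PX].
by apply/seteqP; split=> u; [rewrite (z u)|move=> ->; exact: rdom0].
Qed.

End WellBehaved.

(** * Existence of an atom *)

Section Atom.
(** [V] stands for the values chi(N) of positive characters and [null] for the sets that the
    spectral measure ignores, so that what remains is the dynamics of t |-> q t + 1 on the line. *)
Context (R : realType) (q : R) (q_gt0 : 0 < q) (V : set R) (null : set R -> Prop).
Hypothesis V_ge0 : forall t, V t -> 0 <= t.
Hypothesis V_pred : forall t, V t -> t != 0 -> V ((t - 1) / q).
Hypothesis null_sub : forall S S', measurable S -> measurable S' ->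
  (forall t, V t -> S t -> S' t) -> null S' -> null S.
Hypothesis null_bigcup : forall S : (set R)^nat, (forall n, measurable (S n)) ->
  (forall n, null (S n)) -> null (\bigcup_n S n).
Hypothesis zero_one : forall S, measurable S -> (forall t, S (q * t + 1) <-> S t) ->
  null S \/ null (~` S).
Hypothesis not_null : ~ null setT.

Let sg (t : R) := q * t + 1.

Let null0 : null set0.
Proof.
have [|t|//|] := @zero_one set0; first exact: measurable0.
  by split.
by rewrite setC0 => /not_null.
Qed.

Let nullU S S' : measurable S -> measurable S' -> null S -> null S' -> null (S `|` S').
Proof.
move=> mS mS' nS nS'; rewrite -bigcup2E.
by apply: null_bigcup => -[|[|n]] //=; rewrite /bigcup2 //=; exact: measurable0.
Qed.

Let null_range (f : nat -> R) : (forall t, null [set t]) -> null (range f).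
Proof.
move=> n1; have -> : range f = \bigcup_n [set f n].
  by apply/seteqP; split=> t; [move=> [n _ <-]; exists n|move=> [n _ ->]; exists n].
by apply: null_bigcup => n; [exact: measurable_set1|exact: n1].
Qed.

Let m_range (f : nat -> R) : measurable (range f).
Proof.
have -> : range f = \bigcup_n [set f n].
  by apply/seteqP; split=> t; [move=> [n _ <-]; exists n|move=> [n _ ->]; exists n].
by apply: bigcup_measurable => n _; exact: measurable_set1.
Qed.

(* Iterating t |-> (t - 1) / q makes t negative unless 0 is hit; [B n] allows n steps. *)
Lemma backward_hits_zero (B : nat -> set R) n t : V t -> B n t ->
  (forall t, V t -> ~ B 0 t) ->
  (forall n t, V t -> t != 0 -> V ((t - 1) / q) -> B n.+1 t -> B n ((t - 1) / q)) ->
  range (fun k => iter k sg 0) t.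
Proof.
move=> Vt Bt B0 BS; elim: n t Vt Bt => [t /B0 //|n IH t Vt Bt].
have [->|t0] := eqVneq t 0; first by exists 0%N.
have [k _ tk] := IH _ (V_pred Vt t0) (BS _ _ Vt t0 (V_pred Vt t0) Bt).
by exists k.+1 => //=; rewrite tk /sg mulrC divfK ?subrK // gt_eqF.
Qed.

(** For q >= 1 a backward step lowers t by at least 1, so every value lies on the orbit of 0. This
    orbit is countable and carries everything, hence contains an atom. *)
Lemma atom_exists_ge1 : 1 <= q -> exists t, ~ null [set t].
Proof.
move=> q1; apply: contrapT => /forallNP n1; apply: not_null.
apply: (null_sub measurableT (m_range (fun k => iter k sg 0))); last first.
  by apply: null_range => t; apply: contrapT; exact: n1.
move=> t Vt _; apply: (@backward_hits_zero (fun n t => t < n%:R) (Num.truncn t).+1) => //.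
- exact: truncnS_gt.
- by move=> s /V_ge0; rewrite leNgt => /negP.
- move=> n s Vs s0 /V_ge0; rewrite ler_pdivlMr // mul0r subr_ge0 => s1.
  rewrite -natr1 ltr_pdivrMr // => sn.
  have n0 : 0 <= n%:R :> R by [].
  by nra.
Qed.

Section Contracting.
Hypothesis q_lt1 : q < 1.
Let c := (1 - q)^-1.
Let q1 : 0 < 1 - q. Proof. by rewrite subr_gt0. Qed.
Let c_gt0 : 0 < c. Proof. by rewrite invr_gt0. Qed.

Let sgc t : sg t - c = q * (t - c).
Proof. by rewrite /sg /c; field; rewrite gt_eqF. Qed.

Let Pos := `]c, +oo[%classic : set R.

(** A backward step divides the distance c - t by q; once the distance exceeds c, the point is
    negative. *)
Lemma below_fixed_point t : V t -> t < c -> range (fun k => iter k sg 0) t.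
Proof.
move=> Vt tc; have [n hn] : exists n, q ^+ n * c < c - t.
  have q1' : `|q| < 1 by rewrite gtr0_norm.
  have e0 : 0 < (c - t) / c by rewrite divr_gt0 // subr_gt0.
  have /cvgrPdist_lt/(_ _ e0)/filter_ex[n] := cvg_expr q1'.
  rewrite sub0r normrN gtr0_norm ?exprn_gt0 // ltr_pdivlMr // => hn.
  by exists n.
apply: (@backward_hits_zero (fun n t => q ^+ n * c < c - t) n) => // [s /V_ge0 s0|m s Vs s0 _].
  by rewrite expr0 mul1r => ?; lra.
have -> : c - (s - 1) / q = (c - s) / q by rewrite /c; field; rewrite !gt_eqF.
by move=> H; rewrite ltr_pdivlMr // mulrC mulrA -exprS.
Qed.

(* [frac] is constant on the orbits above the fixed point and separates them. *)
Let h (t : R) : R := ln (t - c) / ln q.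
Let fl (x : R) : R := (Num.floor x)%:~R.
Let frac t := h t - fl (h t).

Let lnq : ln q < 0. Proof. by apply: ln_lt0; rewrite q_gt0. Qed.

Let frac_itv t : 0 <= frac t < 1.
Proof.
have := floor_itv (h t); rewrite intrD1 /frac /fl => /andP[h1 h2].
by rewrite subr_ge0 h1 /= ltrBlDl.
Qed.

Let frac_sg t : c < t -> frac (sg t) = frac t.
Proof.
move=> ct; have hs : h (sg t) = h t + 1.
  rewrite /h sgc lnM ?posrE ?subr_gt0 // mulrDl mulfV ?lt_eqF //.
  by rewrite addrC.
rewrite /frac hs /fl (@floor_def _ (h t + 1) (Num.floor (h t) + 1)).
  by rewrite intrD1 opprD addrACA subrr addr0.
by have := floor_itv (h t); rewrite !intrD1 lerD2r ltrD2r.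
Qed.

Let sg_pos t : (c < sg t) = (c < t).
Proof. by rewrite -subr_gt0 sgc pmulr_rgt0 // subr_gt0. Qed.

Let frac_measurable : measurable_fun setT frac.
Proof.
have mh : measurable_fun setT h.
  have -> : h = ( *%R^~ (ln q)^-1) \o (@ln R \o (fun t => t - c)) by [].
  apply: measurableT_comp; first exact: mulrr_measurable.
  apply: measurableT_comp; first exact: measurable_ln.
  by apply: measurable_funB; [exact: measurable_id|exact: measurable_cst].
apply: measurable_funB => //; apply: (measurableT_comp _ mh).
apply: nondecreasing_measurable => // x y xy.
by rewrite ler_int; apply: le_floor.
Qed.

Let L r : set R := Pos `&` frac @^-1` `]-oo, r[.
Let M r : set R := Pos `&` frac @^-1` `[r, +oo[.

Let mPos : measurable Pos. Proof. exact: measurable_itv. Qed.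

Let mL r : measurable (L r).
Proof.
apply: measurableI => //; rewrite -[X in measurable X]setTI.
by apply: frac_measurable => //; exact: measurable_itv.
Qed.

Let mM r : measurable (M r).
Proof.
apply: measurableI => //; rewrite -[X in measurable X]setTI.
by apply: frac_measurable => //; exact: measurable_itv.
Qed.

Let LP r t : L r t <-> c < t /\ frac t < r.
Proof. by rewrite /L /Pos /= !in_itv /= andbT. Qed.

Let MP r t : M r t <-> c < t /\ r <= frac t.
Proof. by rewrite /M /Pos /= !in_itv /= !andbT. Qed.

(** [L r] is invariant, since both t > c and frac t are; [M r] is its complement within [Pos]. *)
Let zero_one_L r : null (L r) \/ null (M r).
Proof.
have [|t|?|nC] := @zero_one (L r); [exact: mL| |by left|right].
  rewrite -/(sg t); split=> /LP[]; rewrite ?sg_pos => ct; rewrite ?frac_sg // => f; apply/LP; split=> //.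
    by rewrite sg_pos.
  by rewrite frac_sg.
apply: (null_sub (mM r) (measurableC (mL r))) nC.
by move=> t _ /MP[ct rf] /LP[_]; rewrite ltNge rf.
Qed.

Lemma atom_exists_lt1 : exists t, ~ null [set t].
Proof.
apply: contrapT => /forallNP n1; have {}n1 t : null [set t] by apply: contrapT; exact: n1.
have nPos : ~ null Pos.
  move=> nP; apply: not_null.
  have mG := m_range (fun k => iter k sg 0).
  have m2 : measurable (range (fun k => iter k sg 0) `|` [set c]).
    by apply: measurableU => //; exact: measurable_set1.
  apply: (null_sub measurableT (measurableU _ _ m2 mPos)).
    move=> t Vt _; have [tc|ct|->] := ltgtP t c.
    - by left; left; exact: below_fixed_point.
    - by right; rewrite /Pos /= in_itv /= ct.
    - by left; right.
  by apply: nullU => //; apply: nullU => //; exact: null_range.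
pose Z := [set r | null (L r)].
have Z_lt1 r : Z r -> r < 1.
  move=> Zr; rewrite ltNge; apply/negP => r1; apply: nPos; apply: null_sub Zr => // t _.
  rewrite /Pos /= in_itv /= andbT => ct; apply/LP; split=> //.
  by apply: lt_le_trans r1; case/andP: (frac_itv t).
have Z0 : Z 0.
  apply: null_sub null0 => // t _ /LP[_]; rewrite ltNge.
  by case/andP: (frac_itv t) => ->.
have hZ : has_sup Z by split; [exists 0|exists 1 => r /Z_lt1/ltW].
(* [frac] is concentrated at r0: smaller values are null by the definition of the supremum, larger
   ones by the zero-one law for [L r] with r > r0. *)
pose r0 := sup Z.
have nL : null (\bigcup_n L (r0 - n.+1%:R^-1)).
  apply: null_bigcup => // n; have e0 : 0 < n.+1%:R^-1 :> R by rewrite invr_gt0.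
  have [r Zr rr] := sup_adherent e0 hZ; apply: null_sub Zr => // t _ /LP[ct ft].
  by apply/LP; split=> //; apply: lt_trans rr.
have nM : null (\bigcup_n M (r0 + n.+1%:R^-1)).
  apply: null_bigcup => // n; have [Zn|//] := zero_one_L (r0 + n.+1%:R^-1).
  have : r0 + n.+1%:R^-1 <= r0 by apply: ub_le_sup; [case: hZ|].
  by rewrite gerDl leNgt invr_gt0 ltr0n.
(* [f] lists the points above c with frac = r0, where h = r0 + k for an integer k: one orbit,
   countable, hence null when there is no atom. *)
pose f k := c + expR ((r0 + k%:~R) * ln q).
have nf : null (range (fun n : nat => f (Posz n)) `|` range (fun n : nat => f (Negz n))).
  by apply: nullU; [exact: m_range|exact: m_range|exact: null_range|exact: null_range].
have mLs : measurable (\bigcup_n L (r0 - n.+1%:R^-1)) by exact: bigcup_measurable.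
have mMs : measurable (\bigcup_n M (r0 + n.+1%:R^-1)) by exact: bigcup_measurable.
have mf : measurable (range (fun n : nat => f (Posz n)) `|` range (fun n : nat => f (Negz n))).
  by apply: measurableU; exact: m_range.
have arch (e : R) : 0 < e -> exists n : nat, n.+1%:R^-1 < e.
  move=> e0; exists (Num.truncn e^-1); rewrite -[ltRHS]invrK ltf_pV2 ?posrE ?ltr0n ?invr_gt0 //.
  exact: truncnS_gt.
apply: nPos.
apply: (null_sub mPos (measurableU _ _ (measurableU _ _ mLs mMs) mf)); last first.
  by apply: nullU => //; [exact: measurableU|exact: nullU].
move=> t _; rewrite /Pos /= in_itv /= andbT => ct.
have [fr|fr|fr] := ltgtP (frac t) r0.
- left; left; have [|n hn] := arch (r0 - frac t); first by rewrite subr_gt0.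
  by exists n => //; apply/LP; split=> //; rewrite ltrBrDr addrC -ltrBrDr.
- left; right; have [|n hn] := arch (frac t - r0); first by rewrite subr_gt0.
  by exists n => //; apply/MP; split=> //; rewrite -lerBrDl ltW.
- right; have tE : t = f (Num.floor (h t)).
    rewrite /f -fr /frac /fl subrK /h divfK ?lt_eqF // lnK ?posrE ?subr_gt0 //.
    by rewrite addrC subrK.
  by move: tE; case: (Num.floor (h t)) => n ->; [left; exists n|right; exists n].
Qed.

End Contracting.

Lemma atom_exists : exists t, ~ null [set t].
Proof. by have [/atom_exists_ge1|/atom_exists_lt1] := leP 1 q. Qed.

End Atom.

Theorem theorem2p2 (R : realType) (q : R) (q_gt0 : 0 < q)
  (E : hilbertType R) (pi : star_rep (oscillator q) E)
  (pi_irreducible : irreducible_rep pi)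
  (pi_well_behaved : well_behaved (osc_grading q) pi) :
  exists (H : zmodClosed int) (K : hilbertType R)
    (rho : star_rep (subalg (osc_grading q) H) K),
    [/\ one_dimensional rho,
        inducible rho
      & exists (E' : hilbertType R) (sigma : star_rep (oscillator q) E'),
          is_induced rho sigma /\ unitarily_equivalent pi sigma].
Proof.
have [pi_closed [_ [P [P_sm P_int P_cov]]]] := pi_well_behaved.
have inv t : q * ((t - 1) / q) + 1 = t by rewrite mulrC divfK ?subrK // gt_eqF.
have [t nt] : exists t, ~ tau_null P [set t].
  apply: (@atom_exists _ _ q_gt0 (@tau R q @` @positive_characters R _ (osc_grading q))).
  - by move=> _ [chi X <-]; exact: tau_ge0.
  - move=> _ [chi X <-] t0; exists (alpha chi (osc_a q)); last exact: tau_alpha_a.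
    apply: (alpha_pos q_gt0 X (osc_comp_a q)); rewrite -/(osc_N q) tauE //.
    by rewrite -[0]/((0 : R)%:C%C) (inj_eq (@complexI _)).
  - move=> S S' mS mS' SS'; apply: (tau_null_sub P_sm) => // chi X; apply: SS'.
    by exists chi.
  - by move=> S mS nS; apply: (tau_null_bigcup P_sm).
  - by move=> S mS Sinv; apply: (tau_zero_one q_gt0 P_sm P_cov pi_irreducible).
  - exact: (tau_not_null P_sm pi_irreducible).
set D := tau_set [set t] : set (character_space (osc_grading q)).
have mD : measurable D by apply: measurable_tau_set; exact: measurable_set1.
have DX : D `<=` @positive_characters R _ (osc_grading q) by move=> chi [].
have [chi [X /= chit]] : exists chi, D chi.
  apply: contrapT => /forallNP D0; apply: nt => u.
  have DE : D = set0 by apply/seteqP; split=> chi // /D0.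
  by rewrite -/D DE; exact: (spectral_set0 P_sm).
have [u du Du0] : exists2 u, rdom pi u & P D u <> 0.
  apply: contrapT => nu; apply: nt; apply: (tau_null_dom (pi := pi) P_sm mD DX) => u du.
  by apply: contrapT => Du; apply: nu; exists u.
have [Dlin Did _] := spectral_proj P_sm mD DX.
pose e0 := (`|P D u|)^-1 *: P D u.
have dDu : rdom pi (P D u) by apply: (spectral_dom_inv P_cov).
have e0_dom : rdom pi e0 by apply: rdomZ.
have e0_unit : inner e0 e0 = 1.
  have n0 : `|P D u| != 0 by rewrite normr_eq0; apply/eqP.
  by rewrite inner_norm normrZ normfV normr_id mulVf // expr1n.
have De0 : P D e0 = e0 by rewrite /e0 -[_ *: _]addr0 Dlin Did (linear_op0 Dlin).
have eig v : rdom pi v -> P D v = v -> forall b, osc_comp 0 b -> ract pi b v = ev chi b *: v.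
  by move=> dv Dv; apply: (point_eigenvector q_gt0 P_sm P_int P_cov X dv); rewrite chit.
have e0_eig (b : oscillator q) : osc_comp 0 b -> exists mu, ract pi b e0 = mu *: e0.
  by move=> b0; exists (ev chi b); apply: eig.
have [q1|q1] := pselect (q = 1).
  by apply: (@free_orbit_induced _ _ q_gt0 _ pi e0) => //; left.
have [W0|W0] := pselect (ract pi (osc_W q) e0 = 0); last first.
  by apply: (@free_orbit_induced _ _ q_gt0 _ pi e0) => //; right.
have Wc : osc_comp 0 (osc_W q) by exact: osc_poly_comp.
have e00 : e0 != 0 by apply: contra_eq_neq e0_unit => ->; rewrite inner0l eq_sym oner_eq0.
have evW : ev chi (osc_W q) = 0.
  by move: W0; rewrite eig // => /eqP; rewrite scaler_eq0 (negbTE e00) orbF => /eqP.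
have t1 : (1 - q) * t = 1.
  move: evW; rewrite ev_poly ?tauE //; last exact: pos_char.
  rewrite hornerD hornerZ hornerX hornerN hornerC chit => /eqP.
  rewrite subr_eq0 => /eqP; rewrite -[1 - _]/(1%:C%C - q%:C%C) -rmorphB -rmorphM.
  by move=> /complexI.
(* The set {t} is invariant and not null, so the zero-one law makes its complement null; the
   eigenvalue equation then holds on all of D(pi). *)
have DT v : P D v = v.
  have [|s|//|nC] := @tau_zero_one _ _ q_gt0 _ pi P P_sm P_cov pi_irreducible [set t].
  - exact: measurable_set1.
  - split=> /= st; last by rewrite st; lra.
    have q1' : 1 - q != 0 by rewrite subr_eq0; apply/eqP => /esym.
    by apply: (mulfI (lt0r_neq0 q_gt0)); lra.
  have := spectral_complement P_sm v (@measurable_posX R q) mD DX.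
  have -> : @positive_characters R _ (osc_grading q) `\` D = tau_set (~` [set t]).
    by apply/seteqP; split=> x [Xx nx]; split=> //; [move=> tx; apply: nx|case].
  by rewrite nC => /esym/eqP; rewrite subr_eq0 => /eqP/esym.
apply: (fixed_point_induced (pi := pi) (e0 := e0)) => // v dv.
by rewrite eig // evW scale0r.
Qed.
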